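(* Let $a,\lambda\in\mathbb C$ be such that the quadratic polynomial $q(z):=1+az+\lambda z^2$ has no zeros on the closed unit disc $\overline{\mathbb D}$ (equivalently, $|\lambda|<1$ and $|a-\bar a\lambda|<1-|\lambda|^2$). Given $c>0$, let $F:\mathbb D\to\mathbb C$ be the holomorphic map determined by $F(0)=0$ and $F'(z)=\dfrac{c}{1+az+\lambda z^2}$. Then $F$ is a biholomorphic map onto the bounded strongly convex domain $D=F(\mathbb D)$, and $M_D(0)=|F'(0)|=c$. Moreover, the harmonic maps $f:\mathbb D\to D$ with $f(0)=0$ and $df_0$ conformal that attain $\|df_0\|=M_D(0)$ are exactly the maps \[ z\longmapsto F(e^{i\theta}z)\quad\text{and}\quad z\longmapsto F(e^{i\theta}\bar z),\qquad \theta\in\mathbb R. \]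
   Context: $\mathbb D=\{z\in\mathbb C:|z|<1\}$. For a domain $D\subset\mathbb C$ and $p\in D$, $M_D(p)$ denotes the supremum of the operator norms $\|df_0\|$ over all harmonic maps $f:\mathbb D\to D$ with $f(0)=p$ whose differential $df_0:\mathbb R^2\to\mathbb R^2$ at $0$ is conformal (i.e. a nonnegative multiple of an orthogonal linear map, orientation preserving or reversing). *)

(* Defs.v *)
From Stdlib Require Import Reals.
From Coquelicot Require Import Coquelicot.

Open Scope R_scope.

Definition unit_disc (z : C) : Prop := Cmod z < 1.

Definition cderiv (F : C -> C) (z : C) (l : C) : Prop :=
  @is_derive C_AbsRing C_NormedModule F z l.

Definition holomorphic_on (U : C -> Prop) (F : C -> C) : Prop :=
  forall z, U z -> exists l, cderiv F z l.

Definition cis (t : R) : C := (cos t, sin t).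

Definition uncurry2 (u : R -> R -> R) : R * R -> R := fun p => u (fst p) (snd p).

Definition dx (u : R -> R -> R) : R -> R -> R := fun x y => Derive (fun t => u t y) x.
Definition dy (u : R -> R -> R) : R -> R -> R := fun x y => Derive (fun t => u x t) y.

Definition C1_on (U : C -> Prop) (u : R -> R -> R) : Prop :=
  forall x y, U (x, y) ->
    ex_derive (fun t => u t y) x /\ ex_derive (fun t => u x t) y /\
    continuous (uncurry2 u) (x, y) /\
    continuous (uncurry2 (dx u)) (x, y) /\ continuous (uncurry2 (dy u)) (x, y).

Definition C2_on (U : C -> Prop) (u : R -> R -> R) : Prop :=
  C1_on U u /\ C1_on U (dx u) /\ C1_on U (dy u).

Definition re_part (f : C -> C) : R -> R -> R := fun x y => fst (f (x, y)).
Definition im_part (f : C -> C) : R -> R -> R := fun x y => snd (f (x, y)).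

Definition harmonic_on (U : C -> Prop) (f : C -> C) : Prop :=
  C2_on U (re_part f) /\ C2_on U (im_part f) /\
  forall x y, U (x, y) ->
    dx (dx (re_part f)) x y + dy (dy (re_part f)) x y = 0 /\
    dx (dx (im_part f)) x y + dy (dy (im_part f)) x y = 0.

Record mat2 := Mat2 { m11 : R; m12 : R; m21 : R; m22 : R }.

Definition diff_at (f : C -> C) (x y : R) : mat2 :=
  Mat2 (dx (re_part f) x y) (dy (re_part f) x y)
       (dx (im_part f) x y) (dy (im_part f) x y).

Definition orthogonal2 (O : mat2) : Prop :=
  m11 O * m11 O + m21 O * m21 O = 1 /\
  m12 O * m12 O + m22 O * m22 O = 1 /\
  m11 O * m12 O + m21 O * m22 O = 0.

Definition conformal2 (L : mat2) : Prop :=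
  exists k O, 0 <= k /\ orthogonal2 O /\
    m11 L = k * m11 O /\ m12 L = k * m12 O /\
    m21 L = k * m21 O /\ m22 L = k * m22 O.

Definition opnorm (L : mat2) : Rbar :=
  Lub_Rbar (fun r => exists v1 v2, v1 * v1 + v2 * v2 = 1 /\
    r = sqrt ((m11 L * v1 + m12 L * v2) ^ 2 + (m21 L * v1 + m22 L * v2) ^ 2)).

Definition admissible (D : C -> Prop) (p : C) (f : C -> C) : Prop :=
  harmonic_on unit_disc f /\ (forall z, unit_disc z -> D (f z)) /\
  f (0, 0) = p /\ conformal2 (diff_at f 0 0).

Definition M_D (D : C -> Prop) (p : C) : Rbar :=
  Lub_Rbar (fun r => exists f, admissible D p f /\ opnorm (diff_at f 0 0) = Finite r).

Definition open_set (D : C -> Prop) : Prop :=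
  forall p, D p -> exists eps, 0 < eps /\ forall q, Cmod (Cminus q p) < eps -> D q.

Definition connected_set (D : C -> Prop) : Prop :=
  forall A B : C -> Prop, open_set A -> open_set B ->
    (forall p, D p -> A p \/ B p) ->
    (forall p, ~ (D p /\ A p /\ B p)) ->
    (exists p, D p /\ A p) -> (exists p, D p /\ B p) -> False.

Definition plane_domain (D : C -> Prop) : Prop :=
  open_set D /\ connected_set D /\ exists p, D p.

Definition bounded_set (D : C -> Prop) : Prop :=
  exists M, forall p, D p -> Cmod p <= M.

Definition boundary_pt (D : C -> Prop) (p : C) : Prop :=
  ~ D p /\ forall eps, 0 < eps -> exists q, Cmod (Cminus q p) < eps /\ D q.

(* strongly convex: C^2 boundary with a local defining function rho whose
   real Hessian is positive definite on the tangent space at boundary points *)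
Definition strongly_convex (D : C -> Prop) : Prop :=
  exists (U : C -> Prop) (rho : R -> R -> R),
    open_set U /\ (forall p, boundary_pt D p -> U p) /\
    C2_on U rho /\
    (forall x y, U (x, y) -> (D (x, y) <-> rho x y < 0)) /\
    (forall x y, boundary_pt D (x, y) ->
       (dx rho x y <> 0 \/ dy rho x y <> 0) /\
       forall w1 w2, (w1 <> 0 \/ w2 <> 0) ->
         w1 * dx rho x y + w2 * dy rho x y = 0 ->
         dx (dx rho) x y * w1 * w1 + 2 * dy (dx rho) x y * w1 * w2
           + dy (dy rho) x y * w2 * w2 > 0).

Definition biholomorphic (U V : C -> Prop) (F : C -> C) : Prop :=
  holomorphic_on U F /\ (forall z, U z -> V (F z)) /\
  exists G : C -> C, holomorphic_on V G /\ (forall w, V w -> U (G w)) /\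
    (forall z, U z -> G (F z) = z) /\ (forall w, V w -> F (G w) = w).

(* Main.v *)
Require Import Defs.
From Stdlib Require Import Reals Lra Psatz Classical.
From Coquelicot Require Import Coquelicot.
Import Defs.
Open Scope R_scope.

(** Write q(z) = (1 - al z)(1 - be z).  Then F extends to a disc of radius R1 > 1,
    and D = {rho < 0} for an explicit rho: if al <> be, then exp maps a multiple m w
    of the points w of D onto a disc avoiding 0, which in the coordinates
    X + i Y = m w reads A e^X + B e^(-X) < 2 |E| cos (Y + eta); if al = be, then D is a
    disc.  In both cases rho = phi(X) + psi(Y) with phi and psi uniformly convex on the
    relevant region, and grad rho is a positive multiple of zeta F'(zeta) at
    F(zeta), |zeta| = 1.  As F' = c / q, convexity of D becomes
      Re (conj zeta * q(zeta) * (w - F(zeta))) <= - delta |w - F(zeta)|^2   for w in D.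
    On the circle conj zeta * q(zeta) = conj zeta + a + lam zeta has frequencies
    -1, 0, 1 only.  So for a harmonic f : disc -> D with f(0) = 0, normalised by a rotation
    or reflection of the disc so that its differential at 0 is k times the identity,
    putting w = f(r zeta) and integrating over the circle gives
      2 pi (r k - c) <= - delta int |f(r zeta) - F(zeta)|^2.
    Hence k <= c; and if k = c, the mean of |f - F|^2 over the circle of radius r, which
    increases with r, tends to 0 as r -> 1, so f = F. *)

(** * Partial derivatives and complex derivatives *)

(** [F] is given on the open disc only, while the inequality is needed at boundary points F(zeta).
    Hence an explicit primitive [Ft] of c/q is built on a larger disc, and uniqueness of primitives
    identifies it with [F] inside. No boundary values are available for f: f is taken at r zeta and
    [Ft] at zeta, and r tends to 1 only after integration. In the integral, the weight conj zeta
    reads off the holomorphic derivative at 0, the weight a meets f(0) = 0, and the weight lam zeta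
    meets the antiholomorphic derivative, which is 0 because the normalised differential is
    conformal. For al <> be, partial fractions give m F = log((1 - be z)/(1 - al z)) with m = (al -
    be)/c, so T = exp(m w) is a Moebius function of z with inverse z = (T - 1)/(al T - be). The
    condition |z| < 1 reads |T - 1|^2 < |al T - be|^2, and dividing by |T| = e^X separates X from Y;
    this is the origin of A = 1 - |al|^2, B = 1 - |be|^2 and E = 1 - al conj be. As exp is not
    injective, Y has to be confined to a strip; and m vanishes when al = be, which makes that case
    separate. *)

Lemma Cmod_sqr (z : C) : Cmod z ^ 2 = fst z ^ 2 + snd z ^ 2.
Proof. unfold Cmod. rewrite pow2_sqrt; nra. Qed.

Lemma Cmod_le_abs (z : C) : Cmod z <= Rabs (fst z) + Rabs (snd z).
Proof.
  pose proof (Cmod_sqr z). pose proof (Cmod_ge_0 z).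
  pose proof (Rabs_pos (fst z)). pose proof (Rabs_pos (snd z)).
  pose proof (pow2_abs (fst z)). pose proof (pow2_abs (snd z)). nra.
Qed.

Lemma open_set_locally_2d (U : C -> Prop) (x y : R) :
  open_set U -> U (x, y) -> locally_2d (fun u v => U (u, v)) x y.
Proof.
  intros HU Hp. destruct (HU _ Hp) as [e [He H]].
  assert (He2 : 0 < e / 2) by lra.
  exists (mkposreal _ He2); simpl; intros u v Hu Hv.
  apply H. eapply Rle_lt_trans; [apply Cmod_le_abs|]. simpl.
  replace (u + - x) with (u - x) by ring. replace (v + - y) with (v - y) by ring. lra.
Qed.

Lemma open_set_lines (U : C -> Prop) (x y : R) :
  open_set U -> U (x, y) ->
  locally x (fun t => U (t, y)) /\ locally y (fun t => U (x, t)).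
Proof.
  intros HU Hp. destruct (open_set_locally_2d U x y HU Hp) as [d Hd].
  split; exists d; intros t Ht; apply Hd;
    try (rewrite Rminus_eq_0, Rabs_R0; apply cond_pos); exact Ht.
Qed.

Lemma disc_open (r : R) : open_set (fun z : C => Cmod z < r).
Proof.
  intros p Hp. exists (r - Cmod p). split; [lra|]. intros q Hq.
  pose proof (Cmod_triangle p (Cminus q p)) as Ht.
  replace (Cplus p (Cminus q p)) with q in Ht by ring. lra.
Qed.

Section Partials.
Variable U : C -> Prop.
Hypothesis HU : open_set U.

Lemma dx_ext (u v : R -> R -> R) : (forall x y, U (x, y) -> u x y = v x y) ->
  forall x y, U (x, y) -> dx u x y = dx v x y.
Proof.
  intros Huv x y Hp. apply Derive_ext_loc.
  eapply filter_imp; [|exact (proj1 (open_set_lines U x y HU Hp))]. simpl; auto.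
Qed.

Lemma dy_ext (u v : R -> R -> R) : (forall x y, U (x, y) -> u x y = v x y) ->
  forall x y, U (x, y) -> dy u x y = dy v x y.
Proof.
  intros Huv x y Hp. apply Derive_ext_loc.
  eapply filter_imp; [|exact (proj2 (open_set_lines U x y HU Hp))]. simpl; auto.
Qed.

Lemma continuous_uncurry2 (u : R -> R -> R) (x y : R) :
  continuous (uncurry2 u) (x, y) <-> continuity_2d_pt u x y.
Proof. symmetry. apply continuity_2d_pt_filterlim. Qed.

Lemma continuity_2d_pt_ext_on (u v : R -> R -> R) : (forall x y, U (x, y) -> u x y = v x y) ->
  forall x y, U (x, y) -> continuity_2d_pt u x y -> continuity_2d_pt v x y.
Proof.
  intros Huv x y Hp. apply continuity_2d_pt_ext_loc.
  destruct (open_set_locally_2d U x y HU Hp) as [d Hd]. exists d; auto.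
Qed.

Lemma C1_on_ext (u v : R -> R -> R) : (forall x y, U (x, y) -> u x y = v x y) ->
  C1_on U u -> C1_on U v.
Proof.
  intros Huv H x y Hp. destruct (H x y Hp) as [H1 [H2 [H3 [H4 H5]]]].
  destruct (open_set_lines U x y HU Hp) as [L1 L2].
  rewrite !continuous_uncurry2 in *.
  repeat split.
  - eapply ex_derive_ext_loc; [|exact H1]. eapply filter_imp; [|exact L1]. simpl; auto.
  - eapply ex_derive_ext_loc; [|exact H2]. eapply filter_imp; [|exact L2]. simpl; auto.
  - eapply continuity_2d_pt_ext_on; eauto.
  - eapply continuity_2d_pt_ext_on; [|exact Hp|exact H4].
    now apply dx_ext.
  - eapply continuity_2d_pt_ext_on; [|exact Hp|exact H5].
    now apply dy_ext.
Qed.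

Lemma C2_on_ext (u v : R -> R -> R) : (forall x y, U (x, y) -> u x y = v x y) ->
  C2_on U u -> C2_on U v.
Proof.
  intros Huv [H0 [H1 H2]]. split; [|split].
  - eapply C1_on_ext; eauto.
  - eapply C1_on_ext; [|exact H1]. now apply dx_ext.
  - eapply C1_on_ext; [|exact H2]. now apply dy_ext.
Qed.

(** Existence of both partials together with continuity of [dx u] gives a total differential, the
    form in which the chain rule applies. *)
Lemma C1_on_differentiable (u : R -> R -> R) (x y : R) : C1_on U u -> U (x, y) ->
  differentiable_pt_lim u x y (dx u x y) (dy u x y).
Proof.
  intros H Hp. destruct (H x y Hp) as [_ [H2 [_ [H4 _]]]].
  apply filterdiff_differentiable_pt_lim.
  eapply filterdiff_ext_lin; [eapply (is_derive_filterdiff u x y (dx u) (dy u x y))|].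
  - apply (locally_2d_locally (fun a b => is_derive (fun z => u z b) a (dx u a b))).
    destruct (open_set_locally_2d U x y HU Hp) as [d Hd]. exists d. intros a b Ha Hb.
    apply Derive_correct. apply (H a b). auto.
  - now apply Derive_correct.
  - exact H4.
  - reflexivity.
Qed.

Lemma C1_on_intro (u ux uy : R -> R -> R) :
  (forall x y, U (x, y) -> differentiable_pt_lim u x y (ux x y) (uy x y)) ->
  (forall x y, U (x, y) -> continuity_2d_pt ux x y /\ continuity_2d_pt uy x y) ->
  C1_on U u /\ (forall x y, U (x, y) -> dx u x y = ux x y /\ dy u x y = uy x y).
Proof.
  intros Hd Hc.
  assert (E : forall x y, U (x, y) -> dx u x y = ux x y /\ dy u x y = uy x y).
  { intros x y Hp. exact (differentiable_pt_lim_unique _ _ _ _ _ (Hd x y Hp)). }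
  split; [|exact E]. intros x y Hp. pose proof (Hd x y Hp) as D.
  rewrite !continuous_uncurry2. repeat split.
  - exists (ux x y * 1 + uy x y * 0). apply is_derive_Reals.
    apply (derivable_pt_lim_comp_2d u (fun t => t) (fun _ => y)); auto.
    + apply derivable_pt_lim_id.
    + apply derivable_pt_lim_const.
  - exists (ux x y * 0 + uy x y * 1). apply is_derive_Reals.
    apply (derivable_pt_lim_comp_2d u (fun _ => x) (fun t => t)); auto.
    + apply derivable_pt_lim_const.
    + apply derivable_pt_lim_id.
  - apply differentiable_continuity_pt. now exists (ux x y), (uy x y).
  - eapply continuity_2d_pt_ext_on; [|exact Hp|exact (proj1 (Hc x y Hp))].
    intros; symmetry; now apply E.
  - eapply continuity_2d_pt_ext_on; [|exact Hp|exact (proj2 (Hc x y Hp))].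
    intros; symmetry; now apply E.
Qed.

(** All regularity claims below go through this converse: explicit candidates for the partials are
    checked as total differentials, and the values of the iterated [Derive] follow. *)
Lemma C2_on_intro (u ux uy uxx uxy uyx uyy : R -> R -> R) :
  (forall x y, U (x, y) -> differentiable_pt_lim u x y (ux x y) (uy x y)) ->
  (forall x y, U (x, y) -> differentiable_pt_lim ux x y (uxx x y) (uxy x y)) ->
  (forall x y, U (x, y) -> differentiable_pt_lim uy x y (uyx x y) (uyy x y)) ->
  (forall x y, U (x, y) -> continuity_2d_pt uxx x y /\ continuity_2d_pt uxy x y /\
                           continuity_2d_pt uyx x y /\ continuity_2d_pt uyy x y) ->
  C2_on U u /\
  (forall x y, U (x, y) -> dx u x y = ux x y /\ dy u x y = uy x y /\
     dx (dx u) x y = uxx x y /\ dy (dx u) x y = uxy x y /\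
     dx (dy u) x y = uyx x y /\ dy (dy u) x y = uyy x y).
Proof.
  intros H0 H1 H2 Hc.
  destruct (C1_on_intro u ux uy H0) as [C E].
  { intros x y Hp. split; apply differentiable_continuity_pt; eexists; eexists; eauto. }
  destruct (C1_on_intro ux uxx uxy H1) as [Cx Ex]; [intros x y Hp; now destruct (Hc x y Hp)|].
  destruct (C1_on_intro uy uyx uyy H2) as [Cy Ey]; [intros x y Hp; now destruct (Hc x y Hp)|].
  assert (E1 : forall x y, U (x, y) -> ux x y = dx u x y) by (intros; symmetry; now apply E).
  assert (E2 : forall x y, U (x, y) -> uy x y = dy u x y) by (intros; symmetry; now apply E).
  split.
  - split; [exact C|split].
    + now apply C1_on_ext with ux.
    + now apply C1_on_ext with uy.
  - intros x y Hp. destruct (E x y Hp). destruct (Ex x y Hp). destruct (Ey x y Hp).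
    rewrite <- (dx_ext _ _ E1 x y Hp), <- (dy_ext _ _ E1 x y Hp),
            <- (dx_ext _ _ E2 x y Hp), <- (dy_ext _ _ E2 x y Hp). tauto.
Qed.

End Partials.

(** The Cauchy-Riemann form: the real Jacobian matrix is that of multiplication by [l]. *)
Definition holo_pair (F : C -> C) (x y : R) (l : C) : Prop :=
  differentiable_pt_lim (re_part F) x y (fst l) (- snd l) /\
  differentiable_pt_lim (im_part F) x y (snd l) (fst l).

Lemma cderiv_iff (F : C -> C) (x y : R) (l : C) :
  cderiv F (x, y) l <-> holo_pair F x y l.
Proof.
  split.
  - intros [_ H]. specialize (H (x, y) (fun P HP => HP)).
    assert (K : forall eps : posreal, locally_2d (fun u v =>
       Cmod (Cminus (Cminus (F (u, v)) (F (x, y))) (Cmult (Cminus (u, v) (x, y)) l))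
         <= eps * Rmax (Rabs (u - x)) (Rabs (v - y))) x y).
    (* Halving [eps] pays for the factor 2 between [Cmod] and the maximum norm of
       [differentiable_pt_lim]; the converse direction halves it to add the two components. *)
    { intros eps. assert (He : 0 < eps / 2) by (pose proof (cond_pos eps); lra).
      destruct (H (mkposreal _ He)) as [d Hd].
      assert (Hd2 : 0 < d / 2) by (pose proof (cond_pos d); lra).
      exists (mkposreal _ Hd2). simpl. intros u v Hu Hv.
      assert (B : Cmod (Cminus (u, v) (x, y)) < d).
      { eapply Rle_lt_trans; [apply Cmod_le_abs|]. unfold Rminus in *. simpl. lra. }
      specialize (Hd (u, v) B).
      eapply Rle_trans; [exact Hd|]. simpl.
      assert (B2 : Cmod (Cminus (u, v) (x, y)) <= 2 * Rmax (Rabs (u - x)) (Rabs (v - y))).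
      { eapply Rle_trans; [apply Cmod_le_abs|]. unfold Rminus in *. simpl.
        pose proof (Rmax_l (Rabs (u + - x)) (Rabs (v + - y))).
        pose proof (Rmax_r (Rabs (u + - x)) (Rabs (v + - y))). lra. }
      change (norm (minus ((u, v) : C_AbsRing) (x, y))) with (Cmod (Cminus (u, v) (x, y))).
      pose proof (cond_pos eps). nra. }
    split; intros eps; destruct (K eps) as [d Hd]; exists d; intros u v Hu Hv;
      specialize (Hd u v Hu Hv); (eapply Rle_trans; [|exact Hd]);
      (eapply Rle_trans; [|apply Rmax_Cmod]); unfold re_part, im_part.
    + eapply Rle_trans; [|apply Rmax_l]. right. f_equal. simpl. ring.
    + eapply Rle_trans; [|apply Rmax_r]. right. f_equal. simpl. ring.
  - intros [H1 H2]. split.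
    + apply is_linear_scal_l.
    + intros z Hz eps.
      assert (Ez : z = (x, y)).
      { symmetry. apply (is_filter_lim_locally_unique (V := AbsRing_NormedModule C_AbsRing)). exact Hz. }
      subst z.
      assert (He : 0 < eps / 2) by (pose proof (cond_pos eps); lra).
      destruct (H1 (mkposreal _ He)) as [d1 D1]. destruct (H2 (mkposreal _ He)) as [d2 D2].
      assert (Hd : 0 < Rmin d1 d2) by (apply Rmin_pos; apply cond_pos).
      exists (mkposreal _ Hd). intros [u v] B. simpl in *.
      change (Cmod (Cminus (u, v) (x, y)) < Rmin d1 d2) in B.
      pose proof (Rmax_Cmod (Cminus (u, v) (x, y))) as M. 
      pose proof (Rmin_l d1 d2). pose proof (Rmin_r d1 d2).
      unfold re_part, im_part in *. unfold Rminus in *. simpl in M.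
      pose proof (Rmax_l (Rabs (u + - x)) (Rabs (v + - y))).
      pose proof (Rmax_r (Rabs (u + - x)) (Rabs (v + - y))).
      specialize (D1 u v ltac:(lra) ltac:(lra)). specialize (D2 u v ltac:(lra) ltac:(lra)).
      change (Cmod (Cminus (Cminus (F (u, v)) (F (x, y))) (Cmult (Cminus (u, v) (x, y)) l))
               <= eps * Cmod (Cminus (u, v) (x, y))).
      eapply Rle_trans; [apply Cmod_le_abs|].
      replace (fst (Cminus (Cminus (F (u, v)) (F (x, y))) (Cmult (Cminus (u, v) (x, y)) l)))
        with (fst (F (u, v)) + - fst (F (x, y)) + - (fst l * (u + - x) + - snd l * (v + - y)))
        by (simpl; ring).
      replace (snd (Cminus (Cminus (F (u, v)) (F (x, y))) (Cmult (Cminus (u, v) (x, y)) l)))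
        with (snd (F (u, v)) + - snd (F (x, y)) + - (snd l * (u + - x) + fst l * (v + - y)))
        by (simpl; ring).
      pose proof (cond_pos eps). nra.
Qed.

(** * Integrals over the circle in polar coordinates *)

Lemma continuity_2d_slice (f : R -> R -> R) (r t : R) :
  continuity_2d_pt f r t -> continuous (f r) t.
Proof.
  intros H. apply continuity_pt_filterlim.
  intros e He. destruct (H (mkposreal e He)) as [d Hd].
  exists d. split; [apply cond_pos|]. intros s [_ Hs]. simpl in *. unfold R_dist in *.
  apply Hd; auto. rewrite Rminus_eq_0, Rabs_R0. apply cond_pos.
Qed.

Lemma continuity_2d_pt_of_1d (f : R -> R) (r t : R) :
  continuous f t -> continuity_2d_pt (fun _ s => f s) r t.
Proof.
  intros H. apply (continuity_1d_2d_pt_comp f (fun _ s => s)).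
  - now apply continuity_pt_filterlim.
  - apply continuity_2d_pt_id2.
Qed.

Ltac cont2 := repeat first
  [ assumption | apply continuity_2d_pt_plus | apply continuity_2d_pt_minus
  | apply continuity_2d_pt_mult | apply continuity_2d_pt_opp | apply continuity_2d_pt_const
  | apply continuity_2d_pt_id1 | apply continuity_2d_pt_id2
  | apply continuity_2d_pt_of_1d; solve [auto] | solve [auto] ].

(** Continuity in the angle at a fixed radius: the goal is abstracted over the radius and joint
    continuity is proved instead, since that is what the hypotheses supply. *)
Ltac cslice r := match goal with |- continuous ?g ?t =>
  let g' := eval pattern r in g in
  match g' with ?h _ => apply (continuity_2d_slice h r t); cbv beta; cont2 end end.

Ltac ex_der := repeat match goal with
  | |- _ /\ _ => split | |- True => exact I | |- ex_derive _ _ => eexists; eassumption end.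

Definition Icirc (f : R -> R) : R := RInt f 0 (2 * PI).

Lemma two_PI_pos : 0 < 2 * PI.
Proof. pose proof PI_RGT_0; lra. Qed.

Section Icirc_algebra.
Variables f g : R -> R.
Hypothesis Cf : forall t, continuous f t.
Hypothesis Cg : forall t, continuous g t.

Lemma ex_Icirc : ex_RInt f 0 (2 * PI).
Proof. apply (ex_RInt_continuous (V := R_CompleteNormedModule)). auto. Qed.

Lemma Icirc_plus : Icirc (fun t => f t + g t) = Icirc f + Icirc g.
Proof. apply (RInt_plus f g); apply (ex_RInt_continuous (V := R_CompleteNormedModule)); auto. Qed.

Lemma Icirc_scal (k : R) : Icirc (fun t => k * f t) = k * Icirc f.
Proof. apply (RInt_scal f 0 (2 * PI) k). apply ex_Icirc. Qed.

Lemma Icirc_le : (forall t, f t <= g t) -> Icirc f <= Icirc g.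
Proof.
  intros H. pose proof two_PI_pos.
  apply RInt_le; auto; try lra; apply (ex_RInt_continuous (V := R_CompleteNormedModule)); auto.
Qed.

Lemma Icirc_ext : (forall t, f t = g t) -> Icirc f = Icirc g.
Proof. intros H. apply RInt_ext. auto. Qed.

Lemma Icirc_const (k : R) : Icirc (fun _ => k) = 2 * PI * k.
Proof. unfold Icirc. rewrite RInt_const. unfold scal; simpl; unfold mult; simpl. ring. Qed.

Lemma Icirc_derive (F : R -> R) : (forall t, is_derive F t (f t)) ->
  Icirc f = F (2 * PI) - F 0.
Proof. intros H. apply is_RInt_unique. apply (is_RInt_derive F f); auto. Qed.

Lemma Icirc_nonneg_eq_0 : (forall t, 0 <= f t) -> Icirc f <= 0 ->
  forall t, 0 < t < 2 * PI -> f t = 0.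
Proof.
  intros Hp H0 t Ht.
  destruct (Req_dec (f t) 0) as [|Hn]; auto. exfalso.
  assert (Hft : 0 < f t) by (specialize (Hp t); lra).
  pose proof (Cf t) as Ct. apply continuity_pt_filterlim in Ct.
  destruct (Ct (f t / 2) ltac:(lra)) as [d [Hd Dd]]. simpl in Dd. unfold R_dist in Dd.
  (* Small enough for [t - e, t + e] to lie inside the interval of integration and inside the
     neighbourhood where [f] exceeds [f t / 2]. *)
  set (e := Rmin (d / 2) (Rmin t (2 * PI - t) / 2)).
  assert (He : 0 < e).
  { unfold e. apply Rmin_pos; [lra|]. assert (0 < Rmin t (2 * PI - t)) by (apply Rmin_pos; lra). lra. }
  assert (He1 : e <= d / 2) by apply Rmin_l.
  assert (He2 : e <= t / 2 /\ e <= (2 * PI - t) / 2).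
  { pose proof (Rmin_r (d / 2) (Rmin t (2 * PI - t) / 2)). fold e in H.
    pose proof (Rmin_l t (2 * PI - t)). pose proof (Rmin_r t (2 * PI - t)). lra. }
  assert (Hint : forall a b, ex_RInt f a b) by (intros; apply (ex_RInt_continuous (V := R_CompleteNormedModule)); auto).
  assert (E : Icirc f = RInt f 0 (t - e) + (RInt f (t - e) (t + e) + RInt f (t + e) (2 * PI))).
  { unfold Icirc. rewrite <- (RInt_Chasles f 0 (t - e) (2 * PI)) by auto.
    rewrite <- (RInt_Chasles f (t - e) (t + e) (2 * PI)) by auto. reflexivity. }
  assert (0 <= RInt f 0 (t - e)) by (apply RInt_ge_0; auto; lra).
  assert (0 <= RInt f (t + e) (2 * PI)) by (apply RInt_ge_0; auto; lra).
  assert (0 < RInt f (t - e) (t + e)).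
  { apply RInt_gt_0; auto; [lra|]. intros s Hs.
    destruct (Req_dec s t) as [->|Hst]; auto.
    assert (A : Rabs (f s - f t) < f t / 2).
    { apply Dd. split; [split; [exact I|auto]|]. apply Rabs_def1; lra. }
    apply Rabs_def2 in A. lra. }
  lra.
Qed.
End Icirc_algebra.

Lemma is_derive_Icirc (f f' : R -> R -> R) (R0 r : R) :
  (forall r t, Rabs r < R0 -> is_derive (fun s => f s t) r (f' r t)) ->
  (forall r t, Rabs r < R0 -> continuity_2d_pt f r t) ->
  (forall r t, Rabs r < R0 -> continuity_2d_pt f' r t) ->
  Rabs r < R0 -> is_derive (fun s => Icirc (f s)) r (Icirc (f' r)).
Proof.
  intros Hd Hc Hc' Hr.
  assert (L : locally r (fun s => Rabs s < R0)).
  { assert (K : forall s : R, Rabs (s - r) < R0 - Rabs r -> Rabs s < R0).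
    { intros s Hs. pose proof (Rabs_triang (s - r) r) as T.
      replace (s - r + r) with s in T by ring. lra. }
    exists (mkposreal (R0 - Rabs r) ltac:(lra)). exact K. }
  replace (Icirc (f' r)) with (Icirc (fun t => Derive (fun u => f u t) r)).
  2:{ apply RInt_ext. intros t _. apply is_derive_unique. auto. }
  apply (is_derive_RInt_param f 0 (2 * PI) r).
  - eapply filter_imp; [|exact L]. intros s Hs t _. exists (f' s t). auto.
  - intros t _. eapply continuity_2d_pt_ext_loc; [|apply (Hc' r t Hr)].
    destruct L as [d Hd2]. exists d. intros u v Hu _. symmetry. apply is_derive_unique.
    apply Hd. apply Hd2. exact Hu.
  - eapply filter_imp; [|exact L]. intros s Hs. apply (ex_RInt_continuous (V := R_CompleteNormedModule)).
    intros t _. apply continuity_2d_slice. auto.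
Qed.

(** * Mean value arguments and the Euler equation *)

Lemma MVT_open (f df : R -> R) (a b : R) : a < b ->
  (forall x, a <= x <= b -> is_derive f x (df x)) ->
  exists c, a <= c <= b /\ f b - f a = df c * (b - a).
Proof.
  intros Hab Hd. 
  destruct (MVT_gen f a b df) as [c Hc].
  - rewrite Rmin_left, Rmax_right by lra. intros; apply Hd; lra.
  - rewrite Rmin_left, Rmax_right by lra. intros x Hx.
    apply continuity_pt_filterlim. apply (ex_derive_continuous f). exists (df x). auto.
  - rewrite Rmin_left, Rmax_right in Hc by lra. now exists c.
Qed.

Lemma derive_nonneg_incr (f df : R -> R) (a b : R) : a < b ->
  (forall x, a <= x <= b -> is_derive f x (df x)) ->
  (forall x, a < x < b -> 0 <= df x) -> f a <= f b.
Proof.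
  intros Hab Hd Hp.
  destruct (MVT_cor2 f df a b Hab) as [c [Hc Hc2]].
  { intros x Hx. apply is_derive_Reals. auto. }
  specialize (Hp c Hc2). nra.
Qed.

Lemma derive_zero_const (f df : R -> R) (a b : R) : a < b ->
  (forall x, a <= x <= b -> is_derive f x (df x)) ->
  (forall x, a < x < b -> df x = 0) -> f b = f a.
Proof.
  intros Hab Hd Hp.
  destruct (MVT_cor2 f df a b Hab) as [c [Hc Hc2]].
  { intros x Hx. apply is_derive_Reals. auto. }
  specialize (Hp c Hc2). rewrite Hp in Hc. lra.
Qed.

(** For a harmonic function the circle averages [A] against [1], and against [cos] or [sin],
    satisfy the Euler equation [r^2 A'' + r A' = n^2 A] with [n = 0], respectively [n = 1]. *)
Section Euler.
Variables (A A1 A2 : R -> R) (R0 : R).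
Hypothesis HA : forall r, Rabs r < R0 -> is_derive A r (A1 r).
Hypothesis HA1 : forall r, Rabs r < R0 -> is_derive A1 r (A2 r).

(** The equation is r (r A')' = 0, so r A' is constant; it vanishes at 0 because [A] is
    differentiable across the centre, which excludes the solution log r. *)
Lemma euler_order_0 : (forall r, Rabs r < R0 -> r ^ 2 * A2 r + r * A1 r = 0) ->
  forall r, 0 <= r < R0 -> A r = A 0.
Proof.
  intros E r Hr. destruct (Req_dec r 0) as [->|Hr0]; auto.
  assert (Z : forall s, 0 < s <= r -> A1 s = 0).
  { intros s Hs.
    assert (s * A1 s = 0 * A1 0).
    { apply (derive_zero_const (fun x => x * A1 x) (fun x => A1 x + x * A2 x)); [lra| |].
      - intros x Hx. assert (Hx' : Rabs x < R0) by (rewrite Rabs_right; lra).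
        pose proof (HA1 x Hx') as D. auto_derive; [now exists (A2 x)|].
        replace (Derive (fun x0 => A1 x0) x) with (A2 x)
          by (symmetry; now apply is_derive_unique). ring.
      - intros x Hx. specialize (E x ltac:(rewrite Rabs_right; lra)). nra. }
    nra. }
  apply (derive_zero_const A A1); [lra| |].
  - intros x Hx. apply HA. rewrite Rabs_right; lra.
  - intros; apply Z; lra.
Qed.

(** The left side is the derivative of r (r A' - A), which vanishes at 0; hence A = r A', and the
    equation then forces A'' = 0 away from 0. Differentiability at the centre excludes the solution
    1/r. *)
Lemma euler_order_1 : (forall r, Rabs r < R0 -> r ^ 2 * A2 r + r * A1 r - A r = 0) ->
  forall r, 0 <= r < R0 -> A r = r * A1 0.
Proof.
  intros E r Hr.
  assert (Z : forall s, 0 < s <= r -> A s = s * A1 s).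
  { intros s Hs.
    assert (s * (s * A1 s - A s) = 0 * (0 * A1 0 - A 0)).
    { apply (derive_zero_const (fun x => x * (x * A1 x - A x)) (fun x => x ^ 2 * A2 x + x * A1 x - A x)); [lra| |].
      - intros x Hx. assert (Hx' : Rabs x < R0) by (rewrite Rabs_right; lra).
        pose proof (HA1 x Hx') as D1. pose proof (HA x Hx') as D0.
        auto_derive; [ex_der|].
        replace (Derive (fun x0 => A1 x0) x) with (A2 x) by (symmetry; now apply is_derive_unique).
        replace (Derive (fun x0 => A x0) x) with (A1 x) by (symmetry; now apply is_derive_unique).
        ring.
      - intros x Hx. apply E. rewrite Rabs_right; lra. }
    nra. }
  destruct (Req_dec r 0) as [->|Hr0].
  { specialize (E 0 ltac:(rewrite Rabs_R0; lra)). lra. }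
  rewrite (Z r) by lra. f_equal.
  apply (derive_zero_const A1 A2); [lra| |].
  - intros x Hx. apply HA1. rewrite Rabs_right; lra.
  - intros x Hx. specialize (E x ltac:(rewrite Rabs_right; lra)). rewrite (Z x) in E by lra. 
    assert (Z2 : x ^ 2 * A2 x = 0) by lra.
    apply Rmult_integral in Z2. destruct Z2; auto. nra.
Qed.
End Euler.

(** In this section [U r t] stands for a harmonic function at [r e^(it)].  Negative [r] is
    allowed, which makes the circle averages differentiable across [r = 0]. *)
Section Polar.
Variables (R0 : R) (U Ur Ut Urr Utt : R -> R -> R).
Hypothesis Dr : forall r t, Rabs r < R0 -> is_derive (fun s => U s t) r (Ur r t).
Hypothesis Drr : forall r t, Rabs r < R0 -> is_derive (fun s => Ur s t) r (Urr r t).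
Hypothesis Dt : forall r t, Rabs r < R0 -> is_derive (U r) t (Ut r t).
Hypothesis Dtt : forall r t, Rabs r < R0 -> is_derive (Ut r) t (Utt r t).
Hypothesis C0 : forall r t, Rabs r < R0 -> continuity_2d_pt U r t.
Hypothesis Cr : forall r t, Rabs r < R0 -> continuity_2d_pt Ur r t.
Hypothesis Ct : forall r t, Rabs r < R0 -> continuity_2d_pt Ut r t.
Hypothesis Crr : forall r t, Rabs r < R0 -> continuity_2d_pt Urr r t.
Hypothesis Ctt : forall r t, Rabs r < R0 -> continuity_2d_pt Utt r t.
Hypothesis P0 : forall r, U r (2 * PI) = U r 0.
Hypothesis Pt : forall r, Ut r (2 * PI) = Ut r 0.
Hypothesis Lap : forall r t, Rabs r < R0 -> r ^ 2 * Urr r t + r * Ur r t + Utt r t = 0.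

Section Weight.
Variables w w1 w2 : R -> R.
Hypothesis Dw : forall t, is_derive w t (w1 t).
Hypothesis Dw1 : forall t, is_derive w1 t (w2 t).
Hypothesis Cw2 : forall t, continuous w2 t.
Hypothesis Pw : w (2 * PI) = w 0.
Hypothesis Pw1 : w1 (2 * PI) = w1 0.

Let Cw : forall t, continuous w t.
Proof. intros t. apply (ex_derive_continuous w). now exists (w1 t). Qed.

Lemma polar_weight_derive (r : R) : Rabs r < R0 ->
  is_derive (fun s => Icirc (fun t => U s t * w t)) r (Icirc (fun t => Ur r t * w t)) /\
  is_derive (fun s => Icirc (fun t => Ur s t * w t)) r (Icirc (fun t => Urr r t * w t)).
Proof.
  intros Hr. split.
  - apply (is_derive_Icirc (fun s t => U s t * w t) (fun s t => Ur s t * w t) R0); auto.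
    + intros s t Hs. pose proof (Dr s t Hs) as D. auto_derive; [now exists (Ur s t)|].
      replace (Derive (fun x => U x t) s) with (Ur s t) by (symmetry; now apply is_derive_unique).
      ring.
    + intros; cont2.
    + intros; cont2.
  - apply (is_derive_Icirc (fun s t => Ur s t * w t) (fun s t => Urr s t * w t) R0); auto.
    + intros s t Hs. pose proof (Drr s t Hs) as D. auto_derive; [now exists (Urr s t)|].
      replace (Derive (fun x => Ur x t) s) with (Urr s t) by (symmetry; now apply is_derive_unique).
      ring.
    + intros; cont2.
    + intros; cont2.
Qed.

(** Two integrations by parts in the angle move [Utt] onto the weight, the boundary terms cancelling
    by periodicity. For w'' = - n^2 w this is the Euler equation of order n. *)
Lemma polar_weight_euler (r : R) : Rabs r < R0 ->
  r ^ 2 * Icirc (fun t => Urr r t * w t) + r * Icirc (fun t => Ur r t * w t)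
    + Icirc (fun t => U r t * w2 t) = 0.
Proof.
  intros Hr.
  assert (B : Icirc (fun t => Utt r t * w t - U r t * w2 t) = 0).
  { rewrite (Icirc_derive _) with (F := fun t => Ut r t * w t - U r t * w1 t).
    - rewrite P0, Pt, Pw, Pw1. ring.
    - intros t. cslice r.
    - intros t. pose proof (Dt r t Hr) as E1. pose proof (Dtt r t Hr) as E2.
      pose proof (Dw t) as E3. pose proof (Dw1 t) as E4.
      auto_derive.
      + ex_der.
      + replace (Derive (fun x => U r x) t) with (Ut r t) by (symmetry; now apply is_derive_unique).
        replace (Derive (fun x => Ut r x) t) with (Utt r t) by (symmetry; now apply is_derive_unique).
        replace (Derive (fun x => w x) t) with (w1 t) by (symmetry; now apply is_derive_unique).
        replace (Derive (fun x => w1 x) t) with (w2 t) by (symmetry; now apply is_derive_unique).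
        ring. }
  rewrite <- !Icirc_scal.
  2,3: intros t; cslice r.
  rewrite <- Icirc_plus.
  2,3: intros t; cslice r.
  rewrite <- Icirc_plus.
  2: intros t; cslice r.
  2: intros t; cslice r.
  rewrite <- (Rmult_0_r (- 1)), <- B, <- Icirc_scal.
  2: intros t; cslice r.
  apply Icirc_ext. intros t.
  replace (Utt r t) with (- (r ^ 2 * Urr r t + r * Ur r t)) by (pose proof (Lap r t Hr); lra).
  ring.
Qed.
End Weight.

Lemma polar_square_derive (r : R) : Rabs r < R0 ->
  is_derive (fun s => Icirc (fun t => U s t ^ 2)) r (2 * Icirc (fun t => U r t * Ur r t)) /\
  is_derive (fun s => Icirc (fun t => U s t * Ur s t)) r
    (Icirc (fun t => Ur r t * Ur r t + U r t * Urr r t)).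
Proof.
  intros Hr. split.
  - rewrite <- Icirc_scal by (intros t; cslice r).
    apply (is_derive_Icirc (fun s t => U s t ^ 2) (fun s t => 2 * (U s t * Ur s t)) R0); auto.
    + intros s t Hs. pose proof (Dr s t Hs) as D. auto_derive; [now exists (Ur s t)|].
      replace (Derive (fun x => U x t) s) with (Ur s t) by (symmetry; now apply is_derive_unique).
      ring.
    + intros s t Hs. apply continuity_2d_pt_ext with (fun s t => U s t * U s t).
      { intros; simpl; ring. } cont2.
    + intros; cont2.
  - apply (is_derive_Icirc (fun s t => U s t * Ur s t) (fun s t => Ur s t * Ur s t + U s t * Urr s t) R0); auto.
    + intros s t Hs. pose proof (Dr s t Hs) as D. pose proof (Drr s t Hs) as D2.
      auto_derive; [ex_der|].
      replace (Derive (fun x => U x t) s) with (Ur s t) by (symmetry; now apply is_derive_unique).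
      replace (Derive (fun x => Ur x t) s) with (Urr s t) by (symmetry; now apply is_derive_unique).
      ring.
    + intros; cont2.
    + intros; cont2.
Qed.

(* [r * (r N)' = int (r U_r)^2 + U_t^2 >= 0] for [N = int U U_r], half the derivative of [int U^2]. *)
Lemma polar_square_incr (r s : R) : 0 < r -> r <= s -> s < R0 ->
  Icirc (fun t => U r t ^ 2) <= Icirc (fun t => U s t ^ 2).
Proof.
  intros Hr Hrs Hs.
  assert (N : forall x, 0 < x < R0 -> 0 <= Icirc (fun t => U x t * Ur x t)).
  { intros x Hx.
    set (N := fun x => Icirc (fun t => U x t * Ur x t)).
    set (N1 := fun x => Icirc (fun t => Ur x t * Ur x t + U x t * Urr x t)).
    assert (0 * N 0 <= x * N x).
    { apply (derive_nonneg_incr (fun x => x * N x) (fun x => N x + x * N1 x)); [lra| |].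
      - intros y Hy. assert (Hy' : Rabs y < R0) by (rewrite Rabs_right; lra).
        pose proof (proj2 (polar_square_derive y Hy')) as D. fold N in D.
        change (is_derive N y (N1 y)) in D.
        auto_derive; [now exists (N1 y)|].
        replace (Derive (fun x0 => N x0) y) with (N1 y) by (symmetry; now apply is_derive_unique). ring.
      - intros y Hy. assert (Hy' : Rabs y < R0) by (rewrite Rabs_right; lra).
        assert (0 <= y * (N y + y * N1 y)); [|nra].
        (* The derivative of the periodic function U U_t has integral zero. Adding this integral
           trades the term - U U_tt, left by the Laplace equation, for the square U_t^2. *)
        assert (B : Icirc (fun t => Ut y t * Ut y t + U y t * Utt y t) = 0).
        { rewrite (Icirc_derive _) with (F := fun t => U y t * Ut y t).
          - rewrite P0, Pt. ring.
          - intros t. cslice y.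
          - intros t. pose proof (Dt y t Hy') as E1. pose proof (Dtt y t Hy') as E2.
            auto_derive.
            + ex_der.
            + replace (Derive (fun x => U y x) t) with (Ut y t) by (symmetry; now apply is_derive_unique).
              replace (Derive (fun x => Ut y x) t) with (Utt y t) by (symmetry; now apply is_derive_unique).
              ring. }
        replace (y * (N y + y * N1 y)) with
          (y * N y + y ^ 2 * N1 y + Icirc (fun t => Ut y t * Ut y t + U y t * Utt y t)) by (rewrite B; ring).
        unfold N, N1. rewrite <- !Icirc_scal.
        2: intros t; cslice y.
        2: intros t; cslice y.
        rewrite <- !Icirc_plus.
        2: intros t; cslice y.
        2: intros t; cslice y.
        2: intros t; cslice y.
        2: intros t; cslice y.
        replace 0 with (Icirc (fun _ => 0)) by (rewrite Icirc_const; ring).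
        apply Icirc_le.
        + intros; apply continuous_const.
        + intros t; cslice y.
        + intros t. 
          replace (Utt y t) with (- (y ^ 2 * Urr y t + y * Ur y t)) by (pose proof (Lap y t Hy'); lra).
          nra. }
    change (0 <= N x). nra. }
  destruct (Req_dec r s) as [->|Hne]; [lra|].
  apply (derive_nonneg_incr (fun s => Icirc (fun t => U s t ^ 2)) (fun r => 2 * Icirc (fun t => U r t * Ur r t))); [lra| |].
  - intros x Hx. apply polar_square_derive. rewrite Rabs_right; lra.
  - intros x Hx. specialize (N x ltac:(lra)). lra.
Qed.
End Polar.

(** * Harmonic functions on circles *)

Lemma continuity_2d_pt_comp2 (f g h : R -> R -> R) (x y : R) :
  continuity_2d_pt f (g x y) (h x y) -> continuity_2d_pt g x y -> continuity_2d_pt h x y ->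
  continuity_2d_pt (fun u v => f (g u v) (h u v)) x y.
Proof.
  intros Hf Hg Hh e. destruct (Hf e) as [d Hd].
  destruct (Hg d) as [d1 D1]. destruct (Hh d) as [d2 D2].
  assert (Hm : 0 < Rmin d1 d2) by (apply Rmin_pos; apply cond_pos).
  exists (mkposreal _ Hm). simpl. intros u v Hu Hv.
  pose proof (Rmin_l d1 d2). pose proof (Rmin_r d1 d2).
  apply Hd; [apply D1|apply D2]; lra.
Qed.

Lemma Cmod_polar (r t : R) : Cmod (r * cos t, r * sin t) = Rabs r.
Proof.
  unfold Cmod; simpl. rewrite <- sqrt_Rsqr_abs. f_equal. unfold Rsqr.
  pose proof (sin2_cos2 t) as H. unfold Rsqr in H. nra.
Qed.

Lemma derivable_pt_lim_rcos (r t : R) :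
  derivable_pt_lim (fun s => s * cos t) r (cos t) /\
  derivable_pt_lim (fun s => s * sin t) r (sin t) /\
  derivable_pt_lim (fun s => r * cos s) t (- r * sin t) /\
  derivable_pt_lim (fun s => r * sin s) t (r * cos t).
Proof. repeat split; apply is_derive_Reals; auto_derive; auto; ring. Qed.

Lemma is_derive_rot_comp (f : R -> R -> R) (r t lx ly : R) :
  differentiable_pt_lim f (r * cos t) (r * sin t) lx ly ->
  is_derive (fun s => f (s * cos t) (s * sin t)) r (lx * cos t + ly * sin t) /\
  is_derive (fun s => f (r * cos s) (r * sin s)) t (r * (- lx * sin t + ly * cos t)).
Proof.
  intros H. destruct (derivable_pt_lim_rcos r t) as [H1 [H2 [H3 H4]]].
  split; apply is_derive_Reals.
  - apply (derivable_pt_lim_comp_2d f (fun s => s * cos t) (fun s => s * sin t)); auto.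
  - replace (r * (- lx * sin t + ly * cos t)) with (lx * (- r * sin t) + ly * (r * cos t)) by ring.
    apply (derivable_pt_lim_comp_2d f (fun s => r * cos s) (fun s => r * sin s)); auto.
Qed.

Lemma is_derive_tangential (f g : R -> R) (r t f1 g1 : R) :
  is_derive f t f1 -> is_derive g t g1 ->
  is_derive (fun s => r * (- f s * sin s + g s * cos s)) t
    (r * ((- f1 * sin t - f t * cos t) + (g1 * cos t - g t * sin t))).
Proof.
  intros Hf Hg. auto_derive; [ex_der|].
  replace (Derive (fun x => f x) t) with f1 by (symmetry; now apply is_derive_unique).
  replace (Derive (fun x => g x) t) with g1 by (symmetry; now apply is_derive_unique).
  ring.
Qed.

Lemma continuous_cos_R (t : R) : continuous cos t.
Proof. apply continuity_pt_filterlim, continuity_cos. Qed.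
Lemma continuous_sin_R (t : R) : continuous sin t.
Proof. apply continuity_pt_filterlim, continuity_sin. Qed.

Lemma continuity_2d_polar (f : R -> R -> R) (r t : R) :
  continuity_2d_pt f (r * cos t) (r * sin t) ->
  continuity_2d_pt (fun r t => f (r * cos t) (r * sin t)) r t.
Proof.
  intros H. pose proof continuous_cos_R. pose proof continuous_sin_R.
  apply continuity_2d_pt_comp2; auto; cont2.
Qed.

Lemma Icirc_trig : Icirc (fun t => cos t * cos t) = PI /\ Icirc (fun t => sin t * sin t) = PI /\
  Icirc (fun t => sin t * cos t) = 0 /\ Icirc cos = 0 /\ Icirc sin = 0.
Proof.
  pose proof cos_2PI. pose proof sin_2PI. pose proof cos_0. pose proof sin_0.
  pose proof continuous_cos_R as Cc. pose proof continuous_sin_R as Cs.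
  assert (cont : forall f : R -> R, continuity f -> forall t, continuous f t)
    by (intros f Hf t; apply continuity_pt_filterlim, Hf).
  repeat split.
  - rewrite (Icirc_derive _) with (F := fun t => (t + sin t * cos t) / 2); [nra| |].
    + apply cont. reg.
    + intros t. auto_derive; auto. pose proof (sin2_cos2 t) as E. unfold Rsqr in E.
      change (Rmult (Rplus 1 (1 * cos t * cos t + sin t * (1 * - sin t))) (/ 2) = cos t * cos t). nra.
  - rewrite (Icirc_derive _) with (F := fun t => (t - sin t * cos t) / 2); [nra| |].
    + apply cont. reg.
    + intros t. auto_derive; auto. pose proof (sin2_cos2 t) as E. unfold Rsqr in E.
      nra.
  - rewrite (Icirc_derive _) with (F := fun t => sin t * sin t / 2); [nra| |].
    + apply cont. reg.
    + intros t. auto_derive; auto. field.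
  - rewrite (Icirc_derive _) with (F := sin); [nra|auto|].
    intros t. auto_derive; auto. ring.
  - rewrite (Icirc_derive _) with (F := fun t => - cos t); [nra|auto|].
    intros t. auto_derive; auto. ring.
Qed.

Section Harmonic.
Variables (R0 : R) (u : R -> R -> R).
Let disc := fun z : C => Cmod z < R0.
Hypothesis Hu : C2_on disc u.
Hypothesis Hlap : forall x y, disc (x, y) -> dx (dx u) x y + dy (dy u) x y = 0.

Let U r t := u (r * cos t) (r * sin t).
Let Ur r t := dx u (r * cos t) (r * sin t) * cos t + dy u (r * cos t) (r * sin t) * sin t.
Let Ut r t := r * (- dx u (r * cos t) (r * sin t) * sin t + dy u (r * cos t) (r * sin t) * cos t).
Let Urr r t :=
  (dx (dx u) (r * cos t) (r * sin t) * cos t + dy (dx u) (r * cos t) (r * sin t) * sin t) * cos t +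
  (dx (dy u) (r * cos t) (r * sin t) * cos t + dy (dy u) (r * cos t) (r * sin t) * sin t) * sin t.
Let Utt r t :=
  r * ((- (r * (- dx (dx u) (r * cos t) (r * sin t) * sin t + dy (dx u) (r * cos t) (r * sin t) * cos t)) * sin t
        - dx u (r * cos t) (r * sin t) * cos t)
     + ((r * (- dx (dy u) (r * cos t) (r * sin t) * sin t + dy (dy u) (r * cos t) (r * sin t) * cos t)) * cos t
        - dy u (r * cos t) (r * sin t) * sin t)).

Let disc_polar (r t : R) : Rabs r < R0 -> disc (r * cos t, r * sin t).
Proof. intros H. unfold disc. now rewrite Cmod_polar. Qed.

Let D0 (r t : R) : Rabs r < R0 ->
  is_derive (fun s => U s t) r (Ur r t) /\ is_derive (U r) t (Ut r t).
Proof.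
  intros H. apply is_derive_rot_comp.
  apply (C1_on_differentiable disc (disc_open R0)); [apply Hu|auto].
Qed.
Let D1 (r t : R) : Rabs r < R0 ->
  is_derive (fun s => Ur s t) r (Urr r t) /\ is_derive (Ut r) t (Utt r t).
Proof.
  intros H.
  destruct (is_derive_rot_comp (dx u) r t _ _
    (C1_on_differentiable disc (disc_open R0) (dx u) _ _ (proj1 (proj2 Hu)) (disc_polar r t H))) as [A1 A2].
  destruct (is_derive_rot_comp (dy u) r t _ _
    (C1_on_differentiable disc (disc_open R0) (dy u) _ _ (proj2 (proj2 Hu)) (disc_polar r t H))) as [B1 B2].
  split; unfold Ur, Urr, Ut, Utt.
  - apply (is_derive_plus (V := R_NormedModule) (fun s => dx u (s * cos t) (s * sin t) * cos t) (fun s => dy u (s * cos t) (s * sin t) * sin t)).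
    + apply (is_derive_ext (fun s => scal (cos t) (dx u (s * cos t) (s * sin t)))).
      { intros; apply Rmult_comm. }
      rewrite Rmult_comm. now apply (is_derive_scal (fun s => dx u (s * cos t) (s * sin t))).
    + apply (is_derive_ext (fun s => scal (sin t) (dy u (s * cos t) (s * sin t)))).
      { intros; apply Rmult_comm. }
      rewrite Rmult_comm. now apply (is_derive_scal (fun s => dy u (s * cos t) (s * sin t))).
  - apply (is_derive_tangential (fun s => dx u (r * cos s) (r * sin s))
      (fun s => dy u (r * cos s) (r * sin s))); assumption.
Qed.

Let Cont (r t : R) : Rabs r < R0 ->
  continuity_2d_pt U r t /\ continuity_2d_pt Ur r t /\ continuity_2d_pt Ut r t /\
  continuity_2d_pt Urr r t /\ continuity_2d_pt Utt r t.
Proof.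
  intros H. pose proof continuous_cos_R. pose proof continuous_sin_R.
  pose proof (disc_polar r t H) as Hp. destruct Hu as [K0 [K1 K2]].
  destruct (K0 _ _ Hp) as [_ [_ [E0 _]]].
  destruct (K1 _ _ Hp) as [_ [_ [E1 [E2 E3]]]].
  destruct (K2 _ _ Hp) as [_ [_ [E4 [E5 E6]]]].
  rewrite !continuous_uncurry2 in *.
  apply continuity_2d_polar in E0, E1, E2, E3, E4, E5, E6.
  unfold U, Ur, Ut, Urr, Utt. repeat split; cont2.
Qed.

Let P0 (r : R) : U r (2 * PI) = U r 0.
Proof. unfold U. now rewrite cos_2PI, sin_2PI, cos_0, sin_0. Qed.
Let Pt (r : R) : Ut r (2 * PI) = Ut r 0.
Proof. unfold Ut. now rewrite cos_2PI, sin_2PI, cos_0, sin_0. Qed.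
(** The Laplacian in polar coordinates: the mixed partials cancel between [Urr] and [Utt], as do the
    first order terms between [r * Ur] and [Utt]. *)
Let Lap (r t : R) : Rabs r < R0 -> r ^ 2 * Urr r t + r * Ur r t + Utt r t = 0.
Proof.
  intros H. pose proof (Hlap _ _ (disc_polar r t H)) as L.
  pose proof (sin2_cos2 t) as E. unfold Rsqr in E.
  transitivity (r ^ 2 * (dx (dx u) (r * cos t) (r * sin t) + dy (dy u) (r * cos t) (r * sin t)) * (sin t * sin t + cos t * cos t)).
  - unfold Urr, Ur, Utt. ring.
  - rewrite L. ring.
Qed.

Lemma harmonic_square_incr (r s : R) : 0 < r -> r <= s -> s < R0 ->
  Icirc (fun t => u (r * cos t) (r * sin t) ^ 2) <= Icirc (fun t => u (s * cos t) (s * sin t) ^ 2).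
Proof.
  apply (polar_square_incr R0 U Ur Ut Urr Utt); auto;
   intros; first [now apply D0 | now apply D1 | now apply Cont].
Qed.

Let harmonic_weight (w w1 w2 : R -> R) :
  (forall t, is_derive w t (w1 t)) -> (forall t, is_derive w1 t (w2 t)) ->
  (forall t, continuous w2 t) -> w (2 * PI) = w 0 -> w1 (2 * PI) = w1 0 ->
  forall r, Rabs r < R0 ->
  (is_derive (fun s => Icirc (fun t => U s t * w t)) r (Icirc (fun t => Ur r t * w t)) /\
   is_derive (fun s => Icirc (fun t => Ur s t * w t)) r (Icirc (fun t => Urr r t * w t))) /\
  r ^ 2 * Icirc (fun t => Urr r t * w t) + r * Icirc (fun t => Ur r t * w t)
    + Icirc (fun t => U r t * w2 t) = 0.
Proof.
  intros H1 H2 H3 H4 H5 r Hr. split.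
  - apply (polar_weight_derive R0 U Ur Urr) with (w1 := w1); auto;
    intros; first [now apply D0 | now apply D1 | now apply Cont].
  - apply (polar_weight_euler R0 U Ur Ut Urr Utt) with (w1 := w1); auto;
    intros; first [now apply D0 | now apply D1 | now apply Cont].
Qed.

(** The constant weight 1 has second derivative 0, so the circle average obeys the Euler equation of
    order 0 and keeps its value at the centre. *)
Lemma harmonic_mean (r : R) : 0 <= r < R0 ->
  Icirc (fun t => u (r * cos t) (r * sin t)) = 2 * PI * u 0 0.
Proof.
  intros Hr.
  assert (W := harmonic_weight (fun _ => 1) (fun _ => 0) (fun _ => 0)).
  specialize (W (fun t => is_derive_const 1 t) (fun t => is_derive_const 0 t) (fun t => continuous_const 0 t) eq_refl eq_refl).
  transitivity (Icirc (fun t => U r t * 1)).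
  { apply Icirc_ext. intros; unfold U; ring. }
  rewrite (euler_order_0 (fun r => Icirc (fun t => U r t * 1)) (fun r => Icirc (fun t => Ur r t * 1))
     (fun r => Icirc (fun t => Urr r t * 1)) R0); auto.
  - rewrite <- Icirc_const. apply Icirc_ext. intros t. unfold U. rewrite !Rmult_0_l. ring.
  - intros s Hs. exact (proj1 (proj1 (W s Hs))).
  - intros s Hs. exact (proj2 (proj1 (W s Hs))).
  - intros s Hs. destruct (W s Hs) as [_ E].
    assert (Icirc (fun t => U s t * 0) = 0); [|lra].
    transitivity (Icirc (fun _ => 0)); [|rewrite Icirc_const; ring].
    apply Icirc_ext. intros; ring.
Qed.

Let harmonic_weight_1 (w w1 : R -> R) :
  (forall t, is_derive w t (w1 t)) -> (forall t, is_derive w1 t (- w t)) ->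
  w (2 * PI) = w 0 -> w1 (2 * PI) = w1 0 ->
  forall r, 0 <= r < R0 ->
  Icirc (fun t => U r t * w t) = r * Icirc (fun t => Ur 0 t * w t).
Proof.
  intros H1 H2 H4 H5 r Hr.
  assert (Cw : forall t, continuous w t) by (intros t; apply (ex_derive_continuous w); now exists (w1 t)).
  assert (W := harmonic_weight w w1 (fun t => - w t) H1 H2
     (fun t => continuous_opp (V := R_NormedModule) w t (Cw t)) H4 H5).
  apply (euler_order_1 (fun r => Icirc (fun t => U r t * w t)) (fun r => Icirc (fun t => Ur r t * w t))
     (fun r => Icirc (fun t => Urr r t * w t)) R0); auto.
  - intros s Hs. exact (proj1 (proj1 (W s Hs))).
  - intros s Hs. exact (proj2 (proj1 (W s Hs))).
  - intros s Hs. destruct (W s Hs) as [_ E]. rewrite <- E.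
    assert (E2 : Icirc (fun t => U s t * - w t) = - 1 * Icirc (fun t => U s t * w t)); [|rewrite E2; ring].
    rewrite <- Icirc_scal. 
    + apply Icirc_ext. intros; ring.
    + intros t. destruct (Cont s t Hs) as [K _]. cslice s.
Qed.

(** For the weights cos and sin the Euler equation has order 1, so each moment is linear in [r]. Its
    slope is the integral of the weight against the radial derivative at the centre,
    [dx u 0 0 * cos t + dy u 0 0 * sin t], and orthogonality selects one term. *)
Lemma harmonic_first_moments (r : R) : 0 <= r < R0 ->
  Icirc (fun t => u (r * cos t) (r * sin t) * cos t) = PI * r * dx u 0 0 /\
  Icirc (fun t => u (r * cos t) (r * sin t) * sin t) = PI * r * dy u 0 0.
Proof.
  intros Hr. pose proof cos_2PI. pose proof sin_2PI. pose proof cos_0. pose proof sin_0.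
  destruct Icirc_trig as [I1 [I2 [I3 _]]].
  pose proof continuous_cos_R as Cc. pose proof continuous_sin_R as Cs.
  assert (Q : forall f g : R -> R, (forall t, continuous f t) -> (forall t, continuous g t) -> forall t, continuous (fun t => f t * g t) t).
  { intros f g Hf Hg t. apply (continuous_mult (K := R_AbsRing) f g); auto. }
  assert (Q2 : forall k (f : R -> R), (forall t, continuous f t) -> forall t, continuous (fun t => k * f t) t).
  { intros k f Hf t. apply (Q (fun _ => k) f); auto. intros; apply continuous_const. }
  split.
  - change (Icirc (fun t => U r t * cos t) = PI * r * dx u 0 0).
    rewrite (harmonic_weight_1 cos (fun t => - sin t)); try lra; auto.
    + replace (Icirc (fun t => Ur 0 t * cos t)) with
       (Icirc (fun t => dx u 0 0 * (cos t * cos t) + dy u 0 0 * (sin t * cos t))).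
      * rewrite Icirc_plus, !Icirc_scal, I1, I3; auto. ring.
      * apply Icirc_ext. intros t. unfold Ur. rewrite !Rmult_0_l. ring.
    + intros t. auto_derive; auto. ring.
    + intros t. auto_derive; auto. ring.
  - change (Icirc (fun t => U r t * sin t) = PI * r * dy u 0 0).
    rewrite (harmonic_weight_1 sin cos); try lra; auto.
    + replace (Icirc (fun t => Ur 0 t * sin t)) with
       (Icirc (fun t => dx u 0 0 * (sin t * cos t) + dy u 0 0 * (sin t * sin t))).
      * rewrite Icirc_plus, !Icirc_scal, I2, I3; auto. ring.
      * apply Icirc_ext. intros t. unfold Ur. rewrite !Rmult_0_l. ring.
    + intros t. auto_derive; auto. ring.
    + intros t. auto_derive; auto. ring.
Qed.
End Harmonic.

(** * Complex exponential, logarithm and primitives *)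

Lemma dpl_eq (f : R -> R -> R) (x y a b a' b' : R) :
  differentiable_pt_lim f x y a b -> a = a' -> b = b' -> differentiable_pt_lim f x y a' b'.
Proof. now intros H -> ->. Qed.

Lemma dpl_linear (p q k x y : R) : differentiable_pt_lim (fun u v => p * u + q * v + k) x y p q.
Proof.
  intros e. exists e. intros u v _ _.
  replace (_ - _) with 0 by ring. rewrite Rabs_R0.
  apply Rmult_le_pos; [apply Rlt_le, cond_pos|].
  eapply Rle_trans; [apply Rabs_pos|apply Rmax_l].
Qed.

Lemma dpl_fst (x y : R) : differentiable_pt_lim (fun u _ => u) x y 1 0.
Proof.
  eapply differentiable_pt_lim_ext; [|apply (dpl_linear 1 0 0)].
  exists (mkposreal _ Rlt_0_1). intros; ring.
Qed.

Lemma dpl_snd (x y : R) : differentiable_pt_lim (fun _ v => v) x y 0 1.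
Proof.
  eapply differentiable_pt_lim_ext; [|apply (dpl_linear 0 1 0)].
  exists (mkposreal _ Rlt_0_1). intros; ring.
Qed.

Lemma dpl_1d (f : R -> R) (g : R -> R -> R) (x y l a b : R) :
  derivable_pt_lim f (g x y) l -> differentiable_pt_lim g x y a b ->
  differentiable_pt_lim (fun u v => f (g u v)) x y (l * a) (l * b).
Proof.
  intros Hf Hg.
  apply (differentiable_pt_lim_proj1_0 _ _ (g x y)) in Hf.
  pose proof (differentiable_pt_lim_comp _ g g x y l 0 a b a b Hf Hg Hg) as D. simpl in D.
  eapply dpl_eq; [exact D|ring|ring].
Qed.

Lemma dpl_times (x y : R) : differentiable_pt_lim (fun u v => u * v) x y y x.
Proof.
  intros e. exists e. intros u v Hu Hv.
  replace (_ - _) with ((u - x) * (v - y)) by ring. rewrite Rabs_mult.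
  pose proof (Rmax_r (Rabs (u - x)) (Rabs (v - y))).
  pose proof (Rabs_pos (u - x)). pose proof (Rabs_pos (v - y)).
  apply Rmult_le_compat; lra.
Qed.

Lemma dpl_mult (f g : R -> R -> R) (x y a b a' b' : R) :
  differentiable_pt_lim f x y a b -> differentiable_pt_lim g x y a' b' ->
  differentiable_pt_lim (fun u v => f u v * g u v) x y (g x y * a + f x y * a') (g x y * b + f x y * b').
Proof.
  intros Hf Hg. exact (differentiable_pt_lim_comp _ f g x y _ _ a b a' b' (dpl_times (f x y) (g x y)) Hf Hg).
Qed.

Lemma dpl_plus (f g : R -> R -> R) (x y a b a' b' : R) :
  differentiable_pt_lim f x y a b -> differentiable_pt_lim g x y a' b' ->
  differentiable_pt_lim (fun u v => f u v + g u v) x y (a + a') (b + b').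
Proof.
  intros Hf Hg.
  pose proof (differentiable_pt_lim_comp _ f g x y _ _ a b a' b' (dpl_linear 1 1 0 (f x y) (g x y)) Hf Hg) as D.
  apply dpl_eq with (1 * a + 1 * a') (1 * b + 1 * b'); [|ring|ring].
  eapply differentiable_pt_lim_ext; [|exact D].
  exists (mkposreal _ Rlt_0_1). intros; simpl; ring.
Qed.

(** The identity, product and chain rules live on the module structure of a ring over itself. Its
    operations agree with those of [C_NormedModule], so only the linearity record has to be
    repacked. *)
Lemma cderiv_AbsRing (F : C -> C) (z l : C) :
  cderiv F z l <-> @is_derive C_AbsRing (AbsRing_NormedModule C_AbsRing) F z l.
Proof.
  split; intros [H1 H2]; (split; [destruct H1 as [a b c]; split; [exact a|exact b|exact c]|exact H2]).
Qed.

Lemma cderiv_eq (F : C -> C) (z l l' : C) : cderiv F z l -> l = l' -> cderiv F z l'.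
Proof. now intros H <-. Qed.

Lemma cderiv_ext (F G : C -> C) (z l : C) : (forall w, F w = G w) -> cderiv F z l -> cderiv G z l.
Proof. intros E. apply is_derive_ext. exact E. Qed.

Lemma cderiv_const (k z : C) : cderiv (fun _ => k) z (RtoC 0).
Proof. apply (@is_derive_const C_AbsRing C_NormedModule). Qed.

Lemma cderiv_id (z : C) : cderiv (fun w => w) z (RtoC 1).
Proof. apply cderiv_AbsRing. apply (@is_derive_id C_AbsRing). Qed.

Lemma cderiv_plus (F G : C -> C) (z l m : C) : cderiv F z l -> cderiv G z m ->
  cderiv (fun w => Cplus (F w) (G w)) z (Cplus l m).
Proof. apply (@is_derive_plus C_AbsRing C_NormedModule). Qed.

Lemma cderiv_mult (F G : C -> C) (z l m : C) : cderiv F z l -> cderiv G z m ->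
  cderiv (fun w => Cmult (F w) (G w)) z (Cplus (Cmult l (G z)) (Cmult (F z) m)).
Proof.
  rewrite !cderiv_AbsRing. intros H1 H2.
  apply (@is_derive_mult C_AbsRing F G); auto. intros; apply Cmult_comm.
Qed.

Lemma cderiv_comp (F G : C -> C) (z l m : C) : cderiv F (G z) l -> cderiv G z m ->
  cderiv (fun w => F (G w)) z (Cmult m l).
Proof.
  intros H1 H2. apply cderiv_AbsRing in H2.
  exact (@is_derive_comp C_AbsRing C_NormedModule F G z l m H1 H2).
Qed.

Lemma cderiv_scal (k : C) (F : C -> C) (z l : C) : cderiv F z l ->
  cderiv (fun w => Cmult k (F w)) z (Cmult k l).
Proof.
  intros H. eapply cderiv_eq; [apply (cderiv_mult (fun _ => k) F); [apply cderiv_const|exact H]|].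
  ring.
Qed.

Lemma sqr_norm_pos (x y : R) : (x, y) <> RtoC 0 -> 0 < x * x + y * y.
Proof.
  intros H. destruct (Req_dec (x * x + y * y) 0) as [E|]; [|nra].
  exfalso. apply H. unfold RtoC. f_equal; nra.
Qed.

Lemma derivable_pt_lim_Rinv (x : R) : x <> 0 -> derivable_pt_lim (fun t => / t) x (- / (x * x)).
Proof. intros H. apply is_derive_Reals. auto_derive; auto. field. auto. Qed.

Lemma cderiv_inv (z : C) : z <> RtoC 0 -> cderiv Cinv z (Copp (Cinv (Cmult z z))).
Proof.
  destruct z as [x y]. intros H. apply sqr_norm_pos in H as Hp.
  apply cderiv_iff.
  assert (D : differentiable_pt_lim (fun u v => / (u * u + v * v)) x y
     (- / ((x * x + y * y) * (x * x + y * y)) * (2 * x)) (- / ((x * x + y * y) * (x * x + y * y)) * (2 * y))).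
  { apply (dpl_1d (fun t => / t) (fun u v => u * u + v * v)).
    - apply derivable_pt_lim_Rinv. lra.
    - eapply dpl_eq; [apply dpl_plus; apply dpl_mult; try apply dpl_fst; apply dpl_snd|simpl; ring|simpl; ring]. }
  assert (Hn : (x * x - y * y) * (x * x - y * y) + (x * y + y * x) * (x * y + y * x) <> 0).
  { replace (_ + _) with ((x * x + y * y) * (x * x + y * y)) by ring. nra. }
  split.
  - eapply differentiable_pt_lim_ext.
    2: eapply dpl_eq; [apply dpl_mult; [apply dpl_fst|exact D]| |].
    + exists (mkposreal _ Rlt_0_1). intros; unfold re_part; simpl. unfold Rdiv.
      replace (u * (u * 1) + v * (v * 1)) with (u * u + v * v) by ring. ring.
    + simpl. field. repeat split; try nra. 
    + simpl. field. repeat split; nra.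
  - eapply differentiable_pt_lim_ext.
    2: eapply dpl_eq; [apply dpl_mult; [apply (dpl_linear 0 (-1) 0)|exact D]| |].
    + exists (mkposreal _ Rlt_0_1). intros; unfold im_part; simpl. unfold Rdiv.
      replace (u * (u * 1) + v * (v * 1)) with (u * u + v * v) by ring. ring.
    + simpl. field. repeat split; nra.
    + simpl. field. repeat split; nra.
Qed.

Definition cexp (z : C) : C := (exp (fst z) * cos (snd z), exp (fst z) * sin (snd z)).

(* A logarithm on the right half plane only. *)
Definition clog (z : C) : C := (ln (fst z * fst z + snd z * snd z) / 2, atan (snd z / fst z)).

Lemma cderiv_cexp (z : C) : cderiv cexp z (cexp z).
Proof.
  destruct z as [x y]. apply cderiv_iff. split; unfold re_part, im_part, cexp; simpl.
  - eapply dpl_eq; [apply (dpl_mult (fun u _ => exp u) (fun _ v => cos v));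
      [apply (dpl_1d exp (fun u _ => u)); [apply derivable_pt_lim_exp|apply dpl_fst]
      |apply (dpl_1d cos (fun _ v => v)); [apply derivable_pt_lim_cos|apply dpl_snd]]| | ]; simpl; ring.
  - eapply dpl_eq; [apply (dpl_mult (fun u _ => exp u) (fun _ v => sin v));
      [apply (dpl_1d exp (fun u _ => u)); [apply derivable_pt_lim_exp|apply dpl_fst]
      |apply (dpl_1d sin (fun _ v => v)); [apply derivable_pt_lim_sin|apply dpl_snd]]| | ]; simpl; ring.
Qed.

Lemma cderiv_clog (z : C) : 0 < fst z -> cderiv clog z (Cinv z).
Proof.
  destruct z as [x y]. simpl. intros Hx. apply cderiv_iff.
  assert (Hp : 0 < x * x + y * y) by nra.
  split; unfold re_part, im_part, clog; simpl.
  - eapply differentiable_pt_lim_ext.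
    2: eapply dpl_eq; [apply (dpl_1d (fun t => ln t / 2) (fun u v => u * u + v * v));
      [|apply dpl_plus; apply dpl_mult; try apply dpl_fst; apply dpl_snd]| |].
    + exists (mkposreal _ Rlt_0_1). intros; simpl. reflexivity.
    + apply is_derive_Reals. instantiate (1 := / (x * x + y * y) / 2). auto_derive; [lra|]. field. lra.
    + simpl. field. lra.
    + simpl. field. lra.
  - eapply differentiable_pt_lim_ext.
    2: eapply dpl_eq; [apply (dpl_1d atan (fun u v => v * / u));
      [apply derivable_pt_lim_atan|apply dpl_mult; [apply dpl_snd|
       apply (dpl_1d (fun t => / t) (fun u v => u)); [apply derivable_pt_lim_Rinv; simpl; lra|apply dpl_fst]]]| |].
    + exists (mkposreal _ Rlt_0_1). intros; simpl. reflexivity.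
    + simpl. unfold Rsqr. field. repeat split; nra.
    + simpl. unfold Rsqr. field. repeat split; nra.
Qed.

Lemma cexp_clog (z : C) : 0 < fst z -> cexp (clog z) = z.
Proof.
  destruct z as [x y]. simpl. intros Hx. assert (Hp : 0 < x * x + y * y) by nra.
  unfold cexp, clog; simpl.
  assert (E : exp (ln (x * x + y * y) / 2) = sqrt (x * x + y * y)).
  { apply Rsqr_inj; [apply Rlt_le, exp_pos|apply sqrt_pos|].
    unfold Rsqr. rewrite sqrt_sqrt by lra. rewrite <- exp_plus.
    replace (ln (x * x + y * y) / 2 + ln (x * x + y * y) / 2) with (ln (x * x + y * y)) by field.
    now apply exp_ln. }
  (* For x > 0 the modulus factors as [x] times the root that is the denominator in the formulas for
     the cosine and sine of [atan (y / x)]. *)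
  assert (S : sqrt (x * x + y * y) = x * sqrt (1 + (y / x)²)).
  { replace (x * x + y * y) with (x² * (1 + (y / x)²)) by (unfold Rsqr; field; lra).
    rewrite sqrt_mult.
    - rewrite sqrt_Rsqr by lra. reflexivity.
    - unfold Rsqr; nra.
    - pose proof (Rle_0_sqr (y / x)). lra. }
  assert (Sp : 0 < sqrt (1 + (y / x)²)).
  { apply sqrt_lt_R0. pose proof (Rle_0_sqr (y / x)). lra. }
  rewrite E, cos_atan, sin_atan, S. f_equal; field; lra.
Qed.

Lemma cexp_plus (z w : C) : cexp (Cplus z w) = Cmult (cexp z) (cexp w).
Proof.
  unfold cexp, Cplus, Cmult; simpl. rewrite exp_plus, cos_plus, sin_plus. f_equal; ring.
Qed.

Lemma Cmod_cexp (z : C) : Cmod (cexp z) = exp (fst z).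
Proof.
  unfold Cmod, cexp; simpl.
  replace (_ + _) with ((exp (fst z))²).
  - apply sqrt_Rsqr, Rlt_le, exp_pos.
  - pose proof (sin2_cos2 (snd z)) as H. unfold Rsqr in *. 
    transitivity (exp (fst z) * exp (fst z) * (sin (snd z) * sin (snd z) + cos (snd z) * cos (snd z))); [rewrite H|]; ring.
Qed.

(** Equal moduli give equal real parts. The difference of the imaginary parts then has sine 0, and 0
    is the only zero of the sine strictly between - PI and PI. *)
Lemma cexp_inj_strip (z w : C) : cexp z = cexp w -> Rabs (snd z - snd w) < PI -> z = w.
Proof.
  intros E H. assert (E1 : fst z = fst w).
  { apply exp_inv. rewrite <- !Cmod_cexp. now f_equal. }
  destruct z as [x y], w as [x' y']. simpl in *. subst x'.
  unfold cexp in E; simpl in E. injection E as Ec Es.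
  pose proof (exp_pos x).
  apply Rmult_eq_reg_l in Ec; [|lra]. apply Rmult_eq_reg_l in Es; [|lra].
  f_equal.
  assert (S : sin (y - y') = 0) by (rewrite sin_minus, Ec, Es; ring).
  assert (K : cos (y - y') = 1).
  { rewrite cos_minus, Ec, Es. pose proof (sin2_cos2 y') as P. unfold Rsqr in P. lra. }
  apply Rabs_def2 in H.
  destruct (Rtotal_order (y - y') 0) as [L|[L|L]]; [|lra|].
  - assert (0 < sin (- (y - y'))) by (apply sin_gt_0; lra). rewrite sin_neg in H1. lra.
  - assert (0 < sin (y - y')) by (apply sin_gt_0; lra). lra.
Qed.

(** * Segments, Lipschitz bounds and uniqueness of primitives *)

Lemma cderiv_curve (F : C -> C) (g h : R -> R) (t : R) (l : C) (g1 h1 : R) :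
  cderiv F (g t, h t) l -> is_derive g t g1 -> is_derive h t h1 ->
  is_derive (fun s => fst (F (g s, h s))) t (fst (Cmult l (g1, h1))) /\
  is_derive (fun s => snd (F (g s, h s))) t (snd (Cmult l (g1, h1))).
Proof.
  intros H Hg Hh. apply cderiv_iff in H. destruct H as [H1 H2].
  split; apply is_derive_Reals.
  - replace (fst (Cmult l (g1, h1))) with (fst l * g1 + - snd l * h1) by (simpl; ring).
    apply (derivable_pt_lim_comp_2d (re_part F) g h); auto; now apply is_derive_Reals.
  - replace (snd (Cmult l (g1, h1))) with (snd l * g1 + fst l * h1) by (simpl; ring).
    apply (derivable_pt_lim_comp_2d (im_part F) g h); auto; now apply is_derive_Reals.
Qed.

Definition segment (z w : C) (s : R) : C := (fst z + s * (fst w - fst z), snd z + s * (snd w - snd z)).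

Lemma segment_disc (r : R) (z w : C) (s : R) : Cmod z < r -> Cmod w < r -> 0 <= s <= 1 ->
  Cmod (segment z w s) < r.
Proof.
  intros Hz Hw Hs.
  replace (segment z w s) with (Cplus (Cmult (RtoC (1 - s)) z) (Cmult (RtoC s) w)).
  - eapply Rle_lt_trans; [apply Cmod_triangle|]. rewrite !Cmod_mult, !Cmod_R.
    rewrite (Rabs_right (1 - s)), (Rabs_right s) by lra.
    destruct (Req_dec s 1) as [->|]; nra.
  - unfold segment, Cplus, Cmult, RtoC; simpl. f_equal; ring.
Qed.

Lemma segment_ends (z w : C) : segment z w 0 = z /\ segment z w 1 = w.
Proof. destruct z, w. unfold segment; simpl. split; f_equal; ring. Qed.

Lemma cderiv_segment (F : C -> C) (z w : C) (s : R) (l : C) : cderiv F (segment z w s) l ->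
  is_derive (fun s => fst (F (segment z w s))) s (fst (Cmult l (Cminus w z))) /\
  is_derive (fun s => snd (F (segment z w s))) s (snd (Cmult l (Cminus w z))).
Proof.
  intros H. apply (cderiv_curve F (fun s => fst z + s * (fst w - fst z)) (fun s => snd z + s * (snd w - snd z))).
  - exact H.
  - auto_derive; auto. simpl. ring.
  - auto_derive; auto. simpl. ring.
Qed.

Lemma Cmod_comp_le (z : C) : Rabs (fst z) <= Cmod z /\ Rabs (snd z) <= Cmod z.
Proof.
  pose proof (Rmax_Cmod z). pose proof (Rmax_l (Rabs (fst z)) (Rabs (snd z))).
  pose proof (Rmax_r (Rabs (fst z)) (Rabs (snd z))). lra.
Qed.

(** The mean value theorem is applied to the real and the imaginary part along the segment; its two
    intermediate points differ, and adding the two estimates costs the factor 2. *)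
Lemma disc_lipschitz (F F1 : C -> C) (r K : R) :
  (forall z, Cmod z < r -> cderiv F z (F1 z) /\ Cmod (F1 z) <= K) ->
  forall z w, Cmod z < r -> Cmod w < r -> Cmod (Cminus (F w) (F z)) <= 2 * K * Cmod (Cminus w z).
Proof.
  intros H z w Hz Hw.
  assert (S : forall s, 0 <= s <= 1 -> cderiv F (segment z w s) (F1 (segment z w s)) /\ Cmod (F1 (segment z w s)) <= K).
  { intros s Hs. apply H. now apply segment_disc. }
  assert (B : forall s, 0 <= s <= 1 -> Cmod (Cmult (F1 (segment z w s)) (Cminus w z)) <= K * Cmod (Cminus w z)).
  { intros s Hs. rewrite Cmod_mult. apply Rmult_le_compat_r; [apply Cmod_ge_0|]. now apply S. }
  destruct (segment_ends z w) as [E0 E1].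
  eapply Rle_trans; [apply Cmod_le_abs|].
  destruct (MVT_open (fun s => fst (F (segment z w s))) (fun s => fst (Cmult (F1 (segment z w s)) (Cminus w z))) 0 1 Rlt_0_1)
    as [c1 [Hc1 M1]].
  { intros s Hs. apply cderiv_segment. now apply S. }
  destruct (MVT_open (fun s => snd (F (segment z w s))) (fun s => snd (Cmult (F1 (segment z w s)) (Cminus w z))) 0 1 Rlt_0_1)
    as [c2 [Hc2 M2]].
  { intros s Hs. apply cderiv_segment. now apply S. }
  rewrite E0, E1 in *.
  pose proof (proj1 (Cmod_comp_le (Cmult (F1 (segment z w c1)) (Cminus w z)))).
  pose proof (proj2 (Cmod_comp_le (Cmult (F1 (segment z w c2)) (Cminus w z)))).
  pose proof (B c1 Hc1). pose proof (B c2 Hc2).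
  replace (fst (Cminus (F w) (F z))) with (fst (F w) - fst (F z)) by reflexivity.
  replace (snd (Cminus (F w) (F z))) with (snd (F w) - snd (F z)) by reflexivity.
  rewrite M1, M2, Rminus_0_r, !Rmult_1_r. lra.
Qed.

(** F - G has derivative 0, so [disc_lipschitz] applies to it with constant 0. *)
Lemma primitive_unique (F G F1 : C -> C) (r : R) : 0 < r ->
  (forall z, Cmod z < r -> cderiv F z (F1 z)) -> (forall z, Cmod z < r -> cderiv G z (F1 z)) ->
  F (RtoC 0) = G (RtoC 0) -> forall z, Cmod z < r -> F z = G z.
Proof.
  intros Hr HF HG E z Hz.
  assert (Z : Cmod (RtoC 0) < r) by (rewrite Cmod_0; auto).
  pose proof (disc_lipschitz (fun z => Cplus (F z) (Cmult (RtoC (-1)) (G z)))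
    (fun z => Cplus (F1 z) (Cmult (RtoC (-1)) (F1 z))) r 0) as L.
  specialize (L ltac:(intros y Hy; split; [apply cderiv_plus; [|apply cderiv_scal]; auto|
    replace (Cplus _ _) with (RtoC 0) by ring; rewrite Cmod_0; lra]) (RtoC 0) z Z Hz).
  cbv beta in L. rewrite E in L. pose proof (Cmod_ge_0 (Cminus (Cplus (F z) (Cmult (RtoC (-1)) (G z))) (Cplus (G (RtoC 0)) (Cmult (RtoC (-1)) (G (RtoC 0)))))).
  assert (Q : Cminus (Cplus (F z) (Cmult (RtoC (-1)) (G z))) (Cplus (G (RtoC 0)) (Cmult (RtoC (-1)) (G (RtoC 0)))) = RtoC 0).
  { apply Cmod_eq_0. lra. }
  replace (F z) with (Cplus (Cminus (Cplus (F z) (Cmult (RtoC (-1)) (G z))) (Cplus (G (RtoC 0)) (Cmult (RtoC (-1)) (G (RtoC 0))))) (G z)) by ring.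
  rewrite Q. ring.
Qed.

(** * Harmonic maps of the form F(k (x + i e y)) *)

(** For |k| = 1, [e = 1] is a rotation and [e = -1] is conjugation followed by a rotation, so both
    orientations are treated at once. *)
Definition twist (k : C) (e : R) (z : C) : C := Cmult k (fst z, e * snd z).

Lemma dpl_scal (k : R) (f : R -> R -> R) (x y a b : R) : differentiable_pt_lim f x y a b ->
  differentiable_pt_lim (fun u v => k * f u v) x y (k * a) (k * b).
Proof.
  intros H. apply (dpl_1d (fun t => k * t) f); auto.
  apply is_derive_Reals. auto_derive; auto. ring.
Qed.

Lemma twist_dpl (F : C -> C) (k : C) (e x y : R) (l : C) : cderiv F (twist k e (x, y)) l ->
  differentiable_pt_lim (re_part (fun z => F (twist k e z))) x y
    (fst (Cmult k l)) (- e * snd (Cmult k l)) /\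
  differentiable_pt_lim (im_part (fun z => F (twist k e z))) x y
    (snd (Cmult k l)) (e * fst (Cmult k l)).
Proof.
  intros H.
  assert (T1 : differentiable_pt_lim (fun u v => fst (twist k e (u, v))) x y (fst k) (- e * snd k)).
  { eapply differentiable_pt_lim_ext; [|apply (dpl_linear (fst k) (- e * snd k) 0)].
    exists (mkposreal _ Rlt_0_1). intros; unfold twist; simpl; ring. }
  assert (T2 : differentiable_pt_lim (fun u v => snd (twist k e (u, v))) x y (snd k) (e * fst k)).
  { eapply differentiable_pt_lim_ext; [|apply (dpl_linear (snd k) (e * fst k) 0)].
    exists (mkposreal _ Rlt_0_1). intros; unfold twist; simpl; ring. }
  destruct (twist k e (x, y)) as [X Y] eqn:E. apply cderiv_iff in H. destruct H as [H1 H2].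
  assert (EX : X = fst (twist k e (x, y))) by now rewrite E.
  assert (EY : Y = snd (twist k e (x, y))) by now rewrite E.
  rewrite EX, EY in H1, H2.
  split.
  - eapply differentiable_pt_lim_ext.
    2: eapply dpl_eq; [apply (differentiable_pt_lim_comp (re_part F) (fun u v => fst (twist k e (u, v)))
       (fun u v => snd (twist k e (u, v))) x y _ _ _ _ _ _ H1 T1 T2)| |].
    + exists (mkposreal _ Rlt_0_1). intros; reflexivity.
    + simpl; ring.
    + simpl; ring.
  - eapply differentiable_pt_lim_ext.
    2: eapply dpl_eq; [apply (differentiable_pt_lim_comp (im_part F) (fun u v => fst (twist k e (u, v)))
       (fun u v => snd (twist k e (u, v))) x y _ _ _ _ _ _ H2 T1 T2)| |].
    + exists (mkposreal _ Rlt_0_1). intros; reflexivity.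
    + simpl; ring.
    + simpl; ring.
Qed.

Section Twist.
Variables (F F1 F2 : C -> C) (V W : C -> Prop) (k : C) (e : R).
Hypothesis HW : open_set W.
Hypothesis HVW : forall z, W z -> V (twist k e z).
Hypothesis He : e * e = 1.
Hypothesis D0 : forall z, V z -> cderiv F z (F1 z).
Hypothesis D1 : forall z, V z -> cderiv F1 z (F2 z).
Hypothesis D2 : holomorphic_on V F2.
Let g (z : C) : C := F (twist k e z).

(** Differentiating twice in y instead of x multiplies by (i e)^2 = -1, so the Laplacian vanishes.
    Complex differentiability of [F2] supplies the continuity of the second partials. *)
Lemma harmonic_twist : harmonic_on W g /\
  (forall x y, W (x, y) -> diff_at g x y =
     let l := Cmult k (F1 (twist k e (x, y))) in Mat2 (fst l) (- e * snd l) (snd l) (e * fst l)).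
Proof.
  assert (E1 : forall x y, W (x, y) ->
    differentiable_pt_lim (re_part (fun z => Cmult k (F1 (twist k e z)))) x y
      (fst (Cmult k (Cmult k (F2 (twist k e (x, y)))))) (- e * snd (Cmult k (Cmult k (F2 (twist k e (x, y)))))) /\
    differentiable_pt_lim (im_part (fun z => Cmult k (F1 (twist k e z)))) x y
      (snd (Cmult k (Cmult k (F2 (twist k e (x, y)))))) (e * fst (Cmult k (Cmult k (F2 (twist k e (x, y))))))).
  { intros x y Hp. apply (twist_dpl (fun z => Cmult k (F1 z))). apply cderiv_scal. auto. }
  assert (E2 : forall x y, W (x, y) ->
    continuity_2d_pt (fun x y => fst (Cmult k (Cmult k (F2 (twist k e (x, y)))))) x y /\
    continuity_2d_pt (fun x y => snd (Cmult k (Cmult k (F2 (twist k e (x, y)))))) x y).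
  { intros x y Hp. destruct (D2 _ (HVW _ Hp)) as [l Hl].
    pose proof (twist_dpl (fun z => Cmult k (Cmult k (F2 z))) k e x y _ (cderiv_scal _ _ _ _ (cderiv_scal k _ _ _ Hl))) as [A B].
    split; apply differentiable_continuity_pt; eexists; eexists; [exact A|exact B]. }
  destruct (C2_on_intro W HW (re_part g) (fun x y => fst (Cmult k (F1 (twist k e (x, y)))))
     (fun x y => - e * snd (Cmult k (F1 (twist k e (x, y)))))
     (fun x y => fst (Cmult k (Cmult k (F2 (twist k e (x, y))))))
     (fun x y => - e * snd (Cmult k (Cmult k (F2 (twist k e (x, y))))))
     (fun x y => - e * snd (Cmult k (Cmult k (F2 (twist k e (x, y))))))
     (fun x y => - e * (e * fst (Cmult k (Cmult k (F2 (twist k e (x, y)))))))) as [R1 R2].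
  { intros x y Hp. apply (twist_dpl F k e x y). auto. }
  { intros x y Hp. now apply E1. }
  { intros x y Hp. apply dpl_scal. now apply E1. }
  { intros x y Hp. destruct (E2 x y Hp). repeat split; cont2. }
  destruct (C2_on_intro W HW (im_part g) (fun x y => snd (Cmult k (F1 (twist k e (x, y)))))
     (fun x y => e * fst (Cmult k (F1 (twist k e (x, y)))))
     (fun x y => snd (Cmult k (Cmult k (F2 (twist k e (x, y))))))
     (fun x y => e * fst (Cmult k (Cmult k (F2 (twist k e (x, y))))))
     (fun x y => e * fst (Cmult k (Cmult k (F2 (twist k e (x, y))))))
     (fun x y => e * (- e * snd (Cmult k (Cmult k (F2 (twist k e (x, y)))))))) as [I1 I2].
  { intros x y Hp. apply (twist_dpl F k e x y). auto. }
  { intros x y Hp. now apply E1. }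
  { intros x y Hp. apply dpl_scal. now apply E1. }
  { intros x y Hp. destruct (E2 x y Hp). repeat split; cont2. }
  split; [split; [exact R1|split; [exact I1|]]|].
  - intros x y Hp. destruct (R2 x y Hp) as [_ [_ [-> [_ [_ ->]]]]].
    destruct (I2 x y Hp) as [_ [_ [-> [_ [_ ->]]]]].
    split.
    + transitivity (fst (Cmult k (Cmult k (F2 (twist k e (x, y))))) * (1 - e * e)); [ring|rewrite He; ring].
    + transitivity (snd (Cmult k (Cmult k (F2 (twist k e (x, y))))) * (1 - e * e)); [ring|rewrite He; ring].
  - intros x y Hp. destruct (R2 x y Hp) as [A1 [A2 _]]. destruct (I2 x y Hp) as [B1 [B2 _]].
    unfold diff_at. rewrite A1, A2, B1, B2. reflexivity.
Qed.
End Twist.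

Lemma harmonic_on_ext (W : C -> Prop) (f g : C -> C) : open_set W ->
  (forall z, W z -> f z = g z) -> harmonic_on W f -> harmonic_on W g /\
  (forall x y, W (x, y) -> diff_at g x y = diff_at f x y).
Proof.
  intros HW E [H1 [H2 H3]].
  assert (E1 : forall x y, W (x, y) -> re_part f x y = re_part g x y) by (intros; unfold re_part; now rewrite E).
  assert (E2 : forall x y, W (x, y) -> im_part f x y = im_part g x y) by (intros; unfold im_part; now rewrite E).
  split.
  - split; [|split].
    + now apply C2_on_ext with (re_part f).
    + now apply C2_on_ext with (im_part f).
    + intros x y Hp. destruct (H3 x y Hp) as [L1 L2].
      rewrite <- (dx_ext W HW _ _ (dx_ext W HW _ _ E1) x y Hp), <- (dy_ext W HW _ _ (dy_ext W HW _ _ E1) x y Hp).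
      rewrite <- (dx_ext W HW _ _ (dx_ext W HW _ _ E2) x y Hp), <- (dy_ext W HW _ _ (dy_ext W HW _ _ E2) x y Hp).
      auto.
  - intros x y Hp. unfold diff_at.
    rewrite <- (dx_ext W HW _ _ E1 x y Hp), <- (dy_ext W HW _ _ E1 x y Hp),
      <- (dx_ext W HW _ _ E2 x y Hp), <- (dy_ext W HW _ _ E2 x y Hp). reflexivity.
Qed.

(** Such a matrix stretches every unit vector by exactly [k], so the supremum runs over a single
    value. *)
Lemma opnorm_conformal (L O : mat2) (k : R) : 0 <= k -> orthogonal2 O ->
  m11 L = k * m11 O -> m12 L = k * m12 O -> m21 L = k * m21 O -> m22 L = k * m22 O ->
  opnorm L = Finite k.
Proof.
  intros Hk [O1 [O2 O3]] E1 E2 E3 E4. apply is_lub_Rbar_unique.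
  assert (N : forall v1 v2, v1 * v1 + v2 * v2 = 1 ->
    sqrt ((m11 L * v1 + m12 L * v2) ^ 2 + (m21 L * v1 + m22 L * v2) ^ 2) = k).
  { intros v1 v2 Hv. rewrite E1, E2, E3, E4.
    replace (_ + _) with (Rsqr k).
    - now apply sqrt_Rsqr.
    - unfold Rsqr. transitivity (k * k * ((m11 O * m11 O + m21 O * m21 O) * (v1 * v1) + (m12 O * m12 O + m22 O * m22 O) * (v2 * v2)
        + 2 * (m11 O * m12 O + m21 O * m22 O) * (v1 * v2))); [|ring].
      rewrite O1, O2, O3. transitivity (k * k * (v1 * v1 + v2 * v2)); [rewrite Hv|]; ring. }
  split.
  - intros r [v1 [v2 [Hv ->]]]. rewrite N by auto. simpl; lra.
  - intros b Hb. apply Hb. exists 1, 0. split; [ring|]. symmetry. apply N. ring.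
Qed.

(** The angle is placed in the integration interval of [Icirc], so that vanishing on that interval
    reaches every point of the circle. *)
Lemma unit_angle (a b : R) : a * a + b * b = 1 ->
  exists t, 0 <= t <= 2 * PI /\ a = cos t /\ b = sin t.
Proof.
  intros H. assert (Ha : -1 <= a <= 1) by nra.
  assert (S : sqrt (1 - a²) * sqrt (1 - a²) = b * b).
  { rewrite sqrt_sqrt; unfold Rsqr; nra. }
  pose proof (sqrt_pos (1 - a²)). pose proof (acos_bound a). pose proof PI_RGT_0.
  destruct (Rle_dec 0 b).
  - exists (acos a). rewrite cos_acos, sin_acos by auto. repeat split; try lra. nra.
  - exists (- acos a + 2 * PI). rewrite cos_plus, sin_plus, cos_2PI, sin_2PI, cos_neg, sin_neg, cos_acos, sin_acos by auto.
    repeat split; try lra. nra.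
Qed.

Lemma orthogonal2_form (O : mat2) : orthogonal2 O ->
  exists t e, e * e = 1 /\ m11 O = cos t /\ m21 O = sin t /\ m12 O = - e * sin t /\ m22 O = e * cos t.
Proof.
  intros [O1 [O2 O3]]. destruct (unit_angle _ _ O1) as [t [_ [E1 E2]]].
  (* The sign [e] is the determinant; its square is 1 by Lagrange's identity. *)
  exists t, (m11 O * m22 O - m21 O * m12 O).
  rewrite <- E1, <- E2. destruct O as [a b c d]; simpl in *.
  repeat split.
  - transitivity ((a * a + c * c) * (b * b + d * d) - (a * b + c * d) * (a * b + c * d)); [ring|].
    rewrite O1, O2, O3. ring.
  - transitivity (b * (a * a + c * c) - a * (a * b + c * d)); [rewrite O1, O3|]; ring.
  - transitivity (d * (a * a + c * c) - c * (a * b + c * d)); [rewrite O1, O3|]; ring.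
Qed.

(** * The extremal problem *)

Section Moment.
Variables (R0 : R) (u : R -> R -> R).
Hypothesis Hu : C2_on (fun z => Cmod z < R0) u.
Hypothesis Hlap : forall x y, Cmod (x, y) < R0 -> dx (dx u) x y + dy (dy u) x y = 0.

Lemma circle_continuous (r : R) : 0 <= r < R0 ->
  forall t, continuous (fun t => u (r * cos t) (r * sin t)) t.
Proof.
  intros Hr t. apply (continuity_2d_slice (fun r t => u (r * cos t) (r * sin t))).
  apply continuity_2d_polar. apply continuous_uncurry2.
  apply (proj1 Hu). rewrite Cmod_polar, Rabs_right; lra.
Qed.

Lemma harmonic_moment (r A B K : R) : 0 <= r < R0 ->
  Icirc (fun t => u (r * cos t) (r * sin t) * (A + B * cos t + K * sin t))
  = 2 * PI * (A * u 0 0) + PI * r * (B * dx u 0 0 + K * dy u 0 0).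
Proof.
  intros Hr. destruct (harmonic_first_moments R0 u Hu Hlap r Hr) as [M1 M2].
  pose proof (harmonic_mean R0 u Hu Hlap r Hr) as M0.
  pose proof (circle_continuous r Hr) as Cu.
  assert (Q : forall f g : R -> R, (forall t, continuous f t) -> (forall t, continuous g t) -> forall t, continuous (fun t => f t * g t) t).
  { intros f g Hf Hg t. apply (continuous_mult (K := R_AbsRing) f g); auto. }
  assert (P : forall f g : R -> R, (forall t, continuous f t) -> (forall t, continuous g t) -> forall t, continuous (fun t => f t + g t) t).
  { intros f g Hf Hg t. apply (continuous_plus (K := R_AbsRing) (V := R_NormedModule) f g); auto. }
  pose proof continuous_cos_R. pose proof continuous_sin_R.
  assert (Q2 : forall k (f : R -> R), (forall t, continuous f t) -> forall t, continuous (fun t => k * f t) t).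
  { intros k f Hf t. apply (Q (fun _ => k) f); auto. intros; apply continuous_const. }
  transitivity (Icirc (fun t => A * u (r * cos t) (r * sin t) + (B * (u (r * cos t) (r * sin t) * cos t)
     + K * (u (r * cos t) (r * sin t) * sin t)))).
  { apply Icirc_ext. intros; ring. }
  rewrite (Icirc_plus (fun t => A * u (r * cos t) (r * sin t))
    (fun t => B * (u (r * cos t) (r * sin t) * cos t) + K * (u (r * cos t) (r * sin t) * sin t))) by auto.
  rewrite (Icirc_plus (fun t => B * (u (r * cos t) (r * sin t) * cos t))) by auto.
  rewrite !Icirc_scal by auto.
  rewrite M0, M1, M2. ring.
Qed.
End Moment.

Lemma C2_on_minus (U : C -> Prop) (u v : R -> R -> R) : open_set U -> C2_on U u -> C2_on U v ->
  C2_on U (fun x y => u x y - v x y) /\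
  (forall x y, U (x, y) ->
    dx (dx (fun x y => u x y - v x y)) x y + dy (dy (fun x y => u x y - v x y)) x y
    = (dx (dx u) x y + dy (dy u) x y) - (dx (dx v) x y + dy (dy v) x y)).
Proof.
  intros HU [U0 [U1 U2]] [V0 [V1 V2]].
  assert (M : forall f g, C1_on U f -> C1_on U g -> forall x y, U (x, y) ->
    differentiable_pt_lim (fun x y => f x y - g x y) x y (dx f x y - dx g x y) (dy f x y - dy g x y)).
  { intros f g Hf Hg x y Hp.
    pose proof (dpl_plus f (fun x y => -1 * g x y) x y _ _ _ _ (C1_on_differentiable U HU f x y Hf Hp)
      (dpl_scal (-1) g x y _ _ (C1_on_differentiable U HU g x y Hg Hp))) as D.
    eapply differentiable_pt_lim_ext; [|eapply dpl_eq; [exact D|ring|ring]].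
    exists (mkposreal _ Rlt_0_1). intros; simpl; ring. }
  destruct (C2_on_intro U HU (fun x y => u x y - v x y) (fun x y => dx u x y - dx v x y) (fun x y => dy u x y - dy v x y)
    (fun x y => dx (dx u) x y - dx (dx v) x y) (fun x y => dy (dx u) x y - dy (dx v) x y)
    (fun x y => dx (dy u) x y - dx (dy v) x y) (fun x y => dy (dy u) x y - dy (dy v) x y)) as [A B]; auto.
  - intros x y Hp.
    destruct (U1 x y Hp) as [_ [_ [_ [a1 a2]]]]. destruct (U2 x y Hp) as [_ [_ [_ [a3 a4]]]].
    destruct (V1 x y Hp) as [_ [_ [_ [b1 b2]]]]. destruct (V2 x y Hp) as [_ [_ [_ [b3 b4]]]].
    rewrite !continuous_uncurry2 in *. repeat split; apply continuity_2d_pt_minus; auto.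
  - split; auto. intros x y Hp. destruct (B x y Hp) as [_ [_ [-> [_ [_ ->]]]]]. ring.
Qed.

(** The limit r -> 1 in elementary form, used with radius 1 - s. *)
Lemma small_linear (x M s0 : R) : 0 <= M -> 0 < s0 ->
  (forall s, 0 < s < s0 -> x <= M * s) -> x <= 0.
Proof.
  intros HM Hs0 H. destruct (Rle_dec x 0) as [|Hn]; auto. exfalso.
  assert (Hx : 0 < x) by lra.
  set (s := Rmin (s0 / 2) (x / (2 * (M + 1)))).
  assert (Hs : 0 < s).
  { apply Rmin_pos; [lra|]. apply Rdiv_lt_0_compat; lra. }
  assert (Hs1 : s <= s0 / 2) by apply Rmin_l.
  assert (Hs2 : s <= x / (2 * (M + 1))) by apply Rmin_r.
  specialize (H s ltac:(lra)).
  assert ((M + 1) * s <= x / 2).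
  { replace (x / 2) with ((M + 1) * (x / (2 * (M + 1)))) by (field; lra).
    apply Rmult_le_compat_l; lra. }
  nra.
Qed.

Lemma C1_on_sub (U V : C -> Prop) (u : R -> R -> R) : (forall z, V z -> U z) -> C1_on U u -> C1_on V u.
Proof. intros H HU x y Hp. apply HU. auto. Qed.

Lemma harmonic_on_sub (U V : C -> Prop) (f : C -> C) : (forall z, V z -> U z) ->
  harmonic_on U f -> harmonic_on V f.
Proof.
  intros H [[A1 [A2 A3]] [[B1 [B2 B3]] L]].
  pose proof (C1_on_sub U V) as S.
  split; [|split].
  - exact (conj (S _ H A1) (conj (S _ H A2) (S _ H A3))).
  - exact (conj (S _ H B1) (conj (S _ H B2) (S _ H B3))).
  - intros x y Hp. apply L. auto.
Qed.

(** [Icirc_nonneg_eq_0] gives zeros in the open interval only; continuity adds the end 0 and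
    periodicity the end 2 PI. *)
Lemma continuous_zero_ends (f : R -> R) : (forall t, continuous f t) -> f (2 * PI) = f 0 ->
  (forall t, 0 < t < 2 * PI -> f t = 0) -> forall t, 0 <= t <= 2 * PI -> f t = 0.
Proof.
  intros Cf P Z. pose proof two_PI_pos.
  assert (Z0 : f 0 = 0).
  { destruct (Req_dec (f 0) 0) as [|Hn]; auto. exfalso.
    pose proof (Cf 0) as C0. apply continuity_pt_filterlim in C0.
    destruct (C0 (Rabs (f 0)) (Rabs_pos_lt _ Hn)) as [d [Hd D]]. simpl in D. unfold R_dist in D.
    set (s := Rmin (d / 2) PI).
    assert (0 < s) by (apply Rmin_pos; lra).
    assert (s <= d / 2) by apply Rmin_l. assert (s <= PI) by apply Rmin_r.
    specialize (D s). rewrite (Z s) in D by lra.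
    rewrite Rminus_0_l, Rabs_Ropp in D.
    apply (Rlt_irrefl (Rabs (f 0))), D. split; [split; [exact I|lra]|].
    rewrite Rabs_right; lra. }
  intros t Ht. destruct (Req_dec t 0) as [->|]; auto.
  destruct (Req_dec t (2 * PI)) as [->|]; [lra|]. apply Z. lra.
Qed.

Definition qpoly (a lam z : C) : C := Cplus (Cplus (RtoC 1) (Cmult a z)) (Cmult lam (Cmult z z)).

Section Extremal.
Variables (a lam : C) (c R1 K delta : R) (Ft F2 : C -> C).
Let F1 (z : C) : C := Cdiv (RtoC c) (qpoly a lam z).
Hypothesis HR1 : 1 < R1.
Hypothesis Hc : 0 < c.
Hypothesis Hdelta : 0 < delta.
Hypothesis Ft0 : Ft (RtoC 0) = RtoC 0.
Hypothesis D0 : forall z, Cmod z < R1 -> cderiv Ft z (F1 z).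
Hypothesis D1 : forall z, Cmod z < R1 -> cderiv F1 z (F2 z).
Hypothesis D2 : holomorphic_on (fun z => Cmod z < R1) F2.
Hypothesis HK : forall z, Cmod z < R1 -> Cmod (F1 z) <= K.
Hypothesis Key : forall zeta z, Cmod zeta = 1 -> Cmod z < 1 ->
  fst (Cmult (Cmult (Cconj zeta) (qpoly a lam zeta)) (Cminus (Ft z) (Ft zeta)))
  <= - delta * Cmod (Cminus (Ft z) (Ft zeta)) ^ 2.

(** [HL] says that the differential of [f] at 0 is [k] times the orthogonal map
    [twist (cis s) e], with [e = 1] or [e = -1] according to orientation. *)
Section Map.
Variables (f : C -> C) (s e k : R).
Hypothesis He : e * e = 1.
Hypothesis Hf : harmonic_on unit_disc f.
Hypothesis HfD : forall z, unit_disc z -> exists w, unit_disc w /\ f z = Ft w.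
Hypothesis Hf0 : f (0, 0) = RtoC 0.
Hypothesis HL : diff_at f 0 0 = Mat2 (k * cos s) (- e * (k * sin s)) (k * sin s) (e * (k * cos s)).

Let tw (z : C) : C := twist (cis s) e z.
Let G (z : C) : C := Ft (tw z).

Lemma Cmod_twist (z : C) : Cmod (tw z) = Cmod z.
Proof.
  unfold tw, twist. rewrite Cmod_mult.
  replace (Cmod (cis s)) with 1.
  - rewrite Rmult_1_l. unfold Cmod; simpl. f_equal.
    transitivity (fst z * fst z + e * e * (snd z * snd z)); [|rewrite He]; ring.
  - unfold cis, Cmod; simpl. rewrite <- sqrt_1 at 1. f_equal.
    pose proof (sin2_cos2 s) as E. unfold Rsqr in E. lra.
Qed.

Let HG : harmonic_on (fun z => Cmod z < R1) G /\
  diff_at G 0 0 = Mat2 (c * cos s) (- e * (c * sin s)) (c * sin s) (e * (c * cos s)).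
Proof.
  destruct (harmonic_twist Ft F1 F2 (fun z => Cmod z < R1) (fun z => Cmod z < R1) (cis s) e) as [A B]; auto.
  - apply disc_open.
  - intros z Hz. change (Cmod (tw z) < R1). now rewrite Cmod_twist.
  - split; auto. fold G in B. change (fun z => Ft (twist (cis s) e z)) with G in B. rewrite B.
    2: { change (0, 0) with (RtoC 0). rewrite Cmod_0. lra. }
    replace (F1 (twist (cis s) e (0, 0))) with (RtoC c).
    + simpl. f_equal; ring.
    + unfold F1, qpoly. replace (twist (cis s) e (0, 0)) with (RtoC 0).
      * replace (Cplus (Cplus (RtoC 1) (Cmult a (RtoC 0))) (Cmult lam (Cmult (RtoC 0) (RtoC 0)))) with (RtoC 1) by ring.
        unfold Cdiv. replace (Cinv (RtoC 1)) with (RtoC 1); [ring|].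
        rewrite <- RtoC_inv by lra. f_equal. field.
      * unfold twist, cis, RtoC, Cmult; simpl. f_equal; ring.
Qed.

(* [(P1 t, P2 t)] is [conj zeta * q zeta] at [zeta = tw (e^(it))]. *)
Let P1 (t : R) : R := fst a + ((1 + fst lam) * cos s - snd lam * sin s) * cos t
  + (- e * ((1 + fst lam) * sin s + snd lam * cos s)) * sin t.
Let P2 (t : R) : R := snd a + ((fst lam - 1) * sin s + snd lam * cos s) * cos t
  + (e * ((fst lam - 1) * cos s - snd lam * sin s)) * sin t.

(** The value does not involve [a] and [lam]: the constant frequency meets h(0) = 0, and the terms
    in [lam] cancel because the differential is conformal with the orientation [e] of the weight.
    The weight conj zeta leaves the scale [m] of the differential. Both [f] and [G] satisfy the
    hypotheses. *)
Let trig_moment (h : C -> C) (R0 r m : R) : 0 <= r < R0 -> harmonic_on (fun z => Cmod z < R0) h ->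
  h (0, 0) = RtoC 0 ->
  diff_at h 0 0 = Mat2 (m * cos s) (- e * (m * sin s)) (m * sin s) (e * (m * cos s)) ->
  Icirc (fun t => P1 t * fst (h (r * cos t, r * sin t)) - P2 t * snd (h (r * cos t, r * sin t)))
  = 2 * PI * (r * m).
Proof.
  intros Hr [H1 [H2 H3]] H0 HD. injection HD as E1 E2 E3 E4.
  pose proof (harmonic_moment R0 (re_part h) H1 (fun x y Hp => proj1 (H3 x y Hp)) r (fst a)
    ((1 + fst lam) * cos s - snd lam * sin s) (- e * ((1 + fst lam) * sin s + snd lam * cos s)) Hr) as M1.
  pose proof (harmonic_moment R0 (im_part h) H2 (fun x y Hp => proj2 (H3 x y Hp)) r (snd a)
    ((fst lam - 1) * sin s + snd lam * cos s) (e * ((fst lam - 1) * cos s - snd lam * sin s)) Hr) as M2.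
  pose proof (circle_continuous R0 (re_part h) H1 r Hr) as C1.
  pose proof (circle_continuous R0 (im_part h) H2 r Hr) as C2.
  assert (T : forall A B D t, continuous (fun t => A + B * cos t + D * sin t) t).
  { intros A B D t. apply (ex_derive_continuous (V := R_NormedModule)). auto_derive; auto. }
  assert (Q : forall f g : R -> R, (forall t, continuous f t) -> (forall t, continuous g t) -> forall t, continuous (fun t => f t * g t) t).
  { intros f' g' Hf' Hg' t. apply (continuous_mult (K := R_AbsRing) f' g'); auto. }
  transitivity (Icirc (fun t => re_part h (r * cos t) (r * sin t) * P1 t + -1 * (im_part h (r * cos t) (r * sin t) * P2 t))).
  { apply Icirc_ext. intros t. unfold re_part, im_part. ring. }
  assert (X1 : forall t, continuous (fun t => re_part h (r * cos t) (r * sin t) * P1 t) t) by (apply Q; unfold P1; auto).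
  assert (X2 : forall t, continuous (fun t => im_part h (r * cos t) (r * sin t) * P2 t) t) by (apply Q; unfold P2; auto).
  assert (X3 : forall t, continuous (fun t => -1 * (im_part h (r * cos t) (r * sin t) * P2 t)) t).
  { apply (Q (fun _ => -1)); auto. intros; apply continuous_const. }
  rewrite Icirc_plus, Icirc_scal by auto.
  unfold P1, P2. rewrite M1, M2, E1, E2, E3, E4. unfold re_part, im_part. rewrite H0. simpl.
  transitivity (PI * r * (m * ((1 + fst lam) * (cos s * cos s) - snd lam * sin s * cos s
     + (e * e) * ((1 + fst lam) * (sin s * sin s) + snd lam * sin s * cos s)
     - (fst lam - 1) * (sin s * sin s) - snd lam * sin s * cos s
     - (e * e) * ((fst lam - 1) * (cos s * cos s) - snd lam * sin s * cos s)))); [ring|].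
  rewrite He. pose proof (sin2_cos2 s) as E. unfold Rsqr in E.
  transitivity (PI * r * (m * (2 * (sin s * sin s + cos s * cos s)))); [|rewrite E]; ring.
Qed.

(** The factors 1 are kept so that this is literally the instance of radius 1 of the circles r
    e^(it). *)
Let G_circle (t : R) : C := G (1 * cos t, 1 * sin t).
Let S (r t : R) : R :=
  (fst (f (r * cos t, r * sin t)) - fst (G_circle t)) ^ 2 +
  (snd (f (r * cos t, r * sin t)) - snd (G_circle t)) ^ 2.

Let cont_mult (g h : R -> R) : (forall t, continuous g t) -> (forall t, continuous h t) ->
  forall t, continuous (fun t => g t * h t) t.
Proof. intros Hg Hh t. apply (continuous_mult (K := R_AbsRing) g h); auto. Qed.
Let cont_plus (g h : R -> R) : (forall t, continuous g t) -> (forall t, continuous h t) ->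
  forall t, continuous (fun t => g t + h t) t.
Proof. intros Hg Hh t. apply (continuous_plus (V := R_NormedModule) g h); auto. Qed.
Let cont_minus (g h : R -> R) : (forall t, continuous g t) -> (forall t, continuous h t) ->
  forall t, continuous (fun t => g t - h t) t.
Proof. intros Hg Hh t. apply (continuous_minus (V := R_NormedModule) g h); auto. Qed.
Let cont_sqr (g : R -> R) : (forall t, continuous g t) -> forall t, continuous (fun t => g t ^ 2) t.
Proof.
  intros Hg t. apply (continuous_ext (fun t => g t * g t)); [intros; simpl; ring|]. now apply cont_mult.
Qed.

Let circle_cont (h : C -> C) (R0 r : R) : 0 <= r < R0 -> harmonic_on (fun z => Cmod z < R0) h ->
  (forall t, continuous (fun t => fst (h (r * cos t, r * sin t))) t) /\
  (forall t, continuous (fun t => snd (h (r * cos t, r * sin t))) t).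
Proof.
  intros Hr [H1 [H2 _]]. split.
  - exact (circle_continuous R0 (re_part h) H1 r Hr).
  - exact (circle_continuous R0 (im_part h) H2 r Hr).
Qed.

Let S_cont (r : R) : 0 <= r < 1 -> forall t, continuous (S r) t.
Proof.
  intros Hr. destruct (circle_cont f 1 r Hr Hf). destruct (circle_cont G R1 1 ltac:(lra) (proj1 HG)).
  unfold S, G_circle. apply cont_plus; apply cont_sqr; apply cont_minus; auto.
Qed.

Let G0 : G (0, 0) = RtoC 0.
Proof.
  unfold G, tw. replace (twist (cis s) e (0, 0)) with (RtoC 0); auto.
  unfold twist, cis, RtoC, Cmult; simpl. f_equal; ring.
Qed.

Let pointwise (r t : R) : 0 <= r < 1 ->
  P1 t * (fst (f (r * cos t, r * sin t)) - fst (G_circle t))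
  - P2 t * (snd (f (r * cos t, r * sin t)) - snd (G_circle t)) <= - delta * S r t.
Proof.
  intros Hr. set (zeta := tw (1 * cos t, 1 * sin t)).
  assert (Hz : Cmod zeta = 1) by (unfold zeta; rewrite Cmod_twist, Cmod_polar; apply Rabs_R1).
  destruct (HfD (r * cos t, r * sin t)) as [w [Hw E]].
  { unfold unit_disc. rewrite Cmod_polar, Rabs_right; lra. }
  pose proof (Key zeta w Hz Hw) as K0. rewrite Cmod_sqr in K0.
  change (Ft zeta) with (G_circle t) in K0. rewrite <- E in K0.
  unfold S. simpl fst in K0 at 2. 
  assert (EP : Cmult (Cconj zeta) (qpoly a lam zeta) = (P1 t, P2 t)).
  { assert (N : Cmult (Cconj zeta) zeta = RtoC 1).
    { rewrite Cmult_comm, <- Cmod2_conj, Hz. f_equal. ring. }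
    transitivity (Cplus (Cconj zeta) (Cmult (Cplus a (Cmult lam zeta)) (Cmult (Cconj zeta) zeta))).
    - unfold qpoly. ring.
    - rewrite N. unfold zeta, tw, twist, cis, P1, P2. destruct a, lam.
      unfold Cconj, Cplus, Cmult, RtoC; simpl. f_equal; ring. }
  rewrite EP in K0. simpl in K0. simpl. lra.
Qed.

(** [pointwise] integrated over the circle: the part with [f] is [trig_moment] at radius r, the part
    with [G] is [trig_moment] at radius 1, allowed because [G] is harmonic up to [R1]. *)
Let ineq (r : R) : 0 <= r < 1 -> 2 * PI * (r * k - c) <= - delta * Icirc (S r).
Proof.
  intros Hr.
  pose proof (trig_moment f 1 r k Hr Hf Hf0 HL) as Mf.
  pose proof (trig_moment G R1 1 c ltac:(lra) (proj1 HG) G0 (proj2 HG)) as MG.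
  destruct (circle_cont f 1 r Hr Hf) as [f1 f2].
  destruct (circle_cont G R1 1 ltac:(lra) (proj1 HG)) as [g1 g2].
  assert (T : forall A B D t, continuous (fun t => A + B * cos t + D * sin t) t).
  { intros A B D t. apply (ex_derive_continuous (V := R_NormedModule)). auto_derive; auto. }
  assert (CP1 : forall t, continuous P1 t) by (unfold P1; auto).
  assert (CP2 : forall t, continuous P2 t) by (unfold P2; auto).
  replace (2 * PI * (r * k - c)) with (2 * PI * (r * k) + -1 * (2 * PI * (1 * c))) by ring.
  rewrite <- Mf, <- MG.
  rewrite <- Icirc_scal by (apply cont_minus; apply cont_mult; auto).
  rewrite <- Icirc_plus.
  2: apply cont_minus; apply cont_mult; auto.
  2: apply (cont_mult (fun _ => -1)); [intros; apply continuous_const|apply cont_minus; apply cont_mult; auto].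
  rewrite <- Icirc_scal by (apply S_cont; auto).
  apply Icirc_le.
  - apply cont_plus; [|apply (cont_mult (fun _ => -1)); [intros; apply continuous_const|]]; apply cont_minus; apply cont_mult; auto.
  - apply (cont_mult (fun _ => - delta)); [intros; apply continuous_const|apply S_cont; auto].
  - intros t. eapply Rle_trans; [|apply (pointwise r t Hr)]. right. unfold G_circle. ring.
Qed.

Let S_nonneg (r : R) : 0 <= r < 1 -> 0 <= Icirc (S r).
Proof.
  intros Hr. rewrite <- (Rmult_0_r (2 * PI)), <- Icirc_const. apply Icirc_le.
  - intros; apply continuous_const.
  - apply S_cont; auto.
  - intros t. unfold S. apply Rplus_le_le_0_compat; apply pow2_ge_0.
Qed.

Lemma extremal_bound : 0 <= k -> k <= c.
Proof.
  intros Hk. assert (k - c <= 0); [|lra].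
  apply (small_linear _ k 1); auto; [lra|]. intros x Hx.
  pose proof (ineq (1 - x) ltac:(lra)) as I1. pose proof (S_nonneg (1 - x) ltac:(lra)).
  pose proof PI_RGT_0. assert (2 * PI * ((1 - x) * k - c) <= 0) by nra.
  assert ((1 - x) * k - c <= 0) by nra. lra.
Qed.

(** [S r] compares [f] at radius r with [G] at radius 1, whereas the harmonic differences [h1] and
    [h2] use one common point; this is the price of the change. *)
Let G_radial (r t : R) : 0 <= r < 1 ->
  (fst (G (r * cos t, r * sin t)) - fst (G_circle t)) ^ 2 +
  (snd (G (r * cos t, r * sin t)) - snd (G_circle t)) ^ 2 <= 4 * K ^ 2 * (1 - r) ^ 2.
Proof.
  intros Hr.
  assert (B1 : Cmod (tw (1 * cos t, 1 * sin t)) < R1) by (rewrite Cmod_twist, Cmod_polar, Rabs_R1; lra).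
  assert (B2 : Cmod (tw (r * cos t, r * sin t)) < R1) by (rewrite Cmod_twist, Cmod_polar, Rabs_right; lra).
  pose proof (disc_lipschitz Ft F1 R1 K (fun z Hz => conj (D0 z Hz) (HK z Hz)) _ _ B1 B2) as L.
  replace (Cmod (Cminus (tw (r * cos t, r * sin t)) (tw (1 * cos t, 1 * sin t)))) with (1 - r) in L.
  2: { replace (Cminus (tw (r * cos t, r * sin t)) (tw (1 * cos t, 1 * sin t))) with (tw ((r - 1) * cos t, (r - 1) * sin t)).
       - rewrite Cmod_twist, Cmod_polar, Rabs_left; lra.
       - unfold tw, twist, cis, Cminus, Cplus, Copp, Cmult; simpl. f_equal; ring. }
  fold (G (r * cos t, r * sin t)) in L. fold (G (1 * cos t, 1 * sin t)) in L. fold (G_circle t) in L.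
  pose proof (Cmod_sqr (Cminus (G (r * cos t, r * sin t)) (G_circle t))) as E.
  pose proof (Cmod_ge_0 (Cminus (G (r * cos t, r * sin t)) (G_circle t))).
  replace (_ + _) with (Cmod (Cminus (G (r * cos t, r * sin t)) (G_circle t)) ^ 2).
  replace (4 * K ^ 2 * (1 - r) ^ 2) with ((2 * K * (1 - r)) ^ 2) by ring. apply pow_incr. lra.
Qed.

Let h1 (x y : R) : R := re_part f x y - re_part G x y.
Let h2 (x y : R) : R := im_part f x y - im_part G x y.

Let H1f : (C2_on unit_disc h1 /\ C2_on unit_disc h2) /\
  forall x y, unit_disc (x, y) -> dx (dx h1) x y + dy (dy h1) x y = 0 /\ dx (dx h2) x y + dy (dy h2) x y = 0.
Proof.
  destruct Hf as [A1 [A2 A3]].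
  assert (HG' : harmonic_on unit_disc G).
  { apply (harmonic_on_sub (fun z => Cmod z < R1)); [|apply HG]. unfold unit_disc; intros; lra. }
  destruct HG' as [B1 [B2 B3]].
  destruct (C2_on_minus unit_disc _ _ (disc_open 1) A1 B1) as [E1 L1].
  destruct (C2_on_minus unit_disc _ _ (disc_open 1) A2 B2) as [E2 L2].
  split; [split; assumption|]. intros x y Hp. unfold h1, h2. rewrite L1, L2 by auto.
  destruct (A3 x y Hp) as [-> ->]. destruct (B3 x y Hp) as [-> ->]. split; ring.
Qed.

(** Monotonicity replaces r by x. There |f - G|^2 is at most 2 |f - G_circle|^2 + 2 |G -
    G_circle|^2: [ineq] with k = c bounds the integral of the first term, [G_radial] that of the
    second, both by multiples of 1 - x. *)
Let square_le (r x : R) : k = c -> 0 < r -> r <= x -> x < 1 ->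
  Icirc (fun t => h1 (r * cos t) (r * sin t) ^ 2) + Icirc (fun t => h2 (r * cos t) (r * sin t) ^ 2)
  <= (4 * PI * c / delta + 16 * PI * K ^ 2) * (1 - x).
Proof.
  intros Hkc Hr Hrx Hx. destruct H1f as [[C1 C2] L].
  pose proof (harmonic_square_incr 1 h1 C1 (fun x y Hp => proj1 (L x y Hp)) r x Hr Hrx Hx) as I1.
  pose proof (harmonic_square_incr 1 h2 C2 (fun x y Hp => proj2 (L x y Hp)) r x Hr Hrx Hx) as I2.
  pose proof (circle_continuous 1 h1 C1 x ltac:(lra)) as c1.
  pose proof (circle_continuous 1 h2 C2 x ltac:(lra)) as c2.
  pose proof (S_cont x ltac:(lra)) as cS.
  assert (I3 : Icirc (fun t => h1 (x * cos t) (x * sin t) ^ 2) + Icirc (fun t => h2 (x * cos t) (x * sin t) ^ 2)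
     <= 2 * Icirc (S x) + 2 * PI * (8 * K ^ 2 * (1 - x) ^ 2)).
  { rewrite <- Icirc_plus by (apply cont_sqr; auto).
    rewrite <- Icirc_scal by auto. rewrite <- Icirc_const.
    rewrite <- Icirc_plus.
    2: apply (cont_mult (fun _ => 2)); auto; intros; apply continuous_const.
    2: intros; apply continuous_const.
    apply Icirc_le.
    - apply cont_plus; apply cont_sqr; auto.
    - apply cont_plus; [apply (cont_mult (fun _ => 2)); auto|]; intros; apply continuous_const.
    - intros t. pose proof (G_radial x t ltac:(lra)) as B. unfold S, h1, h2, re_part, im_part.
      set (p := fst (f (x * cos t, x * sin t))) in *. set (p' := snd (f (x * cos t, x * sin t))) in *.
      set (g := fst (G (x * cos t, x * sin t))) in *. set (g' := snd (G (x * cos t, x * sin t))) in *.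
      set (o := fst (G_circle t)) in *. set (o' := snd (G_circle t)) in *.
      assert ((p - g) ^ 2 <= 2 * (p - o) ^ 2 + 2 * (g - o) ^ 2) by (pose proof (pow2_ge_0 (p + g - 2 * o)); nra).
      assert ((p' - g') ^ 2 <= 2 * (p' - o') ^ 2 + 2 * (g' - o') ^ 2) by (pose proof (pow2_ge_0 (p' + g' - 2 * o')); nra).
      lra. }
  pose proof (ineq x ltac:(lra)) as I4. rewrite Hkc in I4.
  assert (I5 : Icirc (S x) <= 2 * PI * c / delta * (1 - x)).
  { apply Rmult_le_reg_l with delta; auto.
    replace (delta * (2 * PI * c / delta * (1 - x))) with (2 * PI * (c - x * c)) by (field; lra). lra. }
  assert (I6 : (1 - x) ^ 2 <= 1 - x) by nra.
  assert (I7 : 2 * PI * (8 * K ^ 2 * (1 - x) ^ 2) <= 16 * PI * K ^ 2 * (1 - x)).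
  { replace (2 * PI * (8 * K ^ 2 * (1 - x) ^ 2)) with (16 * PI * K ^ 2 * (1 - x) ^ 2) by ring.
    apply Rmult_le_compat_l; auto. pose proof PI_RGT_0. pose proof (pow2_ge_0 K). nra. }
  replace (4 * PI * c / delta) with (2 * (2 * PI * c / delta)) by (field; lra). lra.
Qed.

Lemma extremal_unique : k = c -> forall z, unit_disc z -> f z = Ft (twist (cis s) e z).
Proof.
  intros Hkc z Hz. destruct H1f as [[C1 C2] L].
  (* The centre has no polar angle; there both maps have the value 0. *)
  destruct (Req_dec (Cmod z) 0) as [Z|Z].
  { apply Cmod_eq_0 in Z. subst z. change (RtoC 0) with ((0, 0) : C) at 1. rewrite Hf0. symmetry. exact G0. }
  set (r := Cmod z) in *. pose proof (Cmod_ge_0 z) as Hr0. fold r in Hr0. unfold unit_disc in Hz. fold r in Hz.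
  pose proof (Cmod_sqr z) as E. fold r in E.
  destruct (unit_angle (fst z / r) (snd z / r)) as [t [Ht [E1 E2]]].
  { replace (fst z / r * (fst z / r) + snd z / r * (snd z / r)) with ((fst z ^ 2 + snd z ^ 2) / r ^ 2) by (field; auto).
    rewrite <- E. field. auto. }
  assert (Ez : z = (r * cos t, r * sin t)).
  { rewrite <- E1, <- E2. destruct z; simpl. f_equal; field; auto. }
  set (X := Icirc (fun t => h1 (r * cos t) (r * sin t) ^ 2)).
  set (Y := Icirc (fun t => h2 (r * cos t) (r * sin t) ^ 2)).
  assert (B : X + Y <= 0).
  { apply (small_linear _ (4 * PI * c / delta + 16 * PI * K ^ 2) (1 - r)).
    - pose proof PI_RGT_0. pose proof (pow2_ge_0 K).
      assert (0 <= 4 * PI * c / delta) by (apply Rlt_le, Rdiv_lt_0_compat; nra). nra.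
    - lra.
    - intros x Hx. pose proof (square_le r (1 - x) Hkc ltac:(lra) ltac:(lra) ltac:(lra)) as Q.
      replace (1 - (1 - x)) with x in Q by ring. exact Q. }
  pose proof (circle_continuous 1 h1 C1 r ltac:(lra)) as c1.
  pose proof (circle_continuous 1 h2 C2 r ltac:(lra)) as c2.
  assert (N : forall g : R -> R, (forall t, continuous g t) -> 0 <= Icirc (fun t => g t ^ 2)).
  { intros g Hg. rewrite <- (Rmult_0_r (2 * PI)), <- Icirc_const. apply Icirc_le.
    - intros; apply continuous_const.
    - now apply cont_sqr.
    - intros; apply pow2_ge_0. }
  assert (V : forall g : R -> R, (forall t, continuous g t) -> g (2 * PI) = g 0 ->
    Icirc (fun t => g t ^ 2) <= 0 -> g t = 0).
  { intros g Hg Pg Ig.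
    assert (g t ^ 2 = 0); [|nra].
    apply (continuous_zero_ends (fun t => g t ^ 2)); auto.
    - simpl. now rewrite Pg.
    - apply Icirc_nonneg_eq_0; auto. intros; apply pow2_ge_0. }
  pose proof (N _ c1) as N1. pose proof (N _ c2) as N2. cbv beta in N1, N2. fold X in N1. fold Y in N2.
  assert (V1 : h1 (r * cos t) (r * sin t) = 0).
  { apply (V (fun t => h1 (r * cos t) (r * sin t))); auto.
    - now rewrite cos_2PI, sin_2PI, cos_0, sin_0.
    - fold X. lra. }
  assert (V2 : h2 (r * cos t) (r * sin t) = 0).
  { apply (V (fun t => h2 (r * cos t) (r * sin t))); auto.
    - now rewrite cos_2PI, sin_2PI, cos_0, sin_0.
    - fold Y. lra. }
  rewrite Ez. unfold h1, h2, re_part, im_part in V1, V2.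
  change (Ft (twist (cis s) e (r * cos t, r * sin t))) with (G (r * cos t, r * sin t)).
  rewrite (surjective_pairing (f _)), (surjective_pairing (G _)). f_equal; lra.
Qed.
End Map.
End Extremal.

(** * Domains of the form phi (Re (m w)) + psi (Im (m w)) < 0 *)

(** Subtract from [g] its tangent at [a] and k (x - a)^2. By the mean value theorem the derivative
    of the rest has the sign of x - a between [a] and [b], so the rest does not decrease from [a]
    towards [b], whichever of the two is larger. *)
Lemma convex_quadratic_bound (g g1 g2 : R -> R) (k a b : R) :
  (forall x, is_derive g x (g1 x)) -> (forall x, is_derive g1 x (g2 x)) ->
  (forall x, Rmin a b <= x <= Rmax a b -> 2 * k <= g2 x) ->
  g a + g1 a * (b - a) + k * (b - a) ^ 2 <= g b.
Proof.
  intros D1 D2 H.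
  assert (C1 : forall x, continuity_pt g1 x).
  { intros x. apply continuity_pt_filterlim, (ex_derive_continuous g1). now exists (g2 x). }
  set (h := fun x => g x - g1 a * (x - a) - k * (x - a) ^ 2).
  set (h' := fun x => g1 x - g1 a - 2 * k * (x - a)).
  assert (Dh : forall x, is_derive h x (h' x)).
  { intros x. pose proof (D1 x) as E. unfold h, h'. auto_derive; [ex_der|].
    replace (Derive (fun x => g x) x) with (g1 x) by (symmetry; now apply is_derive_unique).
    ring. }
  destruct (MVT_gen h a b h') as [x [Hx M]].
  - auto.
  - intros y _. apply continuity_pt_filterlim, (ex_derive_continuous h). now exists (h' y).
  - destruct (MVT_gen g1 a x g2) as [y [Hy M2]]; auto.
    assert (Hyab : Rmin a b <= y <= Rmax a b).
    { unfold Rmin, Rmax in *. destruct (Rle_dec a b), (Rle_dec a x); lra. }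
    specialize (H y Hyab).
    assert (0 <= (x - a) * (b - a)).
    { unfold Rmin, Rmax in Hx. destruct (Rle_dec a b); nra. }
    assert (h a <= h b); [|unfold h in *; nra].
    assert (0 <= h b - h a); [|lra]. rewrite M. unfold h'. rewrite M2.
    replace ((g2 y * (x - a) - 2 * k * (x - a)) * (b - a)) with ((g2 y - 2 * k) * ((x - a) * (b - a))) by ring.
    apply Rmult_le_pos; lra.
Qed.

Section Model.
Variables (m : C) (phi phi1 phi2 psi psi1 psi2 : R -> R) (D : C -> Prop) (J : R -> Prop).
Hypothesis Hm : m <> RtoC 0.
Hypothesis Dphi : forall x, is_derive phi x (phi1 x).
Hypothesis Dphi1 : forall x, is_derive phi1 x (phi2 x).
Hypothesis Cphi2 : forall x, continuous phi2 x.
Hypothesis Dpsi : forall x, is_derive psi x (psi1 x).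
Hypothesis Dpsi1 : forall x, is_derive psi1 x (psi2 x).
Hypothesis Cpsi2 : forall x, continuous psi2 x.
Hypothesis Jopen : forall y, J y -> exists d, 0 < d /\ forall y', Rabs (y' - y) < d -> J y'.
Hypothesis Jconv : forall y1 y2 y, J y1 -> J y2 -> Rmin y1 y2 <= y <= Rmax y1 y2 -> J y.
Hypothesis Pphi : forall x, 0 < phi2 x.
Hypothesis Ppsi : forall y, J y -> 0 < psi2 y.

Definition model_rho (x y : R) : R := phi (fst (Cmult m (x, y))) + psi (snd (Cmult m (x, y))).

Hypothesis HD : forall w, D w <-> J (snd (Cmult m w)) /\ model_rho (fst w) (snd w) < 0.

Lemma model_coord_dpl (x y : R) :
  differentiable_pt_lim (fun u v => fst (Cmult m (u, v))) x y (fst m) (- snd m) /\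
  differentiable_pt_lim (fun u v => snd (Cmult m (u, v))) x y (snd m) (fst m).
Proof.
  split; (eapply differentiable_pt_lim_ext; [|apply (dpl_linear _ _ 0)]);
    exists (mkposreal _ Rlt_0_1); intros; simpl; ring.
Qed.

Lemma model_comp_dpl (f g f' g' : R -> R) (p q x y : R) :
  (forall x, is_derive f x (f' x)) -> (forall x, is_derive g x (g' x)) ->
  differentiable_pt_lim (fun u v => p * f (fst (Cmult m (u, v))) + q * g (snd (Cmult m (u, v)))) x y
    (p * fst m * f' (fst (Cmult m (x, y))) + q * snd m * g' (snd (Cmult m (x, y))))
    (- p * snd m * f' (fst (Cmult m (x, y))) + q * fst m * g' (snd (Cmult m (x, y)))).
Proof.
  intros Hf Hg. destruct (model_coord_dpl x y) as [X Y].
  eapply dpl_eq; [apply dpl_plus; apply dpl_scal;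
    [apply (dpl_1d f _ x y); [apply is_derive_Reals, Hf|exact X]
    |apply (dpl_1d g _ x y); [apply is_derive_Reals, Hg|exact Y]]| |]; simpl; ring.
Qed.

Lemma model_comp_cont (f : R -> R) (x y : R) : (forall x, continuous f x) ->
  continuity_2d_pt (fun u v => f (fst (Cmult m (u, v)))) x y /\
  continuity_2d_pt (fun u v => f (snd (Cmult m (u, v)))) x y.
Proof.
  intros Hf. destruct (model_coord_dpl x y) as [X Y].
  split.
  - apply (continuity_1d_2d_pt_comp f (fun u v => fst (Cmult m (u, v)))).
    + apply continuity_pt_filterlim, Hf.
    + apply differentiable_continuity_pt. eexists; eexists; exact X.
  - apply (continuity_1d_2d_pt_comp f (fun u v => snd (Cmult m (u, v)))).
    + apply continuity_pt_filterlim, Hf.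
    + apply differentiable_continuity_pt. eexists; eexists; exact Y.
Qed.

Lemma model_C2 (U : C -> Prop) : open_set U -> C2_on U model_rho /\
  forall x y, U (x, y) ->
    let X := fst (Cmult m (x, y)) in let Y := snd (Cmult m (x, y)) in
    dx model_rho x y = fst m * phi1 X + snd m * psi1 Y /\
    dy model_rho x y = - snd m * phi1 X + fst m * psi1 Y /\
    dx (dx model_rho) x y = fst m * fst m * phi2 X + snd m * snd m * psi2 Y /\
    dy (dx model_rho) x y = - fst m * snd m * phi2 X + snd m * fst m * psi2 Y /\
    dy (dy model_rho) x y = snd m * snd m * phi2 X + fst m * fst m * psi2 Y.
Proof.
  intros HU.
  destruct (C2_on_intro U HU model_rho
    (fun x y => fst m * phi1 (fst (Cmult m (x, y))) + snd m * psi1 (snd (Cmult m (x, y))))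
    (fun x y => - snd m * phi1 (fst (Cmult m (x, y))) + fst m * psi1 (snd (Cmult m (x, y))))
    (fun x y => fst m * fst m * phi2 (fst (Cmult m (x, y))) + snd m * snd m * psi2 (snd (Cmult m (x, y))))
    (fun x y => - fst m * snd m * phi2 (fst (Cmult m (x, y))) + snd m * fst m * psi2 (snd (Cmult m (x, y))))
    (fun x y => - snd m * fst m * phi2 (fst (Cmult m (x, y))) + fst m * snd m * psi2 (snd (Cmult m (x, y))))
    (fun x y => snd m * snd m * phi2 (fst (Cmult m (x, y))) + fst m * fst m * psi2 (snd (Cmult m (x, y))))) as [A B].
  - intros x y _. eapply dpl_eq; [|apply Rmult_1_l|apply Rmult_1_l].
    eapply differentiable_pt_lim_ext.
    2: { eapply dpl_eq; [apply (model_comp_dpl phi psi phi1 psi1 1 1); assumption| |]; ring. }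
    exists (mkposreal _ Rlt_0_1). intros; unfold model_rho. ring.
  - intros x y _. apply (model_comp_dpl phi1 psi1 phi2 psi2); assumption.
  - intros x y _. eapply dpl_eq; [apply (model_comp_dpl phi1 psi1 phi2 psi2); assumption| |]; simpl; ring.
  - intros x y _. destruct (model_comp_cont phi2 x y Cphi2) as [c1 _].
    destruct (model_comp_cont psi2 x y Cpsi2) as [_ c2]. repeat split; cont2.
  - split; auto. intros x y Hp. destruct (B x y Hp) as [E1 [E2 [E3 [E4 [_ E6]]]]]. auto 10.
Qed.

Lemma model_coord_small (w w' : C) (d : R) : 0 < d ->
  Cmod (Cminus w' w) < d / (Cmod m + 1) -> Rabs (snd (Cmult m w') - snd (Cmult m w)) < d.
Proof.
  intros Hd H. pose proof (Cmod_ge_0 m).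
  replace (snd (Cmult m w') - snd (Cmult m w)) with (snd (Cmult m (Cminus w' w))) by (simpl; ring).
  eapply Rle_lt_trans; [apply Cmod_comp_le|]. rewrite Cmod_mult.
  apply Rle_lt_trans with ((Cmod m + 1) * Cmod (Cminus w' w)).
  - pose proof (Cmod_ge_0 (Cminus w' w)). nra.
  - replace d with ((Cmod m + 1) * (d / (Cmod m + 1))) by (field; lra).
    apply Rmult_lt_compat_l; lra.
Qed.

Lemma model_strip_open : open_set (fun w => J (snd (Cmult m w))).
Proof.
  intros p Hp. destruct (Jopen _ Hp) as [d [Hd H]].
  exists (d / (Cmod m + 1)). pose proof (Cmod_ge_0 m). split.
  - apply Rdiv_lt_0_compat; lra.
  - intros q Hq. apply H. now apply model_coord_small.
Qed.

Lemma model_rho_cont (x y : R) : continuity_2d_pt model_rho x y.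
Proof.
  apply differentiable_continuity_pt. eexists; eexists.
  apply (C1_on_differentiable (fun _ => True)); auto.
  - intros p _. exists 1. split; [lra|auto].
  - apply (model_C2 (fun _ => True)). intros p _. exists 1. split; [lra|auto].
Qed.

(** s = 1 serves the openness of [D]; s = -1 keeps [rho] positive near a point on the edge of the
    strip, which therefore cannot be a boundary point. *)
Lemma model_sign_stable (p : C) (s : R) : s * model_rho (fst p) (snd p) < 0 ->
  exists d, 0 < d /\ forall q, Cmod (Cminus q p) < d -> s * model_rho (fst q) (snd q) < 0.
Proof.
  intros H. set (v := model_rho (fst p) (snd p)) in *.
  assert (He : 0 < - (s * v) / (Rabs s + 1)).
  { apply Rdiv_lt_0_compat; [lra|]. pose proof (Rabs_pos s). lra. }
  destruct (model_rho_cont (fst p) (snd p) (mkposreal _ He)) as [d Hd]. simpl in Hd. fold v in Hd.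
  exists d. split; [apply cond_pos|]. intros q Hq.
  destruct (Cmod_comp_le (Cminus q p)) as [B1 B2]. simpl in B1, B2.
  specialize (Hd (fst q) (snd q)). unfold Rminus in Hd. specialize (Hd ltac:(lra) ltac:(lra)).
  set (v' := model_rho (fst q) (snd q)) in *.
  assert (Rabs (s * (v' + - v)) < - (s * v)).
  { rewrite Rabs_mult. pose proof (Rabs_pos s). pose proof (Rabs_pos (v' + - v)).
    apply Rle_lt_trans with ((Rabs s + 1) * Rabs (v' + - v)); [nra|].
    replace (- (s * v)) with ((Rabs s + 1) * (- (s * v) / (Rabs s + 1))) by (field; lra).
    apply Rmult_lt_compat_l; lra. }
  apply Rabs_def2 in H0. lra.
Qed.

Lemma model_open : open_set D.
Proof.
  intros p Hp. apply HD in Hp. destruct Hp as [Hp1 Hp2].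
  destruct (model_strip_open p Hp1) as [d1 [Hd1 S1]].
  destruct (model_sign_stable p 1) as [d2 [Hd2 S2]]; [lra|].
  exists (Rmin d1 d2). split; [now apply Rmin_pos|]. intros q Hq.
  pose proof (Rmin_l d1 d2). pose proof (Rmin_r d1 d2).
  apply HD. split; [apply S1; lra|]. specialize (S2 q). lra.
Qed.

(** As [rho] separates the coordinates of m w, the two one-variable bounds simply add, and
    multiplication by [m] scales squared lengths by |m|^2. *)
Lemma model_convex (k : R) (w1 w2 : C) : J (snd (Cmult m w1)) -> J (snd (Cmult m w2)) ->
  (forall x, 2 * k <= phi2 x) ->
  (forall y, Rmin (snd (Cmult m w1)) (snd (Cmult m w2)) <= y <= Rmax (snd (Cmult m w1)) (snd (Cmult m w2)) ->
     2 * k <= psi2 y) ->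
  phi1 (fst (Cmult m w1)) * fst (Cmult m (Cminus w2 w1)) + psi1 (snd (Cmult m w1)) * snd (Cmult m (Cminus w2 w1))
  + k * Cmod m ^ 2 * Cmod (Cminus w2 w1) ^ 2
  <= model_rho (fst w2) (snd w2) - model_rho (fst w1) (snd w1).
Proof.
  intros J1 J2 B1 B2.
  pose proof (convex_quadratic_bound phi phi1 phi2 k (fst (Cmult m w1)) (fst (Cmult m w2)) Dphi Dphi1 (fun x _ => B1 x)) as I1.
  pose proof (convex_quadratic_bound psi psi1 psi2 k (snd (Cmult m w1)) (snd (Cmult m w2)) Dpsi Dpsi1 B2) as I2.
  replace (k * Cmod m ^ 2 * Cmod (Cminus w2 w1) ^ 2) with (k * Cmod (Cmult m (Cminus w2 w1)) ^ 2)
    by (rewrite Cmod_mult; ring).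
  rewrite Cmod_sqr. unfold model_rho. rewrite <- !surjective_pairing.
  replace (fst (Cmult m (Cminus w2 w1))) with (fst (Cmult m w2) - fst (Cmult m w1)) by (simpl; ring).
  replace (snd (Cmult m (Cminus w2 w1))) with (snd (Cmult m w2) - snd (Cmult m w1)) by (simpl; ring).
  lra.
Qed.

(** The gradient cannot vanish at a boundary point: by [model_convex] with k = 0 a critical point
    minimises the convex [rho], so [rho] would be negative there as it is at [p0], putting the point
    in [D]. In the coordinates of m w the Hessian is diagonal with positive entries, so it is
    positive in every direction. *)
Lemma model_strongly_convex : (exists p, D p) ->
  (forall p, boundary_pt D p -> J (snd (Cmult m p))) -> strongly_convex D.
Proof.
  intros [p0 Hp0] HB. apply HD in Hp0. destruct Hp0 as [J0 R0].
  pose proof (sqr_norm_pos (fst m) (snd m)) as Pm. rewrite <- surjective_pairing in Pm. specialize (Pm Hm).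
  destruct (model_C2 _ model_strip_open) as [C E].
  exists (fun w => J (snd (Cmult m w))), model_rho.
  split; [exact model_strip_open|]. split; [exact HB|]. split; [exact C|]. split.
  - intros x y Hp. pose proof (HD (x, y)) as Q.
    change (model_rho (fst (x, y)) (snd (x, y))) with (model_rho x y) in Q. tauto.
  - intros x y Hb. pose proof (HB _ Hb) as Hp. destruct (E x y Hp) as [E1 [E2 [E3 [E4 E5]]]].
    set (X := fst (Cmult m (x, y))) in *. set (Y := snd (Cmult m (x, y))) in *.
    split.
    + rewrite E1, E2.
      destruct (Req_dec (fst m * phi1 X + snd m * psi1 Y) 0) as [Z1|]; auto.
      destruct (Req_dec (- snd m * phi1 X + fst m * psi1 Y) 0) as [Z2|]; auto. exfalso.
      assert (Z3 : phi1 X = 0).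
      { assert ((fst m * fst m + snd m * snd m) * phi1 X = 0); [|nra].
        transitivity (fst m * (fst m * phi1 X + snd m * psi1 Y) - snd m * (- snd m * phi1 X + fst m * psi1 Y)); [ring|].
        rewrite Z1, Z2; ring. }
      assert (Z4 : psi1 Y = 0).
      { assert ((fst m * fst m + snd m * snd m) * psi1 Y = 0); [|nra].
        transitivity (snd m * (fst m * phi1 X + snd m * psi1 Y) + fst m * (- snd m * phi1 X + fst m * psi1 Y)); [ring|].
        rewrite Z1, Z2; ring. }
      pose proof (model_convex 0 (x, y) p0 Hp J0) as Q.
      fold X in Q. fold Y in Q. rewrite Z3, Z4 in Q.
      specialize (Q ltac:(intros t; specialize (Pphi t); lra)
        ltac:(intros t Ht; assert (J t) by (apply (Jconv Y (snd (Cmult m p0))); auto); specialize (Ppsi t H); lra)).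
      assert (model_rho x y < 0) by (change (model_rho (fst (x, y)) (snd (x, y))) with (model_rho x y) in Q; lra).
      apply (proj1 Hb). apply HD. auto.
    + intros w1 w2 Hw _. rewrite E3, E4, E5.
      pose proof (Pphi X) as PX. pose proof (Ppsi Y Hp) as PY.
      replace (_ + _) with (phi2 X * (fst m * w1 - snd m * w2) ^ 2 + psi2 Y * (snd m * w1 + fst m * w2) ^ 2) by ring.
      assert (Q : 0 < (fst m * w1 - snd m * w2) ^ 2 + (snd m * w1 + fst m * w2) ^ 2).
      { replace (_ + _) with ((fst m * fst m + snd m * snd m) * (w1 * w1 + w2 * w2)) by ring.
        apply Rmult_lt_0_compat; auto. destruct Hw; nra. }
      set (s := (fst m * w1 - snd m * w2) ^ 2) in *. set (t := (snd m * w1 + fst m * w2) ^ 2) in *.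
      assert (0 <= s) by apply pow2_ge_0. assert (0 <= t) by apply pow2_ge_0.
      destruct (Req_dec s 0) as [Zs|]; [rewrite Zs in *|]; nra.
Qed.
End Model.

(** * Factorisation of the quadratic polynomial *)

(** Half-angle formulas: the squared parts of the root are (|w| + x)/2 and (|w| - x)/2, and the sign
    of y fixes the relative sign. *)
Lemma Csqrt_ex (w : C) : exists s, Cmult s s = w.
Proof.
  destruct w as [x y]. set (r := Cmod (x, y)).
  pose proof (Cmod_sqr (x, y)) as E. simpl in E. fold r in E.
  pose proof (Cmod_ge_0 (x, y)) as Hr. fold r in Hr.
  assert (Hx : - r <= x <= r) by (split; nra).
  assert (U : sqrt ((r + x) / 2) * sqrt ((r + x) / 2) = (r + x) / 2) by (apply sqrt_sqrt; lra).
  assert (V : sqrt ((r - x) / 2) * sqrt ((r - x) / 2) = (r - x) / 2) by (apply sqrt_sqrt; lra).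
  pose proof (sqrt_pos ((r + x) / 2)). pose proof (sqrt_pos ((r - x) / 2)).
  set (u := sqrt ((r + x) / 2)) in *. set (v := sqrt ((r - x) / 2)) in *.
  assert (UV : (2 * (u * v)) * (2 * (u * v)) = y * y).
  { transitivity (4 * (u * u) * (v * v)); [ring|]. rewrite U, V. nra. }
  assert (0 <= u * v) by now apply Rmult_le_pos.
  destruct (Rle_dec 0 y).
  - exists (u, v). unfold Cmult; simpl. f_equal; [lra|]. nra.
  - exists (u, - v). unfold Cmult; simpl. f_equal; [lra|]. nra.
Qed.

Definition lin (al z : C) : C := Cminus (RtoC 1) (Cmult al z).

(** [al] and [be] are the roots of the reversed polynomial z^2 + a z + lam, that is, the reciprocals
    of the zeros of q. Reversal keeps the leading coefficient 1, so lam = 0 only makes a root 0. *)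
Lemma qpoly_factor (a lam : C) : (forall z, Cmod z <= 1 -> qpoly a lam z <> RtoC 0) ->
  exists al be, Cmod al < 1 /\ Cmod be < 1 /\ a = Copp (Cplus al be) /\ lam = Cmult al be.
Proof.
  intros H.
  destruct (Csqrt_ex (Cminus (Cmult a a) (Cmult (RtoC 4) lam))) as [s Hs].
  assert (H2 : RtoC 2 <> RtoC 0) by (intros E; apply RtoC_inj in E; lra).
  set (al := Cdiv (Cplus (Copp a) s) (RtoC 2)). set (be := Cdiv (Cminus (Copp a) s) (RtoC 2)).
  assert (Ea : a = Copp (Cplus al be)) by (unfold al, be; field; auto).
  assert (El : lam = Cmult al be).
  { transitivity (Cdiv (Cminus (Cmult a a) (Cmult s s)) (RtoC 4)).
    - rewrite Hs. field.
    - unfold al, be. replace (RtoC 4) with (Cmult (RtoC 2) (RtoC 2)); [field; auto|].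
      unfold RtoC, Cmult; simpl. f_equal; ring. }
  (* A root [x] of modulus at least 1 would make its inverse a zero of q in the closed disc. *)
  assert (K : forall x y, a = Copp (Cplus x y) -> lam = Cmult x y -> Cmod x < 1).
  { intros x y E1 E2. destruct (Rlt_dec (Cmod x) 1) as [|Hn]; auto. exfalso.
    assert (Hx : x <> RtoC 0) by (intros ->; rewrite Cmod_0 in Hn; lra).
    apply (H (Cinv x)).
    - rewrite Cmod_inv by auto. rewrite <- Rinv_1. apply Rinv_le_contravar; lra.
    - unfold qpoly. rewrite E1, E2. field. auto. }
  exists al, be. repeat split; auto.
  - now apply (K al be).
  - apply (K be al); [rewrite Ea; ring|rewrite El; ring].
Qed.

(** Positive real part keeps the factor where [clog] is a logarithm; the lower bound on the modulus
    controls 1/q and enters the constants [delta]. *)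
Lemma lin_re_pos (al z : C) : Cmod al * Cmod z < 1 -> 0 < fst (lin al z) /\ 1 - Cmod al * Cmod z <= Cmod (lin al z).
Proof.
  intros H. rewrite <- Cmod_mult in *. split.
  - unfold lin. pose proof (proj1 (Cmod_comp_le (Cmult al z))) as B.
    change (0 < 1 - fst (Cmult al z)). pose proof (Rle_abs (fst (Cmult al z))). lra.
  - unfold lin. pose proof (Cmod_triangle (Cminus (RtoC 1) (Cmult al z)) (Cmult al z)) as T.
    replace (Cplus (Cminus (RtoC 1) (Cmult al z)) (Cmult al z)) with (RtoC 1) in T by ring.
    rewrite Cmod_1 in T. lra.
Qed.

Lemma lin_neq_0 (al z : C) : Cmod al * Cmod z < 1 -> lin al z <> RtoC 0.
Proof. intros H E. destruct (lin_re_pos al z H) as [P _]. rewrite E in P. simpl in P. lra. Qed.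

Lemma cderiv_lin (al z : C) : cderiv (lin al) z (Copp al).
Proof.
  apply cderiv_ext with (fun w => Cplus (RtoC 1) (Cmult (Copp al) w)); [intros; unfold lin; ring|].
  eapply cderiv_eq; [apply cderiv_plus; [apply cderiv_const|apply cderiv_scal, cderiv_id]|]. ring.
Qed.

(** With M the larger modulus this is the harmonic mean of 1 and 1/M, hence strictly between the
    unit circle and the zeros of q; the formula also covers M = 0. *)
Definition radius (al be : C) : R := 2 / (1 + Rmax (Cmod al) (Cmod be)).

Lemma radius_spec (al be : C) : Cmod al < 1 -> Cmod be < 1 ->
  1 < radius al be /\ Cmod al * radius al be < 1 /\ Cmod be * radius al be < 1.
Proof.
  intros Ha Hb. unfold radius. set (M := Rmax (Cmod al) (Cmod be)).
  pose proof (Rmax_l (Cmod al) (Cmod be)) as Ml. pose proof (Rmax_r (Cmod al) (Cmod be)) as Mr. fold M in Ml, Mr.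
  assert (M1 : M < 1) by (apply Rmax_lub_lt; auto).
  pose proof (Cmod_ge_0 al). pose proof (Cmod_ge_0 be).
  assert (P : 0 < / (1 + M)) by (apply Rinv_0_lt_compat; lra).
  assert (E : (1 + M) * / (1 + M) = 1) by (apply Rinv_r; lra).
  unfold Rdiv. repeat split; nra.
Qed.

Section Factored.
Variables (al be : C) (c : R).
Hypothesis Ha : Cmod al < 1.
Hypothesis Hb : Cmod be < 1.
Hypothesis Hc : 0 < c.
Let a : C := Copp (Cplus al be).
Let lam : C := Cmult al be.
Let R1 := radius al be.

Lemma qpoly_lin (z : C) : qpoly a lam z = Cmult (lin al z) (lin be z).
Proof. unfold qpoly, lin, a, lam. ring. Qed.

Lemma lin_in_disc (x z : C) : (x = al \/ x = be) -> Cmod z < R1 -> Cmod x * Cmod z < 1.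
Proof.
  intros Hx Hz. destruct (radius_spec al be Ha Hb) as [_ [A B]]. fold R1 in A, B.
  pose proof (Cmod_ge_0 al). pose proof (Cmod_ge_0 be). pose proof (Cmod_ge_0 z).
  destruct Hx as [->| ->]; nra.
Qed.

Lemma qpoly_lower (z : C) : Cmod z < R1 ->
  (1 - Cmod al * R1) * (1 - Cmod be * R1) <= Cmod (qpoly a lam z).
Proof.
  intros Hz. rewrite qpoly_lin, Cmod_mult.
  destruct (lin_re_pos al z (lin_in_disc al z (or_introl eq_refl) Hz)) as [_ A].
  destruct (lin_re_pos be z (lin_in_disc be z (or_intror eq_refl) Hz)) as [_ B].
  destruct (radius_spec al be Ha Hb) as [_ [A' B']]. fold R1 in A', B'.
  pose proof (Cmod_ge_0 al). pose proof (Cmod_ge_0 be). pose proof (Cmod_ge_0 z).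
  apply Rmult_le_compat; nra.
Qed.

Lemma qpoly_neq_0 (z : C) : Cmod z < R1 -> qpoly a lam z <> RtoC 0.
Proof.
  intros Hz. rewrite qpoly_lin. apply Cmult_neq_0; apply lin_neq_0; apply lin_in_disc; auto.
Qed.

Definition dquot (a lam : C) (c : R) (z : C) : C :=
  Cmult (Cmult (RtoC (- c)) (Cplus a (Cmult (Cmult (RtoC 2) lam) z)))
        (Cinv (Cmult (qpoly a lam z) (qpoly a lam z))).

Lemma cderiv_qpoly (z : C) : cderiv (qpoly a lam) z (Cplus a (Cmult (Cmult (RtoC 2) lam) z)).
Proof.
  eapply cderiv_eq.
  - apply (cderiv_plus (fun z => Cplus (RtoC 1) (Cmult a z)) (fun z => Cmult lam (Cmult z z))).
    + apply cderiv_plus; [apply cderiv_const|apply cderiv_scal, cderiv_id].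
    + apply cderiv_scal. apply cderiv_mult; apply cderiv_id.
  - replace (RtoC 2) with (Cplus (RtoC 1) (RtoC 1)) by (rewrite <- RtoC_plus; f_equal; ring). ring.
Qed.

Lemma quot_calculus :
  (forall z, Cmod z < R1 -> cderiv (fun z => Cdiv (RtoC c) (qpoly a lam z)) z (dquot a lam c z)) /\
  holomorphic_on (fun z => Cmod z < R1) (dquot a lam c) /\
  exists K, forall z, Cmod z < R1 -> Cmod (Cdiv (RtoC c) (qpoly a lam z)) <= K.
Proof.
  split; [|split].
  - intros z Hz. pose proof (qpoly_neq_0 z Hz) as Q. eapply cderiv_eq.
    + apply cderiv_scal. apply (cderiv_comp Cinv (qpoly a lam)); [now apply cderiv_inv|apply cderiv_qpoly].
    + unfold dquot. rewrite RtoC_opp. ring.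
  - intros z Hz. pose proof (qpoly_neq_0 z Hz) as Q. eexists.
    apply cderiv_mult.
    + apply cderiv_scal. apply cderiv_plus; [apply cderiv_const|apply cderiv_scal, cderiv_id].
    + apply (cderiv_comp Cinv (fun z => Cmult (qpoly a lam z) (qpoly a lam z))).
      * apply cderiv_inv. now apply Cmult_neq_0.
      * apply cderiv_mult; apply cderiv_qpoly.
  - destruct (radius_spec al be Ha Hb) as [_ [A' B']]. fold R1 in A', B'.
    exists (c / ((1 - Cmod al * R1) * (1 - Cmod be * R1))). intros z Hz.
    rewrite Cmod_div by now apply qpoly_neq_0. rewrite Cmod_R, Rabs_right by lra.
    apply Rmult_le_compat_l; [lra|]. apply Rinv_le_contravar; [|now apply qpoly_lower].
    apply Rmult_lt_0_compat; lra.
Qed.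
End Factored.

(** * Equal roots *)

(** The interface between the explicit constructions, one for equal and one for distinct roots, and
    the extremal argument. [G] is the inverse on the image, and the inequality with [delta] is
    strong convexity at boundary points, with normal zeta F'(zeta). *)
Definition convex_extension (al be : C) (c : R) (Ft : C -> C) : Prop :=
  let a := Copp (Cplus al be) in
  let lam := Cmult al be in
  let D := fun w : C => exists z, unit_disc z /\ w = Ft z in
  Ft (RtoC 0) = RtoC 0 /\
  (forall z, Cmod z < radius al be -> cderiv Ft z (Cdiv (RtoC c) (qpoly a lam z))) /\
  (exists delta, 0 < delta /\ forall zeta z, Cmod zeta = 1 -> Cmod z < 1 ->
    fst (Cmult (Cmult (Cconj zeta) (qpoly a lam zeta)) (Cminus (Ft z) (Ft zeta)))
    <= - delta * Cmod (Cminus (Ft z) (Ft zeta)) ^ 2) /\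
  open_set D /\ strongly_convex D /\
  exists G, forall z, unit_disc z -> G (Ft z) = z /\ exists l, cderiv G (Ft z) l.

Lemma Cmod_sqr_conj (z : C) : RtoC (Cmod z ^ 2) = Cmult z (Cconj z).
Proof. rewrite <- Cmod2_conj. now rewrite RtoC_pow. Qed.

Lemma unit_conj (z : C) : Cmod z = 1 -> Cmult z (Cconj z) = RtoC 1.
Proof. intros H. rewrite <- Cmod_sqr_conj, H. f_equal. ring. Qed.

Lemma fst_real_mult (k : R) (z : C) : fst (Cmult (RtoC k) z) = k * fst z.
Proof. simpl. ring. Qed.

Lemma RtoC_neq_0 (r : R) : r <> 0 -> RtoC r <> RtoC 0.
Proof. intros H E. apply RtoC_inj in E. auto. Qed.

Lemma Cconj_RtoC (r : R) : Cconj (RtoC r) = RtoC r.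
Proof. unfold Cconj, RtoC. simpl. f_equal. ring. Qed.

Lemma Cinv_nonzero (z : C) : z <> RtoC 0 -> Cinv z <> RtoC 0.
Proof.
  intros H E. apply (RtoC_neq_0 1); [lra|]. rewrite <- (Cinv_r z H), E. ring.
Qed.

Section Equal_roots.
Variables (al : C) (c : R).
Hypothesis Ha : Cmod al < 1.
Hypothesis Hc : 0 < c.
Let A : R := 1 - Cmod al ^ 2.
Let Ft (z : C) : C := Cdiv (Cmult (RtoC c) z) (lin al z).
(** phi(Re w) + psi(Im w) is |w|^2 - |c + al w|^2, negative exactly where the inverse Moebius map w
    / (c + al w) takes values in the disc. *)
Let phi (x : R) : R := A * x ^ 2 - 2 * c * fst al * x - c ^ 2.
Let phi1 (x : R) : R := 2 * A * x - 2 * c * fst al.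
Let psi (y : R) : R := A * y ^ 2 + 2 * c * snd al * y.
Let psi1 (y : R) : R := 2 * A * y + 2 * c * snd al.
Let D := fun w : C => exists z, unit_disc z /\ w = Ft z.
Let rho := model_rho (RtoC 1) phi psi.
Let den (w : C) : C := Cplus (RtoC c) (Cmult al w).

Let A_pos : 0 < A.
Proof. unfold A. pose proof (Cmod_ge_0 al). nra. Qed.

Let al_small (z : C) : Cmod z <= 1 -> Cmod al * Cmod z < 1.
Proof. intros Hz. pose proof (Cmod_ge_0 al). pose proof (Cmod_ge_0 z). nra. Qed.

Let rho_eq (w : C) : rho (fst w) (snd w) = Cmod w ^ 2 - Cmod (den w) ^ 2.
Proof.
  rewrite !Cmod_sqr. unfold rho, model_rho, phi, psi, A, den. rewrite Cmod_sqr. simpl. ring.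
Qed.

Let den_Ft (z : C) : Cmod z <= 1 -> den (Ft z) = Cdiv (RtoC c) (lin al z) /\ Ft z = Cmult z (den (Ft z)).
Proof.
  intros Hz. pose proof (lin_neq_0 al z (al_small z Hz)) as N.
  assert (E : den (Ft z) = Cdiv (RtoC c) (lin al z)).
  { unfold den, Ft. unfold lin in *. field. exact N. }
  split; auto. rewrite E. unfold Ft. field. exact N.
Qed.

Let den_neq_0 (z : C) : Cmod z <= 1 -> den (Ft z) <> RtoC 0.
Proof.
  intros Hz. rewrite (proj1 (den_Ft z Hz)). unfold Cdiv. apply Cmult_neq_0.
  - apply RtoC_neq_0. lra.
  - apply Cinv_nonzero. apply lin_neq_0, al_small, Hz.
Qed.

(* The convex defining function is [(|z|^2 - 1) / |q z|] in the coordinate [z], up to a constant. *)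
Let rho_Ft (z : C) : Cmod z <= 1 -> rho (fst (Ft z)) (snd (Ft z)) = (Cmod z ^ 2 - 1) * Cmod (den (Ft z)) ^ 2.
Proof.
  intros Hz. rewrite rho_eq. rewrite (proj2 (den_Ft z Hz)) at 1. rewrite Cmod_mult. ring.
Qed.

Let D_iff (w : C) : D w <-> True /\ rho (fst w) (snd w) < 0.
Proof.
  split.
  - intros [z [Hz ->]]. split; auto. unfold unit_disc in Hz. rewrite rho_Ft by lra.
    pose proof (Cmod_ge_0 z).
    assert (0 < Cmod (den (Ft z))) by (apply Cmod_gt_0, den_neq_0; lra).
    assert (0 < Cmod (den (Ft z)) ^ 2) by (apply pow_lt; auto).
    assert (0 < (1 - Cmod z ^ 2) * Cmod (den (Ft z)) ^ 2) by (apply Rmult_lt_0_compat; nra). lra.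
  - intros [_ H]. rewrite rho_eq in H.
    pose proof (Cmod_ge_0 w). pose proof (Cmod_ge_0 (den w)).
    assert (L : Cmod w < Cmod (den w)).
    { apply Rnot_le_lt. intros Hle.
      assert (Cmod (den w) ^ 2 <= Cmod w ^ 2) by (apply pow_incr; lra). lra. }
    assert (N : den w <> RtoC 0) by (intros E; rewrite E, Cmod_0 in L; lra).
    exists (Cdiv w (den w)). split.
    + unfold unit_disc. rewrite Cmod_div by auto. apply Rmult_lt_reg_r with (Cmod (den w)); [lra|].
      unfold Rdiv. rewrite Rmult_assoc, Rinv_l by lra. lra.
    + assert (Hc' : RtoC c <> RtoC 0) by (apply RtoC_neq_0; lra).
      unfold Ft, lin. unfold den in *. field.
      split; auto. replace (Cminus _ _) with (RtoC c) by ring. auto.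
Qed.

Lemma equal_roots_extension : convex_extension al al c Ft.
Proof.
  assert (Hm : RtoC 1 <> RtoC 0) by (apply RtoC_neq_0; lra).
  assert (d1 : forall x, is_derive phi x (phi1 x)) by (intros; unfold phi, phi1; auto_derive; auto; ring).
  assert (d2 : forall x, is_derive phi1 x (2 * A)) by (intros; unfold phi1; auto_derive; auto; ring).
  assert (d3 : forall x, is_derive psi x (psi1 x)) by (intros; unfold psi, psi1; auto_derive; auto; ring).
  assert (d4 : forall x, is_derive psi1 x (2 * A)) by (intros; unfold psi1; auto_derive; auto; ring).
  assert (d5 : forall x : R, continuous (fun _ : R => 2 * A) x) by (intros; apply continuous_const).
  assert (Jo : forall y : R, True -> exists d, 0 < d /\ forall y' : R, Rabs (y' - y) < d -> True)
    by (intros; exists 1; split; [lra|auto]).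
  assert (Z : Cmod (RtoC 0) = 0) by apply Cmod_0.
  assert (F0 : Ft (RtoC 0) = RtoC 0).
  { unfold Ft, lin. field. }
  split; [exact F0|split; [|split; [|split; [|split]]]].
  - intros z Hz. pose proof (lin_in_disc al al Ha Ha al z (or_introl eq_refl) Hz) as S.
    pose proof (lin_neq_0 al z S) as N. eapply cderiv_eq.
    + apply cderiv_mult; [apply cderiv_scal, cderiv_id|].
      apply (cderiv_comp Cinv (lin al)); [now apply cderiv_inv|apply cderiv_lin].
    + rewrite qpoly_lin. unfold lin in *. field. exact N.
  (* [A] is the convexity constant of [rho], (1 - |al|)^2 bounds |lin al zeta|^2 below, and 2c is
     the factor in the gradient identity [E3]. *)
  - exists (A * (1 - Cmod al) ^ 2 / (2 * c)).
    split. { apply Rdiv_lt_0_compat; [|lra]. apply Rmult_lt_0_compat; auto. apply pow_lt; lra. }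
    intros zeta z Hzeta Hz.
    pose proof (model_convex (RtoC 1) phi phi1 (fun _ => 2 * A) psi psi1 (fun _ => 2 * A) (fun _ => True)
      d1 d2 d3 d4 A (Ft zeta) (Ft z) I I) as Q. fold rho in Q.
    specialize (Q ltac:(intros; lra) ltac:(intros; lra)).
    rewrite !rho_Ft in Q by lra. rewrite Hzeta, Cmod_1 in Q.
    set (w := Ft zeta) in *. set (de := Cminus (Ft z) w) in *.
    assert (N : lin al zeta <> RtoC 0) by (apply lin_neq_0, al_small; lra).
    assert (E1 : Cmult (Cconj w) (Cconj (lin al zeta)) = Cmult (RtoC c) (Cconj zeta)).
    { rewrite <- Cmult_conj. unfold w, Ft. replace (Cmult _ (lin al zeta)) with (Cmult (RtoC c) zeta) by (field; auto).
      now rewrite Cmult_conj, Cconj_RtoC. }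
    (* [A conj w - c al] is half the conjugate gradient of [rho] at w. On the circle zeta conj zeta
       = 1 turns the remaining factor conj zeta - al into conj zeta times [lin al zeta], which
       completes q. *)
    assert (E2 : Cmult (Cminus (Cmult (RtoC A) (Cconj w)) (Cmult (RtoC c) al)) (RtoC (Cmod (lin al zeta) ^ 2))
       = Cmult (RtoC c) (Cmult (Cconj zeta) (qpoly (Copp (Cplus al al)) (Cmult al al) zeta))).
    { rewrite Cmod_sqr_conj, qpoly_lin. unfold A. rewrite RtoC_minus, Cmod_sqr_conj.
      transitivity (Cmult (lin al zeta) (Cminus (Cmult (Cminus (RtoC 1) (Cmult al (Cconj al))) (Cmult (Cconj w) (Cconj (lin al zeta))))
         (Cmult (Cmult (RtoC c) al) (Cconj (lin al zeta))))); [ring|].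
      rewrite E1. unfold lin at 2. rewrite Cminus_conj, Cmult_conj, Cconj_RtoC.
      pose proof (unit_conj zeta Hzeta) as U.
      transitivity (Cmult (Cmult (RtoC c) (lin al zeta)) (Cminus (Cconj zeta) (Cmult al (RtoC 1)))); [ring|].
      rewrite <- U. unfold lin. ring. }
    assert (E3 : (phi1 (fst (Cmult (RtoC 1) w)) * fst (Cmult (RtoC 1) de) + psi1 (snd (Cmult (RtoC 1) w)) * snd (Cmult (RtoC 1) de))
      * Cmod (lin al zeta) ^ 2 = 2 * c * fst (Cmult (Cmult (Cconj zeta) (qpoly (Copp (Cplus al al)) (Cmult al al) zeta)) de)).
    { transitivity (2 * fst (Cmult (Cmult (Cminus (Cmult (RtoC A) (Cconj w)) (Cmult (RtoC c) al)) (RtoC (Cmod (lin al zeta) ^ 2))) de)).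
      - unfold phi1, psi1. generalize (Cmod (lin al zeta) ^ 2); intros n2. simpl. ring.
      - rewrite E2. rewrite <- Cmult_assoc. rewrite fst_real_mult. ring. }
    set (P := phi1 _ * _ + psi1 _ * _) in *.
    set (Y := fst (Cmult (Cmult (Cconj zeta) _) de)) in *.
    destruct (lin_re_pos al zeta (al_small zeta ltac:(lra))) as [_ L]. rewrite Hzeta, Rmult_1_r in L.
    assert (L2 : (1 - Cmod al) ^ 2 <= Cmod (lin al zeta) ^ 2) by (apply pow_incr; lra).
    assert (0 <= Cmod (den (Ft z)) ^ 2) by apply pow2_ge_0.
    assert (0 <= Cmod de ^ 2) by apply pow2_ge_0.
    assert (Cmod z ^ 2 <= 1) by (pose proof (Cmod_ge_0 z); nra).
    assert (P <= - (A * Cmod de ^ 2)) by nra.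
    assert (P * Cmod (lin al zeta) ^ 2 <= - (A * Cmod de ^ 2) * (1 - Cmod al) ^ 2).
    { assert (0 <= A * Cmod de ^ 2) by (apply Rmult_le_pos; lra).
      assert (0 <= (1 - Cmod al) ^ 2) by apply pow2_ge_0. nra. }
    apply Rmult_le_reg_l with (2 * c); [lra|].
    replace (2 * c * (- (A * (1 - Cmod al) ^ 2 / (2 * c)) * Cmod de ^ 2)) with (- (A * Cmod de ^ 2) * (1 - Cmod al) ^ 2) by (field; lra).
    lra.
  - exact (model_open (RtoC 1) phi phi1 (fun _ => 2 * A) psi psi1 (fun _ => 2 * A) D (fun _ => True) d1 d2 d5 d3 d4 d5 Jo D_iff).
  - apply (model_strongly_convex (RtoC 1) phi phi1 (fun _ => 2 * A) psi psi1 (fun _ => 2 * A) D (fun _ => True)); auto.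
    + intros; lra.
    + intros; lra.
    + exists (Ft (RtoC 0)), (RtoC 0). split; auto. unfold unit_disc. rewrite Z. lra.
  - exists (fun w => Cmult w (Cinv (den w))). intros z Hz. unfold unit_disc in Hz.
    pose proof (den_neq_0 z ltac:(lra)) as N. split.
    + rewrite (proj2 (den_Ft z ltac:(lra))) at 1. rewrite <- Cmult_assoc, Cinv_r by auto. ring.
    + eexists. apply cderiv_mult; [apply cderiv_id|].
      apply (cderiv_comp Cinv den); [now apply cderiv_inv|].
      apply cderiv_plus; [apply cderiv_const|apply cderiv_scal, cderiv_id].
Qed.
End Equal_roots.

(** * Distinct roots *)

Lemma exp_plus_exp_opp (x : R) : 2 <= exp x + exp (- x).
Proof.
  rewrite exp_Ropp. pose proof (exp_pos x) as P.
  assert (E : exp x * / exp x = 1) by (apply Rinv_r; lra).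
  assert (0 < / exp x) by (apply Rinv_0_lt_compat; auto).
  assert (0 <= (exp x - / exp x) ^ 2) by apply pow2_ge_0. nra.
Qed.

Lemma RtoC_m1 : RtoC (-1) = Copp (RtoC 1).
Proof. unfold Copp, RtoC; simpl. f_equal; ring. Qed.

(** On this interval the cosine increases up to 0 and decreases afterwards, so its minimum over a
    subinterval sits at an end. *)
Lemma cos_between (a b x : R) : - (PI / 2) < a < PI / 2 -> - (PI / 2) < b < PI / 2 ->
  Rmin a b <= x <= Rmax a b -> Rmin (cos a) (cos b) <= cos x.
Proof.
  intros Ha Hb Hx.
  assert (K : forall u v y, - (PI / 2) < u < PI / 2 -> - (PI / 2) < v < PI / 2 -> u <= y <= v ->
     cos u <= cos y \/ cos v <= cos y).
  { intros u v y Hu Hv Hy. destruct (Rle_dec 0 y).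
    - right. apply cos_decr_1; lra.
    - left. rewrite <- (cos_neg u), <- (cos_neg y). apply cos_decr_1; lra. }
  pose proof (Rmin_l (cos a) (cos b)). pose proof (Rmin_r (cos a) (cos b)).
  unfold Rmin at 1, Rmax in Hx. destruct (Rle_dec a b).
  - destruct (K a b x Ha Hb Hx); lra.
  - destruct (K b a x Hb Ha); lra.
Qed.

(** The cosine is at most 0 from PI/2 to 3 PI/2. The bound three times PI/2 is what two arctangents
    and [eta] give together. *)
Lemma cos_pos_strip (x : R) : Rabs x < 3 * (PI / 2) -> 0 < cos x -> Rabs x < PI / 2.
Proof.
  intros Hx Hc. apply Rnot_le_lt. intros H.
  assert (E : cos x = cos (Rabs x)).
  { unfold Rabs. destruct (Rcase_abs x); auto. now rewrite cos_neg. }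
  rewrite E in Hc. pose proof (cos_le_0 (Rabs x) H) as L. lra.
Qed.

Section Distinct_roots.
Variables (al be : C) (c : R).
Hypothesis Ha : Cmod al < 1.
Hypothesis Hb : Cmod be < 1.
Hypothesis Hne : al <> be.
Hypothesis Hc : 0 < c.
Let d : C := Cminus al be.
Let m : C := Cdiv d (RtoC c).
Let A : R := 1 - Cmod al ^ 2.
Let B : R := 1 - Cmod be ^ 2.
Let E : C := lin al (Cconj be).
Let rho0 : R := exp (fst (clog E)).
Let eta : R := snd (clog E).
(** Its derivative is al / lin al - be / lin be = d / q, hence [m * Ft = L] with F' = c/q. *)
Let L (z : C) : C := Cminus (clog (lin be z)) (clog (lin al z)).
Let Ft (z : C) : C := Cdiv (L z) m.
(** With T = e^(X + iY), |T - 1|^2 - |al T - be|^2 equals A e^(2X) + B - 2 Re (E T). Division by e^X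
    leaves phi(X) + psi(Y), where rho0 e^(i eta) is the polar form of [E]. *)
Let phi (x : R) : R := A * exp x + B * exp (- x).
Let phi1 (x : R) : R := A * exp x - B * exp (- x).
Let psi (y : R) : R := - (2 * rho0 * cos (y + eta)).
Let psi1 (y : R) : R := 2 * rho0 * sin (y + eta).
Let psi2 (y : R) : R := 2 * rho0 * cos (y + eta).
Let J (y : R) : Prop := Rabs (y + eta) < PI / 2.
Let D := fun w : C => exists z, unit_disc z /\ w = Ft z.
Let rho := model_rho m phi psi.
(** At w = [Ft z] this is lin be z / lin al z, and z is recovered as [num w / den w]. *)
Let T (w : C) : C := cexp (Cmult m w).
Let den (w : C) : C := Cminus (Cmult al (T w)) be.
Let num (w : C) : C := Cminus (T w) (RtoC 1).

Let A_pos : 0 < A.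
Proof. unfold A. pose proof (Cmod_ge_0 al). nra. Qed.
Let B_pos : 0 < B.
Proof. unfold B. pose proof (Cmod_ge_0 be). nra. Qed.
Let d_neq : d <> RtoC 0.
Proof. intros H. apply Hne. replace al with (Cplus d be) by (unfold d; ring). rewrite H. ring. Qed.
Let c_neq : RtoC c <> RtoC 0.
Proof. apply RtoC_neq_0; lra. Qed.
Let m_neq : m <> RtoC 0.
Proof. apply Cmult_neq_0; auto. now apply Cinv_nonzero. Qed.
Let m_Ft (z : C) : Cmult m (Ft z) = L z.
Proof. unfold Ft. field. auto. Qed.
Let E_pos : 0 < fst E.
Proof.
  apply lin_re_pos. rewrite Cmod_conj. pose proof (Cmod_ge_0 al). pose proof (Cmod_ge_0 be). nra.
Qed.
Let E_polar : fst E = rho0 * cos eta /\ snd E = rho0 * sin eta.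
Proof.
  split.
  - transitivity (fst (cexp (clog E))); [now rewrite cexp_clog|reflexivity].
  - transitivity (snd (cexp (clog E))); [now rewrite cexp_clog|reflexivity].
Qed.
Let eta_bound : - (PI / 2) < eta < PI / 2.
Proof.
  pose proof (atan_bound (snd E / fst E)) as H.
  change (- (PI / 2) < atan (snd E / fst E) < PI / 2). lra.
Qed.
Let rho0_pos : 0 < rho0.
Proof. unfold rho0. apply exp_pos. Qed.

Let rho_eq (w : C) : exp (fst (Cmult m w)) * rho (fst w) (snd w) = Cmod (num w) ^ 2 - Cmod (den w) ^ 2.
Proof.
  rewrite !Cmod_sqr. unfold rho, model_rho, num, den, T. rewrite <- surjective_pairing.
  destruct (Cmult m w) as [X Y]. simpl fst; simpl snd.
  unfold phi, psi. rewrite exp_Ropp, cos_plus.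
  destruct E_polar as [E1 E2]. pose proof (exp_pos X) as P.
  transitivity (A * (exp X * exp X) + B - 2 * exp X * (rho0 * cos eta * cos Y - rho0 * sin eta * sin Y)); [field; lra|].
  rewrite <- E1, <- E2. unfold A, B, E. rewrite !Cmod_sqr.
  pose proof (sin2_cos2 Y) as S. unfold Rsqr in S.
  transitivity (A * (exp X * exp X) * (sin Y * sin Y + cos Y * cos Y) + B - 2 * exp X * (fst E * cos Y - snd E * sin Y)).
  { rewrite S. unfold A, B, E. rewrite !Cmod_sqr. ring. }
  unfold A, B, E. rewrite !Cmod_sqr. unfold cexp. simpl. ring.
Qed.

Let disc_ok (x z : C) : (x = al \/ x = be) -> Cmod z < radius al be -> lin x z <> RtoC 0 /\ 0 < fst (lin x z).
Proof.
  intros Hx Hz. pose proof (lin_in_disc al be Ha Hb x z Hx Hz) as S.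
  split; [now apply lin_neq_0|now apply lin_re_pos].
Qed.

Let T_lin (z : C) : Cmod z < radius al be -> Cmult (T (Ft z)) (lin al z) = lin be z.
Proof.
  intros Hz. destruct (disc_ok al z (or_introl eq_refl) Hz) as [_ P1].
  destruct (disc_ok be z (or_intror eq_refl) Hz) as [_ P2].
  unfold T. rewrite m_Ft.
  transitivity (Cmult (cexp (L z)) (cexp (clog (lin al z)))); [now rewrite (cexp_clog (lin al z))|].
  rewrite <- cexp_plus. transitivity (cexp (clog (lin be z))); [|now apply cexp_clog].
  f_equal. unfold L. ring.
Qed.

Let den_lin (z : C) : Cmod z < radius al be ->
  Cmult (den (Ft z)) (lin al z) = d /\ Cmult (num (Ft z)) (lin al z) = Cmult d z.
Proof.
  intros Hz. pose proof (T_lin z Hz) as H. unfold den, num. split.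
  - transitivity (Cminus (Cmult al (Cmult (T (Ft z)) (lin al z))) (Cmult be (lin al z))); [ring|].
    rewrite H. unfold lin, d. ring.
  - transitivity (Cminus (Cmult (T (Ft z)) (lin al z)) (lin al z)); [ring|].
    rewrite H. unfold lin, d. ring.
Qed.

Let den_neq (z : C) : Cmod z < radius al be -> den (Ft z) <> RtoC 0.
Proof.
  intros Hz H. apply d_neq. rewrite <- (proj1 (den_lin z Hz)), H. ring.
Qed.

Let num_den (z : C) : Cmod z < radius al be -> num (Ft z) = Cmult z (den (Ft z)).
Proof.
  intros Hz. destruct (den_lin z Hz) as [H1 H2]. destruct (disc_ok al z (or_introl eq_refl) Hz) as [N _].
  transitivity (Cdiv (Cmult (num (Ft z)) (lin al z)) (lin al z)); [field; auto|].
  rewrite H2, <- H1. field. auto.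
Qed.

Let rho_Ft (z : C) : Cmod z < radius al be ->
  exp (fst (Cmult m (Ft z))) * rho (fst (Ft z)) (snd (Ft z)) = (Cmod z ^ 2 - 1) * Cmod (den (Ft z)) ^ 2.
Proof. intros Hz. rewrite rho_eq, num_den by auto. rewrite Cmod_mult. ring. Qed.

Let rad : 1 < radius al be.
Proof. now apply radius_spec. Qed.

Let rho_Ft_le (z : C) : Cmod z <= 1 -> rho (fst (Ft z)) (snd (Ft z)) <= 0.
Proof.
  intros Hz. pose proof (rho_Ft z ltac:(lra)) as H. pose proof (exp_pos (fst (Cmult m (Ft z)))) as P.
  assert (Cmod z ^ 2 <= 1) by (pose proof (Cmod_ge_0 z); nra).
  assert (0 <= Cmod (den (Ft z)) ^ 2) by apply pow2_ge_0.
  assert (0 <= (1 - Cmod z ^ 2) * Cmod (den (Ft z)) ^ 2) by (apply Rmult_le_pos; lra).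
  apply Rmult_le_reg_l with (exp (fst (Cmult m (Ft z)))); lra.
Qed.

Let kap : R := Rmin A B.
Let kap_pos : 0 < kap.
Proof. now apply Rmin_pos. Qed.

(** Since phi'' = phi, this is also the convexity bound for the X coordinate. *)
Let phi_lower (x : R) : 2 * kap <= phi x.
Proof.
  unfold phi. pose proof (exp_plus_exp_opp x). pose proof (exp_pos x). pose proof (exp_pos (- x)).
  pose proof (Rmin_l A B : kap <= A). pose proof (Rmin_r A B : kap <= B). nra.
Qed.

(** [rho <= 0] and [phi > 0] force cos(Y + eta) > 0. As Y is a difference of two arctangents, |Y +
    eta| < 3 PI/2, which leaves only the central interval. *)
Let strip_Ft (z : C) : Cmod z <= 1 -> J (snd (Cmult m (Ft z))).
Proof.
  intros Hz. pose proof (rho_Ft_le z Hz) as H. unfold rho, model_rho in H. rewrite <- surjective_pairing in H.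
  pose proof (phi_lower (fst (Cmult m (Ft z)))) as P.
  apply cos_pos_strip.
  - rewrite m_Ft. unfold L, clog. 
    change (snd (Cminus ?x ?y)) with (snd x - snd y). simpl snd.
    pose proof (atan_bound (snd (lin be z) / fst (lin be z))). pose proof (atan_bound (snd (lin al z) / fst (lin al z))).
    match goal with |- Rabs ?x < _ => replace x with (atan (snd (lin be z) / fst (lin be z)) - atan (snd (lin al z) / fst (lin al z)) + eta) by (simpl; ring) end.
    apply Rabs_def1; lra.
  - unfold psi in H. set (co := cos (snd (Cmult m (Ft z)) + eta)) in *. nra.
Qed.

Let D_iff (w : C) : D w <-> J (snd (Cmult m w)) /\ rho (fst w) (snd w) < 0.
Proof.
  split.
  - intros [z [Hz ->]]. unfold unit_disc in Hz. split; [apply strip_Ft; lra|].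
    pose proof (rho_Ft z ltac:(lra)) as H. pose proof (exp_pos (fst (Cmult m (Ft z)))) as P.
    assert (0 < Cmod (den (Ft z))) by (apply Cmod_gt_0, den_neq; lra).
    assert (0 < Cmod (den (Ft z)) ^ 2) by (apply pow_lt; auto).
    assert (Cmod z ^ 2 < 1) by (pose proof (Cmod_ge_0 z); nra).
    assert (0 < (1 - Cmod z ^ 2) * Cmod (den (Ft z)) ^ 2) by (apply Rmult_lt_0_compat; lra).
    apply Rmult_lt_reg_l with (exp (fst (Cmult m (Ft z)))); lra.
  - intros [HJ H].
    assert (H2 : Cmod (num w) ^ 2 - Cmod (den w) ^ 2 < 0).
    { rewrite <- rho_eq. pose proof (exp_pos (fst (Cmult m w))). nra. }
    pose proof (Cmod_ge_0 (num w)). pose proof (Cmod_ge_0 (den w)).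
    assert (Lt : Cmod (num w) < Cmod (den w)).
    { apply Rnot_le_lt. intros Hle.
      assert (Cmod (den w) ^ 2 <= Cmod (num w) ^ 2) by (apply pow_incr; lra). lra. }
    assert (N : den w <> RtoC 0) by (intros E0; rewrite E0, Cmod_0 in Lt; lra).
    set (z := Cdiv (num w) (den w)).
    assert (Hz : Cmod z < 1).
    { unfold z. rewrite Cmod_div by auto. apply Rmult_lt_reg_r with (Cmod (den w)); [lra|].
      unfold Rdiv. rewrite Rmult_assoc, Rinv_l by lra. lra. }
    exists z. split; auto.
    assert (Hz' : Cmod z < radius al be) by lra.
    destruct (disc_ok al z (or_introl eq_refl) Hz') as [Nz _].
    assert (TT : T (Ft z) = T w).
    { transitivity (Cdiv (Cmult (T (Ft z)) (lin al z)) (lin al z)); [field; auto|].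
      rewrite T_lin by auto.
      assert (La : lin al z = Cdiv d (den w)).
      { unfold lin, z, d, num. unfold den in *. field. exact N. }
      assert (Lb : lin be z = Cdiv (Cmult (T w) d) (den w)).
      { unfold lin, z, d, num. unfold den in *. field. exact N. }
      rewrite La, Lb. field. auto. }
    pose proof (strip_Ft z ltac:(lra)) as HJz. unfold J in HJ, HJz.
    (* Both points lie in one strip of height PI, where exp is injective. *)
    assert (M : Cmult m w = Cmult m (Ft z)).
    { apply cexp_inj_strip; [now symmetry|].
      apply Rabs_def2 in HJ. apply Rabs_def2 in HJz. apply Rabs_def1; lra. }
    transitivity (Cdiv (Cmult m w) m); [field; auto|]. rewrite M. field. auto.
Qed.

Let d1 (x : R) : is_derive phi x (phi1 x).
Proof. unfold phi, phi1; auto_derive; auto; ring. Qed.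
Let d2 (x : R) : is_derive phi1 x (phi x).
Proof. unfold phi, phi1; auto_derive; auto; ring. Qed.
Let d3 (x : R) : is_derive psi x (psi1 x).
Proof. unfold psi, psi1; auto_derive; auto; ring. Qed.
Let d4 (x : R) : is_derive psi1 x (psi2 x).
Proof. unfold psi1, psi2; auto_derive; auto; ring. Qed.
Let d5 (x : R) : continuous phi x.
Proof. apply (ex_derive_continuous phi). eexists; apply d1. Qed.
Let d6 (x : R) : continuous psi2 x.
Proof. apply (ex_derive_continuous (V := R_NormedModule)). unfold psi2. auto_derive. auto. Qed.
Let J_open (y : R) : J y -> exists r, 0 < r /\ forall y', Rabs (y' - y) < r -> J y'.
Proof.
  unfold J. intros H. exists (PI / 2 - Rabs (y + eta)). split; [lra|]. intros y' Hy.
  pose proof (Rabs_triang (y' - y) (y + eta)) as Tr. replace (y' - y + (y + eta)) with (y' + eta) in Tr by ring. lra.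
Qed.
Let J_conv (y1 y2 y : R) : J y1 -> J y2 -> Rmin y1 y2 <= y <= Rmax y1 y2 -> J y.
Proof.
  unfold J. intros H1 H2 H. apply Rabs_def2 in H1. apply Rabs_def2 in H2.
  unfold Rmin, Rmax in H. apply Rabs_def1; destruct (Rle_dec y1 y2); lra.
Qed.
Let psi2_pos (y : R) : J y -> 0 < psi2 y.
Proof.
  unfold J, psi2. intros H. apply Rabs_def2 in H.
  assert (0 < cos (y + eta)) by (apply cos_gt_0; lra). nra.
Qed.

(** psi'' = - psi, and [rho <= 0] gives - psi >= phi >= 2 kap at both ends. Between them the cosine
    is no smaller than at one of the ends, so the convexity constant [kap] serves both
    coordinates. *)
Let psi2_lower (w1 w2 : C) : J (snd (Cmult m w1)) -> J (snd (Cmult m w2)) ->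
  rho (fst w1) (snd w1) <= 0 -> rho (fst w2) (snd w2) <= 0 ->
  forall y, Rmin (snd (Cmult m w1)) (snd (Cmult m w2)) <= y <= Rmax (snd (Cmult m w1)) (snd (Cmult m w2)) ->
  2 * kap <= psi2 y.
Proof.
  unfold rho, model_rho. rewrite <- !surjective_pairing. unfold psi, J, psi2. intros H1 H2 R1 R2 y Hy.
  pose proof (phi_lower (fst (Cmult m w1))). pose proof (phi_lower (fst (Cmult m w2))).
  set (y1 := snd (Cmult m w1)) in *. set (y2 := snd (Cmult m w2)) in *.
  apply Rabs_def2 in H1. apply Rabs_def2 in H2.
  assert (K : Rmin (cos (y1 + eta)) (cos (y2 + eta)) <= cos (y + eta)).
  { apply cos_between; try lra.
    unfold Rmin, Rmax in *. destruct (Rle_dec y1 y2), (Rle_dec (y1 + eta) (y2 + eta)); lra. }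
  unfold Rmin in K. destruct (Rle_dec (cos (y1 + eta)) (cos (y2 + eta))); nra.
Qed.

(* Up to positive factors, the gradient of [rho] at [Ft zeta] is [zeta * conj (q zeta)], the
   outer normal [zeta * F'(zeta)]. *)
Let normal_identity (zeta : C) : Cmod zeta = 1 ->
  Cmult (Cmult (Cmult (RtoC 2) (T (Ft zeta))) (Cminus (Cmult (RtoC A) (Cconj (T (Ft zeta)))) E))
        (RtoC (Cmod (lin al zeta) ^ 2))
  = Cmult (Cmult (RtoC 2) (Cconj d)) (Cmult (Cconj zeta) (qpoly (Copp (Cplus al be)) (Cmult al be) zeta)).
Proof.
  intros Hz. assert (Hr : Cmod zeta < radius al be) by lra.
  pose proof (T_lin zeta Hr) as H.
  assert (H' : Cmult (Cconj (T (Ft zeta))) (Cconj (lin al zeta)) = Cconj (lin be zeta)) by (now rewrite <- Cmult_conj, H).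
  rewrite Cmod_sqr_conj, qpoly_lin.
  transitivity (Cmult (Cmult (RtoC 2) (Cmult (T (Ft zeta)) (lin al zeta)))
    (Cminus (Cmult (RtoC A) (Cmult (Cconj (T (Ft zeta))) (Cconj (lin al zeta)))) (Cmult E (Cconj (lin al zeta))))); [ring|].
  rewrite H, H'.
  pose proof (unit_conj zeta Hz) as U.
  assert (K : Cminus (Cmult (RtoC A) (Cconj (lin be zeta))) (Cmult E (Cconj (lin al zeta)))
     = Cmult (Cconj d) (Cmult (Cconj zeta) (lin al zeta))).
  { unfold A, E, d. rewrite RtoC_minus, Cmod_sqr_conj.
    unfold lin. rewrite !Cminus_conj, !Cmult_conj, Cconj_RtoC.
    transitivity (Cmult (Cminus (Cconj al) (Cconj be)) (Cminus (Cconj zeta) (Cmult al (RtoC 1)))); [ring|].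
    transitivity (Cmult (Cminus (Cconj al) (Cconj be)) (Cminus (Cconj zeta) (Cmult al (Cmult zeta (Cconj zeta)))));
      [now rewrite U|ring]. }
  rewrite K. ring.
Qed.

(** [V] is e^X times the conjugate gradient in the coordinates X, Y. After [normal_identity], the
    factor conj d meets m = d/c and produces |d|^2 / c. *)
Let gradient_identity (zeta De : C) : Cmod zeta = 1 ->
  let w := Ft zeta in
  (phi1 (fst (Cmult m w)) * fst (Cmult m De) + psi1 (snd (Cmult m w)) * snd (Cmult m De))
    * (exp (fst (Cmult m w)) * Cmod (lin al zeta) ^ 2)
  = 2 * Cmod d ^ 2 / c *
    fst (Cmult (Cmult (Cconj zeta) (qpoly (Copp (Cplus al be)) (Cmult al be) zeta)) De).
Proof.
  intros Hz w. assert (Hr : Cmod zeta < radius al be) by lra.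
  set (V := Cmult (Cmult (RtoC 2) (T w)) (Cminus (Cmult (RtoC A) (Cconj (T w))) E)).
  (* [rho = 0] on the image of the circle eliminates B: A e^(2X) - B becomes 2 A e^(2X) - 2 Re (E
     T), a multiple of T as the product form of [V] requires. *)
  assert (HV : (exp (fst (Cmult m w)) * phi1 (fst (Cmult m w)), - (exp (fst (Cmult m w)) * psi1 (snd (Cmult m w)))) = V).
  { pose proof (rho_Ft zeta Hr) as R0. fold w in R0. rewrite Hz in R0.
    replace ((1 ^ 2 - 1) * Cmod (den w) ^ 2) with 0 in R0 by ring.
    unfold rho, model_rho in R0. rewrite <- surjective_pairing in R0.
    destruct E_polar as [E1 E2]. pose proof (surjective_pairing E) as EE. revert EE E1 E2.
    generalize (fst E) (snd E). intros e1 e2 EE E1 E2.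
    unfold V, T. rewrite EE. destruct (Cmult m w) as [X Y].
    simpl fst in R0; simpl snd in R0; simpl fst; simpl snd.
    unfold phi, psi in R0. unfold phi1, psi1. rewrite exp_Ropp, cos_plus in R0. rewrite exp_Ropp, sin_plus.
    pose proof (exp_pos X) as P.
    pose proof (sin2_cos2 Y) as S. unfold Rsqr in S.
    assert (R1 : A * (exp X * exp X) + B - 2 * exp X * (rho0 * cos eta * cos Y - rho0 * sin eta * sin Y) = 0).
    { rewrite <- R0. field. lra. }
    rewrite <- E1, <- E2 in R1.
    unfold cexp, Cconj, Cminus, Cplus, Copp, Cmult, RtoC. simpl fst; simpl snd.
    f_equal.
    - transitivity (A * (exp X * exp X) - B); [field; lra|].
      transitivity (2 * (A * (exp X * exp X)) * (sin Y * sin Y + cos Y * cos Y) - 2 * exp X * (e1 * cos Y - e2 * sin Y)); [rewrite S; lra|ring].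
    - transitivity (- (2 * exp X * (rho0 * cos eta * sin Y + rho0 * sin eta * cos Y))); [ring|].
      rewrite <- E1, <- E2. ring. }
  transitivity (fst (Cmult (Cmult V (RtoC (Cmod (lin al zeta) ^ 2))) (Cmult m De))).
  - rewrite <- HV. generalize (Cmod (lin al zeta) ^ 2); intros n2. destruct (Cmult m De) as [p q].
    simpl. ring.
  - unfold V, w. rewrite normal_identity by auto.
    rewrite <- (fst_real_mult (2 * Cmod d ^ 2 / c)). f_equal.
    unfold Rdiv. rewrite !RtoC_mult, RtoC_inv by lra. rewrite Cmod_sqr_conj. unfold m, Cdiv. ring.
Qed.

Lemma distinct_roots_extension : convex_extension al be c Ft.
Proof.
  assert (F0 : Ft (RtoC 0) = RtoC 0).
  { unfold Ft, L. replace (lin be (RtoC 0)) with (RtoC 1) by (unfold lin; ring).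
    replace (lin al (RtoC 0)) with (RtoC 1) by (unfold lin; ring). unfold Cdiv. ring. }
  assert (D0 : D (RtoC 0)).
  { exists (RtoC 0). split; [unfold unit_disc; rewrite Cmod_0; lra|auto]. }
  split; [exact F0|split; [|split; [|split; [|split]]]].
  - intros z Hz. destruct (disc_ok al z (or_introl eq_refl) Hz) as [N1 P1].
    destruct (disc_ok be z (or_intror eq_refl) Hz) as [N2 P2].
    apply cderiv_ext with (fun z => Cmult (Cinv m) (Cplus (clog (lin be z)) (Cmult (RtoC (-1)) (clog (lin al z))))).
    { intros w. unfold Ft, L, Cdiv. rewrite RtoC_m1. ring. }
    eapply cderiv_eq.
    + apply cderiv_scal. apply cderiv_plus.
      * apply (cderiv_comp clog (lin be)); [now apply cderiv_clog|apply cderiv_lin].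
      * apply cderiv_scal. apply (cderiv_comp clog (lin al)); [now apply cderiv_clog|apply cderiv_lin].
    + rewrite qpoly_lin, RtoC_m1. unfold m. unfold lin, d in *. field. repeat split; auto.
  (* The convexity constant kap |m|^2 = kap |d|^2 / c^2, divided by the factor 2 |d|^2 / c of
     [gradient_identity], leaves kap / (2c). The product of 1 - |al| and 1 - |be| bounds e^X |lin al
     zeta|^2 = |lin be zeta| |lin al zeta| below. *)
  - exists (kap * ((1 - Cmod al) * (1 - Cmod be)) / (2 * c)).
    assert (Pq : 0 < (1 - Cmod al) * (1 - Cmod be)) by (apply Rmult_lt_0_compat; lra).
    split. { apply Rdiv_lt_0_compat; [|lra]. now apply Rmult_lt_0_compat. }
    intros zeta z Hzeta Hz.
    pose proof (rho_Ft_le zeta ltac:(lra)) as Rz. pose proof (rho_Ft_le z ltac:(lra)) as Rw.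
    pose proof (model_convex m phi phi1 phi psi psi1 psi2 J d1 d2 d3 d4 kap (Ft zeta) (Ft z)
      (strip_Ft zeta ltac:(lra)) (strip_Ft z ltac:(lra)) phi_lower
      (psi2_lower (Ft zeta) (Ft z) (strip_Ft zeta ltac:(lra)) (strip_Ft z ltac:(lra)) Rz Rw)) as Q.
    fold rho in Q.
    assert (R0 : rho (fst (Ft zeta)) (snd (Ft zeta)) = 0).
    { pose proof (rho_Ft zeta ltac:(lra)) as R0. rewrite Hzeta in R0.
      pose proof (exp_pos (fst (Cmult m (Ft zeta)))). nra. }
    rewrite R0 in Q.
    pose proof (gradient_identity zeta (Cminus (Ft z) (Ft zeta)) Hzeta) as G. cbv zeta in G.
    set (De := Cminus (Ft z) (Ft zeta)) in *.
    set (P := phi1 _ * _ + psi1 _ * _) in *.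
    set (Y := fst (Cmult (Cmult (Cconj zeta) _) De)) in *.
    assert (N : (1 - Cmod al) * (1 - Cmod be) <= exp (fst (Cmult m (Ft zeta))) * Cmod (lin al zeta) ^ 2).
    { rewrite <- Cmod_cexp. fold (T (Ft zeta)).
      replace (Cmod (T (Ft zeta)) * Cmod (lin al zeta) ^ 2) with (Cmod (Cmult (T (Ft zeta)) (lin al zeta)) * Cmod (lin al zeta))
        by (rewrite Cmod_mult; ring).
      rewrite T_lin by lra.
      assert (S1 : Cmod al * Cmod zeta < 1) by (rewrite Hzeta; lra).
      assert (S2 : Cmod be * Cmod zeta < 1) by (rewrite Hzeta; lra).
      destruct (lin_re_pos al zeta S1) as [_ L1]. destruct (lin_re_pos be zeta S2) as [_ L2].
      rewrite Hzeta, Rmult_1_r in L1, L2. rewrite Rmult_comm. apply Rmult_le_compat; lra. }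
    set (W := exp (fst (Cmult m (Ft zeta))) * Cmod (lin al zeta) ^ 2) in *.
    set (q0 := (1 - Cmod al) * (1 - Cmod be)) in *.
    assert (Hd : 0 < Cmod d) by (apply Cmod_gt_0; auto).
    assert (Em : Cmod m = Cmod d / c).
    { unfold m. rewrite Cmod_div by auto. rewrite Cmod_R, Rabs_right by lra. reflexivity. }
    rewrite Em in Q.
    assert (D2 : 0 <= Cmod De ^ 2) by apply pow2_ge_0.
    assert (X0 : 0 <= kap * (Cmod d / c) ^ 2 * Cmod De ^ 2).
    { apply Rmult_le_pos; auto. apply Rmult_le_pos; [lra|apply pow2_ge_0]. }
    assert (X1 : P * W <= - (kap * (Cmod d / c) ^ 2 * Cmod De ^ 2) * q0).
    { assert (P <= - (kap * (Cmod d / c) ^ 2 * Cmod De ^ 2)) by lra. nra. }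
    rewrite G in X1.
    assert (K : 0 < 2 * Cmod d ^ 2 / c).
    { apply Rdiv_lt_0_compat; auto. assert (0 < Cmod d ^ 2) by (apply pow_lt; auto). lra. }
    apply Rmult_le_reg_l with (2 * Cmod d ^ 2 / c); auto.
    eapply Rle_trans; [exact X1|]. right. field. lra.
  - exact (model_open m phi phi1 phi psi psi1 psi2 D J d1 d2 d5 d3 d4 d6 J_open D_iff).
  - apply (model_strongly_convex m phi phi1 phi psi psi1 psi2 D J); auto.
    + intros x. pose proof (phi_lower x). lra.
    + now exists (RtoC 0).
    (* A boundary point is a limit of points of the strip, so it could leave the open strip only
       through its edge. There the cosine vanishes and [rho = phi > 0], which persists nearby and
       contradicts [rho < 0] on [D]. *)
    + intros p [Hp1 Hp2]. apply Rnot_le_lt. intros Hge.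
      set (Y := snd (Cmult m p)) in *.
      assert (HY : Rabs (Y + eta) <= PI / 2).
      { apply Rnot_lt_le. intros Hgt.
        set (r := Rabs (Y + eta) - PI / 2) in *. assert (Hr : 0 < r) by (unfold r; lra).
        assert (Hq : 0 < r / (Cmod m + 1)) by (apply Rdiv_lt_0_compat; [auto|pose proof (Cmod_ge_0 m); lra]).
        destruct (Hp2 _ Hq) as [q [Hq1 Hq2]]. apply D_iff in Hq2. destruct Hq2 as [Hq2 _].
        pose proof (model_coord_small m p q r Hr Hq1) as S. fold Y in S. unfold J in Hq2.
        pose proof (Rabs_triang (Y - snd (Cmult m q)) (snd (Cmult m q) + eta)) as Tr.
        replace (Y - snd (Cmult m q) + (snd (Cmult m q) + eta)) with (Y + eta) in Tr by ring.
        rewrite Rabs_minus_sym in S. unfold r in S. lra. }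
      assert (CY : cos (Y + eta) = 0).
      { assert (E0 : Rabs (Y + eta) = PI / 2) by lra.
        unfold Rabs in E0. destruct (Rcase_abs (Y + eta)).
        - rewrite <- cos_neg, E0. apply cos_PI2.
        - rewrite E0. apply cos_PI2. }
      destruct (model_sign_stable m phi phi1 phi psi psi1 psi2 d1 d2 d5 d3 d4 d6 p (-1)) as [r [Hr S]].
      { unfold model_rho. rewrite <- surjective_pairing. fold Y.
        unfold psi. rewrite CY. pose proof (phi_lower (fst (Cmult m p))). lra. }
      destruct (Hp2 r Hr) as [q [Hq1 Hq2]]. apply D_iff in Hq2. destruct Hq2 as [_ Hq2].
      specialize (S q Hq1). fold rho in S. lra.
  (* The inverse (T - 1)/(al T - be), with subtractions written as sums and multiples of -1 to fit
     the derivative rules. *)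
  - exists (fun w => Cmult (Cplus (T w) (RtoC (-1))) (Cinv (Cplus (Cmult al (T w)) (Cmult (RtoC (-1)) be)))).
    assert (DE : forall w, Cplus (Cmult al (T w)) (Cmult (RtoC (-1)) be) = den w).
    { intros w. unfold den. rewrite RtoC_m1. ring. }
    intros z Hz. unfold unit_disc in Hz. pose proof (den_neq z ltac:(lra)) as N. split.
    + rewrite DE. replace (Cplus (T (Ft z)) (RtoC (-1))) with (num (Ft z)) by (unfold num; rewrite RtoC_m1; ring).
      rewrite num_den by lra. field. auto.
    + assert (DT : forall w, cderiv T w (Cmult m (T w))).
      { intros w. eapply cderiv_eq.
        - apply (cderiv_comp cexp (Cmult m)); [apply cderiv_cexp|apply cderiv_scal, cderiv_id].
        - unfold T. ring. }
      eexists. apply cderiv_mult.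
      * apply cderiv_plus; [apply DT|apply cderiv_const].
      * apply (cderiv_comp Cinv (fun w => Cplus (Cmult al (T w)) (Cmult (RtoC (-1)) be))).
        -- apply cderiv_inv. now rewrite DE.
        -- apply cderiv_plus; [apply cderiv_scal, DT|apply cderiv_const].
Qed.
End Distinct_roots.

(** * The image domain and its extremal maps *)

Lemma open_set_ext (D D' : C -> Prop) : (forall w, D w <-> D' w) -> open_set D -> open_set D'.
Proof.
  intros E H p Hp. destruct (H p) as [d [Hd K]]; [now apply E|].
  exists d. split; auto. intros q Hq. now apply E, K.
Qed.

Lemma strongly_convex_ext (D D' : C -> Prop) : (forall w, D w <-> D' w) ->
  strongly_convex D -> strongly_convex D'.
Proof.
  intros E [U [rho [H1 [H2 [H3 [H4 H5]]]]]].
  assert (B : forall p, boundary_pt D' p -> boundary_pt D p).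
  { intros p [P1 P2]. split.
    - now rewrite E.
    - intros eps He. destruct (P2 eps He) as [q [Q1 Q2]]. exists q. now rewrite E. }
  exists U, rho. split; auto. split; [auto|]. split; auto. split.
  - intros x y Hp. rewrite <- E. auto.
  - intros x y Hp. auto.
Qed.

(** * Connectedness of the image *)

Lemma segment_dist (z w : C) (s t : R) :
  Cmod (Cminus (segment z w s) (segment z w t)) = Rabs (s - t) * Cmod (Cminus w z).
Proof.
  rewrite <- Cmod_R, <- Cmod_mult. f_equal.
  unfold segment, Cminus, Cplus, Copp, Cmult, RtoC; simpl. f_equal; ring.
Qed.

(** A separation of [D] would split the image of the segment between two preimages. Take the
    supremum x of the initial stretches mapped into [A]: if the image of x is in [A], openness
    prolongs the stretch, or reaches the far end; if it is in [B], openness puts earlier points in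
    both sets. *)
Lemma connected_image (F : C -> C) (D : C -> Prop) (K : R) :
  (forall z, unit_disc z -> D (F z)) -> (forall w, D w -> exists z, unit_disc z /\ w = F z) ->
  (forall z w, unit_disc z -> unit_disc w -> Cmod (Cminus (F w) (F z)) <= K * Cmod (Cminus w z)) ->
  connected_set D.
Proof.
  intros HF HD HK A B HA HB Cov Dis [p [Dp Ap]] [q [Dq Bq]].
  destruct (HD p Dp) as [z0 [Hz0 E0]]. destruct (HD q Dq) as [z1 [Hz1 E1]]. subst p q.
  set (g := fun s => F (segment z0 z1 s)).
  assert (Hseg : forall s, 0 <= s <= 1 -> unit_disc (segment z0 z1 s)).
  { intros s Hs. now apply segment_disc. }
  destruct (segment_ends z0 z1) as [S0 S1].
  assert (Stable : forall P : C -> Prop, open_set P -> forall s, 0 <= s <= 1 -> P (g s) ->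
    exists e, 0 < e /\ forall t, 0 <= t <= 1 -> Rabs (t - s) < e -> P (g t)).
  { intros P HP s Hs Ps. destruct (HP _ Ps) as [e [He H]].
    (* The absolute value and the added 1 make the speed bound positive even if [K] is negative or
       the two ends coincide. *)
    set (M := Rabs K * Cmod (Cminus z1 z0) + 1).
    assert (HM : 0 < M).
    { unfold M. pose proof (Rabs_pos K). pose proof (Cmod_ge_0 (Cminus z1 z0)).
      assert (0 <= Rabs K * Cmod (Cminus z1 z0)) by (apply Rmult_le_pos; auto). lra. }
    exists (e / M). split; [apply Rdiv_lt_0_compat; auto|]. intros t Ht Hts.
    apply H. eapply Rle_lt_trans; [apply HK; apply Hseg; auto|].
    rewrite segment_dist.
    apply Rle_lt_trans with (M * Rabs (t - s)).
    - unfold M. pose proof (Rle_abs K). pose proof (Rabs_pos (t - s)). pose proof (Cmod_ge_0 (Cminus z1 z0)).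
      assert (0 <= Rabs (t - s) * Cmod (Cminus z1 z0)) by (apply Rmult_le_pos; auto). nra.
    - replace e with (M * (e / M)) by (field; lra). apply Rmult_lt_compat_l; auto. }
  set (S := fun x => 0 <= x <= 1 /\ forall s, 0 <= s <= x -> A (g s)).
  assert (A0 : A (g 0)) by (unfold g; now rewrite S0).
  assert (SZ : S 0).
  { split; [lra|]. intros s Hs. now replace s with 0 by lra. }
  destruct (completeness S) as [x [Ux Lx]].
  { exists 1. intros y [Hy _]. lra. }
  { now exists 0. }
  assert (Hx : 0 <= x <= 1).
  { split; [now apply Ux|]. apply Lx. intros y [Hy _]. lra. }
  assert (Near : forall e, 0 < e -> exists y, S y /\ x - e < y <= x).
  { intros e He. apply NNPP. intros N. assert (x <= x - e); [|lra].
    apply Lx. intros y Hy. apply Rnot_lt_le. intros L. apply N. exists y. split; auto. }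
  destruct (Cov (g x)) as [Ax|Bx]; [apply HF, Hseg, Hx| |].
  - destruct (Stable A HA x Hx Ax) as [e [He H]].
    destruct (Near e He) as [y [[Hy Sy] Hyx]].
    assert (Ext : forall s, 0 <= s <= 1 -> s < x + e -> A (g s)).
    { intros s Hs Hse. destruct (Rle_dec s y); [apply Sy; lra|].
      apply H; auto. apply Rabs_def1; lra. }
    destruct (Rlt_dec 1 (x + e)).
    + apply (Dis (F z1)). split; auto. split; auto. rewrite <- S1. apply Ext; lra.
    + assert (x + e / 2 <= x); [|lra]. apply Ux. split; [lra|]. intros s Hs. apply Ext; lra.
  - destruct (Stable B HB x Hx Bx) as [e [He H]].
    destruct (Near e He) as [y [[Hy Sy] Hyx]].
    apply (Dis (g y)). split; [apply HF, Hseg, Hy|]. split; [apply Sy; lra|].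
    apply H; auto. apply Rabs_def1; lra.
Qed.

Lemma convex_extension_ex (al be : C) (c : R) : Cmod al < 1 -> Cmod be < 1 -> 0 < c ->
  exists Ft, convex_extension al be c Ft.
Proof.
  intros Ha Hb Hc. destruct (classic (al = be)) as [<-|Hne].
  - eexists. now apply equal_roots_extension.
  - eexists. now apply distinct_roots_extension.
Qed.

Section Image.
Variables (al be : C) (c : R) (F Ft : C -> C).
Hypothesis Ha : Cmod al < 1.
Hypothesis Hb : Cmod be < 1.
Hypothesis Hc : 0 < c.
Let a : C := Copp (Cplus al be).
Let lam : C := Cmult al be.
Let F1 (z : C) : C := Cdiv (RtoC c) (qpoly a lam z).
Hypothesis HFt : convex_extension al be c Ft.
Hypothesis F0 : F (RtoC 0) = RtoC 0.
Hypothesis DF : forall z, unit_disc z -> cderiv F z (F1 z).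
Let D := fun w : C => exists z, unit_disc z /\ w = F z.

Let rad : 1 < radius al be.
Proof. now apply radius_spec. Qed.

(** Both have derivative c/q and value 0 at 0. Through this the given [F] inherits the boundary
    behaviour of the explicit [Ft]. *)
Let F_eq (z : C) : unit_disc z -> F z = Ft z.
Proof.
  destruct HFt as [Z [DFt _]].
  apply (primitive_unique F Ft F1 1 Rlt_0_1); auto.
  - intros w Hw. apply DFt. lra.
  - now rewrite Z.
Qed.

Let D_eq (w : C) : (exists z, unit_disc z /\ w = Ft z) <-> D w.
Proof.
  split; intros [z [Hz E]]; exists z; split; auto; rewrite E; [symmetry|]; now apply F_eq.
Qed.

Let F_lipschitz : exists K, forall z w, unit_disc z -> unit_disc w ->
  Cmod (Cminus (F w) (F z)) <= 2 * K * Cmod (Cminus w z).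
Proof.
  destruct (quot_calculus al be c Ha Hb Hc) as [_ [_ [K HK]]].
  exists K. apply (disc_lipschitz F F1 1 K). intros z Hz. split; auto. apply HK. lra.
Qed.

Lemma image_biholomorphic : biholomorphic unit_disc D F.
Proof.
  destruct HFt as [_ [_ [_ [_ [_ [G HG]]]]]].
  assert (HGF : forall z, unit_disc z -> G (F z) = z).
  { intros z Hz. rewrite F_eq by auto. now apply HG. }
  split; [|split].
  - intros z Hz. eexists. now apply DF.
  - intros z Hz. now exists z.
  - exists G. repeat split.
    + intros w [z [Hz ->]]. rewrite F_eq by auto. now apply HG.
    + intros w [z [Hz ->]]. now rewrite HGF.
    + exact HGF.
    + intros w [z [Hz ->]]. now rewrite HGF.
Qed.

Let disc_0 : unit_disc (RtoC 0).
Proof. unfold unit_disc. rewrite Cmod_0. lra. Qed.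

Lemma image_bounded : bounded_set D.
Proof.
  destruct F_lipschitz as [K HK]. exists (2 * Rabs K). intros w [z [Hz ->]].
  pose proof (HK (RtoC 0) z disc_0 Hz) as L. rewrite F0 in L.
  replace (Cminus (F z) (RtoC 0)) with (F z) in L by ring.
  replace (Cminus z (RtoC 0)) with z in L by ring.
  unfold unit_disc in Hz. pose proof (Cmod_ge_0 z). pose proof (Rle_abs K). pose proof (Rabs_pos K). nra.
Qed.

Lemma image_domain : plane_domain D.
Proof.
  destruct F_lipschitz as [K HK].
  split; [|split].
  - apply (open_set_ext _ _ D_eq). apply HFt.
  - apply (connected_image F D (2 * K)); auto. intros z Hz. now exists z.
  - exists (F (RtoC 0)), (RtoC 0). auto.
Qed.

Lemma image_strongly_convex : strongly_convex D.
Proof. apply (strongly_convex_ext _ _ D_eq). apply HFt. Qed.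

Lemma conformal2_form (L : mat2) : conformal2 L -> exists k s e, 0 <= k /\ e * e = 1 /\
  L = Mat2 (k * cos s) (- e * (k * sin s)) (k * sin s) (e * (k * cos s)) /\ opnorm L = Finite k.
Proof.
  intros [k [O [Hk [HO [E1 [E2 [E3 E4]]]]]]].
  pose proof (opnorm_conformal L O k Hk HO E1 E2 E3 E4) as N.
  destruct (orthogonal2_form O HO) as [s [e [He [O1 [O2 [O3 O4]]]]]].
  exists k, s, e. repeat split; auto.
  rewrite O1 in E1. rewrite O2 in E3. rewrite O3 in E2. rewrite O4 in E4.
  destruct L as [l1 l2 l3 l4]; simpl in *. rewrite E1, E2, E3, E4. f_equal; ring.
Qed.

Lemma admissible_bound (f : C -> C) : admissible D (RtoC 0) f ->
  exists k s e, e * e = 1 /\ opnorm (diff_at f 0 0) = Finite k /\ k <= c /\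
    (k = c -> forall z, unit_disc z -> f z = F (twist (cis s) e z)).
Proof.
  intros [Hf [HfD [Hf0 Hcf]]].
  destruct (conformal2_form _ Hcf) as [k [s [e [Hk [He [HL N]]]]]].
  destruct (quot_calculus al be c Ha Hb Hc) as [D1 [D2 [K HK]]].
  destruct HFt as [Ft0 [D0 [[delta [Hdelta Key]] _]]].
  assert (HfD' : forall z, unit_disc z -> exists w, unit_disc w /\ f z = Ft w).
  { intros z Hz. apply D_eq. auto. }
  exists k, s, e. repeat split; auto.
  - exact (extremal_bound a lam c (radius al be) K delta Ft _ rad Hdelta Ft0 D0 D1 D2 HK Key f s e k
      He Hf HfD' Hf0 HL Hk).
  - intros Hkc z Hz. rewrite F_eq.
    + exact (extremal_unique a lam c (radius al be) K delta Ft _ rad Hc Hdelta Ft0 D0 D1 D2 HK Key f s e k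
        He Hf HfD' Hf0 HL Hkc z Hz).
    + unfold unit_disc. rewrite (Cmod_twist s e He). exact Hz.
Qed.

Lemma twist_attains_bound (f : C -> C) (s e : R) : e * e = 1 ->
  (forall z, unit_disc z -> f z = F (twist (cis s) e z)) ->
  admissible D (RtoC 0) f /\ opnorm (diff_at f 0 0) = Finite c.
Proof.
  intros He Hf.
  destruct (quot_calculus al be c Ha Hb Hc) as [D1 [D2 _]].
  destruct HFt as [Ft0 [D0 _]].
  assert (Htw : forall z, unit_disc z -> unit_disc (twist (cis s) e z)).
  { intros z Hz. unfold unit_disc. rewrite (Cmod_twist s e He). exact Hz. }
  assert (Htw' : forall z, unit_disc z -> Cmod (twist (cis s) e z) < radius al be).
  { intros z Hz. apply Htw in Hz. unfold unit_disc in Hz. lra. }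
  destruct (harmonic_twist Ft F1 (dquot a lam c) (fun z => Cmod z < radius al be) unit_disc (cis s) e
    (disc_open 1) Htw' He D0 D1 D2) as [H1 H2].
  destruct (harmonic_on_ext unit_disc (fun z => Ft (twist (cis s) e z)) f (disc_open 1)) as [H3 H4]; auto.
  { intros z Hz. rewrite Hf by auto. symmetry. apply F_eq. auto. }
  assert (T0 : twist (cis s) e (0, 0) = RtoC 0).
  { unfold twist, cis, RtoC, Cmult; simpl. f_equal; ring. }
  assert (HL : diff_at f 0 0 = Mat2 (c * cos s) (- e * (c * sin s)) (c * sin s) (e * (c * cos s))).
  { rewrite H4, H2 by exact disc_0. rewrite T0.
    replace (F1 (RtoC 0)) with (RtoC c).
    - simpl. f_equal; ring.
    - unfold F1, qpoly. field. }
  assert (HO : orthogonal2 (Mat2 (cos s) (- e * sin s) (sin s) (e * cos s))).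
  { pose proof (sin2_cos2 s) as S. unfold Rsqr in S. unfold orthogonal2; simpl.
    repeat split; [lra| |ring].
    transitivity (e * e * (sin s * sin s + cos s * cos s)); [|rewrite He, S]; ring. }
  split.
  - split; [exact H3|]. split; [|split].
    + intros z Hz. exists (twist (cis s) e z). split; auto.
    + rewrite Hf by exact disc_0. rewrite T0. exact F0.
    + exists c. eexists. split; [lra|]. split; [exact HO|]. rewrite HL. simpl. repeat split; ring.
  - apply (opnorm_conformal _ _ c (Rlt_le _ _ Hc) HO); rewrite HL; simpl; ring.
Qed.

Let twist_rot (s : R) (z : C) : twist (cis s) 1 z = Cmult (cis s) z.
Proof. unfold twist. destruct z. simpl fst; simpl snd. now rewrite Rmult_1_l. Qed.

Let twist_refl (s : R) (z : C) : twist (cis s) (-1) z = Cmult (cis s) (Cconj z).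
Proof. unfold twist, Cconj. f_equal. f_equal. ring. Qed.

Lemma M_D_image : M_D D (RtoC 0) = Finite c.
Proof.
  apply is_lub_Rbar_unique. split.
  - intros r [f [Hf N]]. destruct (admissible_bound f Hf) as [k [s [e [_ [N' [Hk _]]]]]].
    rewrite N in N'. injection N' as ->. exact Hk.
  (* The bound is attained by [F] itself, the twist with angle 0 and [e = 1]. *)
  - intros b Hb'. apply Hb'. exists F.
    apply (twist_attains_bound F 0 1); [ring|].
    intros z Hz. f_equal. rewrite twist_rot.
    unfold cis. rewrite cos_0, sin_0. change (z = Cmult (RtoC 1) z). ring.
Qed.

Lemma extremal_iff_twist (f : C -> C) :
  (admissible D (RtoC 0) f /\ opnorm (diff_at f 0 0) = M_D D (RtoC 0)) <->
  ((exists theta : R, forall z, unit_disc z -> f z = F (Cmult (cis theta) z)) \/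
   (exists theta : R, forall z, unit_disc z -> f z = F (Cmult (cis theta) (Cconj z)))).
Proof.
  rewrite M_D_image. split.
  - intros [Hf N]. destruct (admissible_bound f Hf) as [k [s [e [He [N' [_ Hu]]]]]].
    rewrite N in N'. injection N' as Hk. specialize (Hu (eq_sym Hk)).
    assert (E : e = 1 \/ e = -1).
    { assert (P : (e - 1) * (e + 1) = 0) by lra. apply Rmult_integral in P. destruct P; [left|right]; lra. }
    destruct E as [-> | ->]; [left|right]; exists s; intros z Hz; rewrite Hu by auto; f_equal.
    + apply twist_rot.
    + apply twist_refl.
  - intros [[s Hs]|[s Hs]].
    + apply (twist_attains_bound f s 1); [ring|]. intros z Hz. rewrite Hs by auto. f_equal. symmetry. apply twist_rot.
    + apply (twist_attains_bound f s (-1)); [ring|]. intros z Hz. rewrite Hs by auto. f_equal. symmetry. apply twist_refl.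
Qed.
End Image.

Theorem theorem1p1 (a lam : C) (c : R) (F : C -> C) :
  (forall z : C, Cmod z <= 1 ->
     Cplus (Cplus (RtoC 1) (Cmult a z)) (Cmult lam (Cmult z z)) <> RtoC 0) ->
  0 < c ->
  F (RtoC 0) = RtoC 0 ->
  (forall z : C, unit_disc z ->
     cderiv F z (Cdiv (RtoC c)
       (Cplus (Cplus (RtoC 1) (Cmult a z)) (Cmult lam (Cmult z z))))) ->
  let D := fun w : C => exists z, unit_disc z /\ w = F z in
  biholomorphic unit_disc D F /\ bounded_set D /\ plane_domain D /\ strongly_convex D /\
  M_D D (RtoC 0) = Finite (Cmod (Cdiv (RtoC c) (Cplus (Cplus (RtoC 1) (Cmult a (RtoC 0))) (Cmult lam (Cmult (RtoC 0) (RtoC 0)))))) /\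
  M_D D (RtoC 0) = Finite c /\
  (forall f : C -> C,
     (admissible D (RtoC 0) f /\ opnorm (diff_at f 0 0) = M_D D (RtoC 0)) <->
     ((exists theta : R, forall z, unit_disc z -> f z = F (Cmult (cis theta) z)) \/
      (exists theta : R, forall z, unit_disc z -> f z = F (Cmult (cis theta) (Cconj z))))).
Proof.
  intros Hq Hc F0 DF D.
  destruct (qpoly_factor a lam Hq) as [al [be [Ha [Hb [-> ->]]]]].
  destruct (convex_extension_ex al be c Ha Hb Hc) as [Ft HFt].
  split; [exact (image_biholomorphic al be c F Ft Ha Hb HFt F0 DF)|].
  split; [exact (image_bounded al be c F Ha Hb Hc F0 DF)|].
  split; [exact (image_domain al be c F Ft Ha Hb Hc HFt F0 DF)|].
  split; [exact (image_strongly_convex al be c F Ft Ha Hb HFt F0 DF)|].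
  pose proof (M_D_image al be c F Ft Ha Hb Hc HFt F0 DF) as M. fold D in M.
  split; [|split; [exact M|]].
  - rewrite M. f_equal.
    replace (Cdiv _ _) with (RtoC c) by field.
    rewrite Cmod_R, Rabs_right; lra.
  - exact (extremal_iff_twist al be c F Ft Ha Hb Hc HFt F0 DF).
Qed.
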